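(* Let $n\ge 1$, $m\ge 0$, $t\ge 1$ be integers and let $r_1,\dots,r_t>1$ be integers such that $r_{i+1}$ divides $r_i$ for $1\le i\le t-1$. Let $$G=\underbrace{\mathbb{Z}\stackrel{n}{*}\cdots\stackrel{n}{*}\mathbb{Z}}_{m\text{ copies}}\stackrel{n}{*}\mathbb{Z}_{r_1}\stackrel{n}{*}\cdots\stackrel{n}{*}\mathbb{Z}_{r_t}$$ be the $n$th nilpotent product of these $m+t$ cyclic groups. If $c\ge n$ and $\gcd(p,r_1)=1$ for all primes $p\le n$, then the $c$-nilpotent multiplier of $G$ satisfies $$\mathcal{N}_cM(G)\;\cong\;\mathbb{Z}^{(d_m)}\oplus\mathbb{Z}_{r_1}^{(d_{m+1}-d_m)}\oplus\cdots\oplus\mathbb{Z}_{r_t}^{(d_{m+t}-d_{m+t-1})},$$ where $d_k=\sum_{i=1}^{n}\chi_{c+i}(k)$ for $m\le k\le m+t$.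
   Context: Notation: $\mathbb{Z}_r$ is the cyclic group of order $r$, and $A^{(d)}$ denotes the direct sum of $d$ copies of an abelian group $A$. $\gamma_k(H)$ denotes the $k$th term of the lower central series of a group $H$ ($\gamma_1(H)=H$, $\gamma_{k+1}(H)=[\gamma_k(H),H]$). The $n$th nilpotent product of a family of cyclic groups $\{G_i\}_{i\in I}$ is $P/\gamma_{n+1}(P)$, where $P$ is the free product of the $G_i$. For a group $G$ with a free presentation $G\cong F/R$ ($F$ free, $R$ normal in $F$), the $c$-nilpotent multiplier of $G$ (its Baer invariant with respect to the variety of nilpotent groups of class at most $c$) is the abelian group $$\mathcal{N}_cM(G)=\frac{R\cap\gamma_{c+1}(F)}{[R,\,{}_cF]},$$ where $[R,\,{}_cF]=[R,F,\dots,F]$ (left-normed, $F$ repeated $c$ times). Up to isomorphism it does not depend on the choice of free presentation. For integers $k\ge1$, $d\ge0$, $\chi_k(d)=\frac1k\sum_{e\mid k}\mu(e)\,d^{k/e}$, where $\mu$ is the Möbius function; this is the number of basic commutators of weight $k$ on $d$ letters (so $\chi_k(0)=0$). *)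

(* Defs.v *)
From HB Require Import structures.
From mathcomp Require Import all_boot all_order all_algebra.
From mathcomp Require Import generic_quotient.
From mathcomp Require Import boolp classical_sets.

Set Implicit Arguments.
Unset Strict Implicit.
Unset Printing Implicit Defensive.

Import Algebra GRing.Theory.

Local Open Scope classical_set_scope.
Local Open Scope quotient_scope.
Local Open Scope group_scope.

Definition isomorphic (G H : groupType) : Prop :=
  exists f : {multiplicative G -> H}, bijective f.

Section Subgroups.
Variable G : groupType.
Implicit Types A B : set G.

Definition is_subgroup A : Prop := A 1 /\ forall x y, A x -> A y -> A (x / y).

Definition is_normal A : Prop :=
  is_subgroup A /\ forall x y, A x -> A (x ^ y).

Record normal_subgroup := NormalSubgroup {
  normal_set :> set G;
  normal_setP : is_normal normal_set }.

Definition commutator_subgroup A B : set G :=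
  smallest is_subgroup [set [~ x, y] | x in A & y in B].

(* [A, G, ..., G], left-normed, with [c] copies of [G] *)
Definition iter_commutator (c : nat) A : set G :=
  iter c (fun B => commutator_subgroup B setT) A.

(* Indexed from 1, with [lower_central 1 = setT]; the index 0 is a junk value *)
Definition lower_central (k : nat) : set G := iter_commutator k.-1 setT.

Lemma is_subgroup1 A : is_subgroup A -> A 1.
Proof. by case. Qed.

Lemma is_subgroupV A x : is_subgroup A -> A x -> A x^-1.
Proof. by case=> A1 AF Ax; rewrite -div1g; apply: AF. Qed.

Lemma is_subgroupM A x y : is_subgroup A -> A x -> A y -> A (x * y).
Proof.
move=> sA Ax Ay; rewrite -[y]invgK; apply: sA.2 => //.
exact: is_subgroupV.
Qed.

Lemma is_normalT : is_normal setT.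
Proof. by []. Qed.

Lemma is_normalI A B : is_normal A -> is_normal B -> is_normal (A `&` B).
Proof.
move=> [[A1 AF] AJ] [[B1 BF] BJ]; split; first split=> //.
  by move=> x y [Ax Bx] [Ay By]; split; [apply: AF|apply: BF].
by move=> x y [Ax Bx]; split; [apply: AJ|apply: BJ].
Qed.

Lemma smallest_is_subgroup A : is_subgroup (smallest is_subgroup A).
Proof.
split; first by move=> H [[]].
move=> x y Sx Sy H sH; have [[_ HF] _] := sH.
by apply: HF; [apply: Sx|apply: Sy].
Qed.

Lemma commutator_subgroup_normal A B :
  is_normal A -> is_normal B -> is_normal (commutator_subgroup A B).
Proof.
move=> [_ AJ] [_ BJ]; split; first exact: smallest_is_subgroup.
move=> x z Cx.
apply: (Cx [set u | commutator_subgroup A B (u ^ z)]); split=> [|u /=].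
  have sC := smallest_is_subgroup [set [~ x, y] | x in A & y in B].
  split=> [|u v /= Cu Cv]; first by rewrite /= conj1g; exact: is_subgroup1.
  by rewrite conjMg conjVg; exact: sC.2.
move=> [a Aa [b Bb <-]] H [sH sub]; apply: sub.
by exists (a ^ z); [exact: AJ|exists (b ^ z); [exact: BJ|rewrite conjRg]].
Qed.

Lemma commutator_subgroupS A A' B :
  A `<=` A' -> commutator_subgroup A B `<=` commutator_subgroup A' B.
Proof.
move=> sAA' x Cx H [sH sub]; apply: Cx; split=> // _ [a Aa [b Bb <-]].
by apply: sub; exists a; [exact: sAA'|exists b].
Qed.

Lemma iter_commutatorS c A A' :
  A `<=` A' -> iter_commutator c A `<=` iter_commutator c A'.
Proof. by move=> sAA'; elim: c => //= c IH; exact: commutator_subgroupS. Qed.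

Lemma iter_commutator_sub c A : is_normal A -> iter_commutator c A `<=` A.
Proof.
move=> [sA AJ]; elim: c => //= c IH x Cx; apply: Cx; split=> //.
move=> _ [a Aa [b _ <-]]; apply: is_subgroupM => //.
  by apply: is_subgroupV => //; exact: IH.
exact: AJ (IH _ Aa).
Qed.

Lemma iter_commutator_normal c A : is_normal A -> is_normal (iter_commutator c A).
Proof.
move=> nA; elim: c => //= c IH; exact: commutator_subgroup_normal.
Qed.

Lemma lower_central_normal k : is_normal (lower_central k).
Proof. exact: iter_commutator_normal. Qed.

End Subgroups.

(* The quotient group G / N: a quotient of [G] by x ~ y <-> x^-1 y \in N. *)
Section Quotient.
Variables (G : groupType) (N : normal_subgroup G).

Definition coset_rel : rel G := fun x y => `[< normal_set N (x^-1 * y) >].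

Lemma coset_rel_refl : reflexive coset_rel.
Proof. by move=> x; apply/asboolP; rewrite mulVg; case: (normal_setP N).1. Qed.

Lemma coset_rel_sym : symmetric coset_rel.
Proof.
have sN := (normal_setP N).1.
move=> x y; apply/asboolP/asboolP => /(is_subgroupV sN);
  by rewrite invgM invgK.
Qed.

Lemma coset_rel_trans : transitive coset_rel.
Proof.
move=> y x z /asboolP xy /asboolP yz; apply/asboolP.
rewrite -(mulVKg y z) mulgA.
by apply: is_subgroupM => //; exact: (normal_setP N).1.
Qed.

Canonical coset_equiv :=
  EquivRel coset_rel coset_rel_refl coset_rel_sym coset_rel_trans.

Definition quotient_group := {eq_quot coset_equiv}.

HB.instance Definition _ := Choice.on quotient_group.
HB.instance Definition _ := EqQuotient.on quotient_group.

Definition quotient_one := lift_cst quotient_group (1 : G).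
Definition quotient_mul := lift_op2 quotient_group (fun x y : G => x * y).
Definition quotient_inv := lift_op1 quotient_group (fun x : G => x^-1).

Lemma pi_cosetP (x y : G) :
  reflect (\pi_quotient_group x = \pi_quotient_group y) `[< normal_set N (x^-1 * y) >].
Proof. by apply: (iffP idP) => [h|/eqmodP]; first exact/eqmodP. Qed.

Lemma repr_coset (x : G) :
  normal_set N ((repr (\pi_quotient_group x))^-1 * x).
Proof. by apply/asboolP/pi_cosetP; rewrite reprK. Qed.

Lemma pi_quotientM (x y : G) :
  \pi_quotient_group (x * y) = quotient_mul (\pi x) (\pi y).
Proof.
have [sN NJ] := normal_setP N; unlock quotient_mul; apply/esym/pi_cosetP/asboolP.
have Nx := repr_coset x; have Ny := repr_coset y.
set x' := repr _ in Nx *; set y' := repr _ in Ny *.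
have -> : (x' * y')^-1 * (x * y) = (x'^-1 * x) ^ y' * (y'^-1 * y).
  by rewrite /conjg invgM !mulgA mulgK.
by apply: is_subgroupM => //; exact: NJ.
Qed.

Lemma pi_quotient1 : \pi_quotient_group 1 = quotient_one.
Proof. by unlock quotient_one. Qed.

Lemma quotient_invE a : quotient_inv a = \pi_quotient_group ((repr a)^-1).
Proof. by unlock quotient_inv. Qed.

Lemma quotient_mulA : associative quotient_mul.
Proof.
move=> a b c; rewrite -[a]reprK -[b]reprK -[c]reprK.
by rewrite -!pi_quotientM mulgA.
Qed.

Lemma quotient_mul1 : left_id quotient_one quotient_mul.
Proof. by move=> a; rewrite -[a]reprK -pi_quotient1 -pi_quotientM mul1g. Qed.

Lemma quotient_mulr1 : right_id quotient_one quotient_mul.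
Proof. by move=> a; rewrite -[a]reprK -pi_quotient1 -pi_quotientM mulg1. Qed.

Lemma quotient_mulV : left_inverse quotient_one quotient_inv quotient_mul.
Proof.
move=> a; rewrite quotient_invE -{2}[a]reprK -pi_quotientM mulVg.
exact: pi_quotient1.
Qed.

Lemma quotient_mulrV : right_inverse quotient_one quotient_inv quotient_mul.
Proof.
move=> a; rewrite quotient_invE -{1}[a]reprK -pi_quotientM mulgV.
exact: pi_quotient1.
Qed.

HB.instance Definition _ := isGroup.Build quotient_group
  quotient_mulA quotient_mul1 quotient_mulr1 quotient_mulV quotient_mulrV.

End Quotient.

Section SubgroupType.
Variables (G : groupType) (H : normal_subgroup G).

Definition subgroup_type := set_type H.

HB.instance Definition _ := SubChoice.on subgroup_type.

Lemma mem_subgroup_closed : group_closed (fun x : G => x \in (H : set G)).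
Proof.
have [[H1 HF] _] := normal_setP H.
split=> [|x y]; first exact/mem_set.
by move=> /set_mem Hx /set_mem Hy; apply/mem_set/HF.
Qed.

HB.instance Definition _ := SubChoice_isSubGroup.Build G _ subgroup_type
  mem_subgroup_closed.

Lemma restrict_normal (N : normal_subgroup G) :
  is_normal [set x : subgroup_type | normal_set N (val x)].
Proof.
have [[N1 NF] NJ] := normal_setP N.
pose v : UMagmaMorphism.type subgroup_type G := (val : subgroup_type -> G).
split; first split=> [|x y Nx Ny]; rewrite /mkset.
- by rewrite (gmulf1 (s := v)).
- by rewrite (gmulfF v); exact: NF.
- by move=> x y Nx; rewrite /mkset (gmulfJ v); exact: NJ.
Qed.

Definition restrict (N : normal_subgroup G) := NormalSubgroup (restrict_normal N).

End SubgroupType.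

Section NilpotentMultiplier.
Variables (c : nat) (F : groupType) (R : normal_subgroup F).

Definition multiplier_num : normal_subgroup F := NormalSubgroup
  (is_normalI (normal_setP R) (lower_central_normal F c.+1)).

Definition multiplier_den : normal_subgroup F :=
  NormalSubgroup (iter_commutator_normal c (normal_setP R)).

Lemma multiplier_den_sub : multiplier_den `<=` multiplier_num.
Proof.
move=> x Cx; split.
  exact: iter_commutator_sub (normal_setP R) _ Cx.
exact: iter_commutatorS (@subsetT _ R) _ Cx.
Qed.

(* [restrict] intersects [multiplier_den] with [multiplier_num]; by
   [multiplier_den_sub] nothing is lost. *)
Definition nilpotent_multiplier : groupType :=
  quotient_group (restrict multiplier_num multiplier_den).

End NilpotentMultiplier.

Definition is_free (F : groupType) : Prop :=
  exists (X : Type) (i : X -> F), forall (H : groupType) (f : X -> H),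
    exists2 phi : {multiplicative F -> H}, (forall x, phi (i x) = f x) &
    forall psi : {multiplicative F -> H}, (forall x, psi (i x) = f x) ->
      psi =1 phi.

Section FreeProduct.
Variables (I : choiceType) (G_ : I -> groupType).

Definition letter := {i : I & G_ i}.

(* The smallest congruence on words in the elements of the factors that
   multiplies adjacent letters of a factor and erases its unit. *)
Inductive word_eqv : seq letter -> seq letter -> Prop :=
| word_refl w : word_eqv w w
| word_sym v w : word_eqv v w -> word_eqv w v
| word_trans u v w : word_eqv u v -> word_eqv v w -> word_eqv u w
| word_cat u u' v v' :
    word_eqv u u' -> word_eqv v v' -> word_eqv (u ++ v) (u' ++ v')
| word_one i : word_eqv [:: Tagged G_ (1 : G_ i)] [::]
| word_mul i (x y : G_ i) :
    word_eqv [:: Tagged G_ x; Tagged G_ y] [:: Tagged G_ (x * y)].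

Definition word_rel : rel (seq letter) := fun v w => `[< word_eqv v w >].

Lemma word_rel_refl : reflexive word_rel.
Proof. by move=> w; apply/asboolP; exact: word_refl. Qed.

Lemma word_rel_sym : symmetric word_rel.
Proof. by move=> v w; apply/asboolP/asboolP; exact: word_sym. Qed.

Lemma word_rel_trans : transitive word_rel.
Proof.
by move=> v u w /asboolP uv /asboolP vw; apply/asboolP/(word_trans uv vw).
Qed.

Canonical word_equiv := EquivRel word_rel word_rel_refl word_rel_sym word_rel_trans.

Definition free_product := {eq_quot word_equiv}.

HB.instance Definition _ := Choice.on free_product.
HB.instance Definition _ := EqQuotient.on free_product.

Definition invl (u : letter) : letter := Tagged G_ (tagged u)^-1.
Definition invw (w : seq letter) : seq letter := rev (map invl w).

Lemma word_mulV w : word_eqv (w ++ invw w) [::].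
Proof.
elim: w => [|[i x] w IH]; first exact: word_refl.
rewrite /invw /= rev_cons -cats1 -cat_cons catA -cat1s -!catA.
have step : word_eqv ([:: Tagged G_ x] ++ [::] ++ [:: Tagged G_ x^-1]) [::].
  apply: word_trans (word_mul _ _) _; rewrite mulgV; exact: word_one.
apply: word_trans step; apply: word_cat; first exact: word_refl.
rewrite catA; apply: word_cat => //; exact: word_refl.
Qed.

Lemma invwK : involutive invw.
Proof.
move=> w; rewrite /invw map_rev revK -map_comp -[RHS]map_id.
by apply: eq_map => -[i x] /=; rewrite /invl /= invgK.
Qed.

Lemma word_mulVw w : word_eqv (invw w ++ w) [::].
Proof. by rewrite -{2}[w]invwK; exact: word_mulV. Qed.

Lemma word_inv v w : word_eqv v w -> word_eqv (invw v) (invw w).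
Proof.
move=> vw.
apply: (@word_trans _ (invw v ++ (w ++ invw w))).
  rewrite -{1}[invw v]cats0.
  by apply: word_cat; [exact: word_refl|exact/word_sym/word_mulV].
rewrite catA -[X in word_eqv _ X]cat0s.
apply: word_cat; last exact: word_refl.
apply: word_trans (word_mulVw v).
by apply: word_cat; [exact: word_refl|exact: word_sym].
Qed.

Definition fp_one := lift_cst free_product ([::] : seq letter).
Definition fp_mul := lift_op2 free_product (fun v w : seq letter => v ++ w).
Definition fp_inv := lift_op1 free_product invw.

Lemma pi_wordP v w :
  reflect (\pi_free_product v = \pi_free_product w) `[< word_eqv v w >].
Proof. by apply: (iffP idP) => [h|/eqmodP]; first exact/eqmodP. Qed.

Lemma repr_word w : word_eqv (repr (\pi_free_product w)) w.
Proof. by apply/asboolP/pi_wordP; rewrite reprK. Qed.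

Lemma pi_fp1 : \pi_free_product [::] = fp_one.
Proof. by unlock fp_one. Qed.

Lemma pi_fpM v w : \pi_free_product (v ++ w) = fp_mul (\pi v) (\pi w).
Proof.
unlock fp_mul; apply/esym/pi_wordP/asboolP.
by apply: word_cat; exact: repr_word.
Qed.

Lemma pi_fpV w : \pi_free_product (invw w) = fp_inv (\pi w).
Proof.
unlock fp_inv; apply/esym/pi_wordP/asboolP.
by apply: word_inv; exact: repr_word.
Qed.

Lemma fp_mulA : associative fp_mul.
Proof.
by move=> a b c; rewrite -[a]reprK -[b]reprK -[c]reprK -!pi_fpM catA.
Qed.

Lemma fp_mul1 : left_id fp_one fp_mul.
Proof. by move=> a; rewrite -[a]reprK -pi_fp1 -pi_fpM. Qed.

Lemma fp_mulr1 : right_id fp_one fp_mul.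
Proof. by move=> a; rewrite -[a]reprK -pi_fp1 -pi_fpM cats0. Qed.

Lemma fp_mulV : left_inverse fp_one fp_inv fp_mul.
Proof.
move=> a; rewrite -[a]reprK -pi_fp1 -pi_fpV -pi_fpM.
exact/pi_wordP/asboolP/word_mulVw.
Qed.

Lemma fp_mulrV : right_inverse fp_one fp_inv fp_mul.
Proof.
move=> a; rewrite -[a]reprK -pi_fp1 -pi_fpV -pi_fpM.
exact/pi_wordP/asboolP/word_mulV.
Qed.

HB.instance Definition _ := isGroup.Build free_product
  fp_mulA fp_mul1 fp_mulr1 fp_mulV fp_mulrV.

Lemma pi_fp_cat v w :
  \pi_free_product (v ++ w) = (\pi v : free_product) * (\pi w : free_product).
Proof. exact: pi_fpM. Qed.

Definition fp_in (i : I) (x : G_ i) : free_product :=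
  \pi_free_product [:: Tagged G_ x].

Lemma fp_inM i : {morph @fp_in i : x y / x * y}.
Proof.
move=> x y; rewrite /fp_in -pi_fp_cat.
by apply/pi_wordP/asboolP; apply: word_sym; exact: word_mul.
Qed.

Lemma free_productP (H : groupType) (f : forall i, {multiplicative G_ i -> H}) :
  exists2 phi : {multiplicative free_product -> H},
    (forall i x, phi (@fp_in i x) = f i x) &
    forall psi : {multiplicative free_product -> H},
      (forall i x, psi (@fp_in i x) = f i x) -> psi =1 phi.
Proof.
have f1 (K K' : groupType) (g : {multiplicative K -> K'}) : g 1 = 1.
  have := congr1 (fun z => (g 1)^-1 * z) (gmulfM (s := g) 1 1).
  by rewrite mulg1 mulgA mulVg mul1g.
pose ev (w : seq letter) : H := \prod_(u <- w) f (tag u) (tagged u).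
have evP v w : word_eqv v w -> ev v = ev w.
  elim=> {v w} //; rewrite /ev.
  - by move=> u v w _ -> _ ->.
  - by move=> u u' v v' _ e _ e'; rewrite !big_cat /= e e'.
  - by move=> i; rewrite big_seq1 big_nil /= f1.
  - by move=> i x y; rewrite big_cons !big_seq1 /= gmulfM.
pose phi (a : free_product) : H := ev (repr a).
have phiE w : phi (\pi w) = ev w by apply: evP; exact: repr_word.
have phiM : {morph phi : a b / a * b}.
  move=> a b; rewrite -[a]reprK -[b]reprK -pi_fp_cat.
  by rewrite !phiE /ev big_cat.
pose mphi := Multiplicative.Pack
  (Multiplicative.Class (isMultiplicative.Build _ _ phi phiM)).
exists mphi => [i x|psi psiE a].
  by rewrite [LHS]phiE /ev big_seq1.
rewrite -[a]reprK [RHS]phiE; elim: (repr a) => [|[i x] w IH].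
  by rewrite /ev big_nil pi_fp1; exact: f1.
by rewrite -cat1s pi_fp_cat gmulfM IH [psi _](psiE i x) /ev big_cons.
Qed.

End FreeProduct.

Section FreeGroup.

Definition int_expg (H : groupType) (h : H) (k : int) : H :=
  match k with Posz n => h ^+ n | Negz n => h ^- n.+1 end.

Lemma int_expgS (H : groupType) (h : H) k :
  int_expg h (k + 1)%R = int_expg h k * h.
Proof.
case: k => [n|[|n]]; first by rewrite addrC /= expgSr.
  by rewrite /= mulVg.
have -> : (Negz n.+1 + 1)%R = Negz n.
  by rewrite !NegzE -[n.+2]addn1 PoszD opprD subrK.
by rewrite /= [in RHS]expgS invgM mulgVK.
Qed.

Lemma int_expgM (H : groupType) (h : H) :
  {morph (int_expg h : to_multiplicative int -> H) : k l / k * l}.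
Proof.
move=> k l; change (int_expg h (k + l)%R = int_expg h k * int_expg h l).
elim/int_rec: l => [|n IH|n IH]; first by rewrite addr0 mulg1.
  by rewrite -addn1 PoszD addrA !int_expgS IH mulgA.
have shift (j : int) : int_expg h (j - 1)%R = int_expg h j / h.
  by rewrite -{2}(subrK 1%R j) int_expgS mulgK.
by rewrite -addn1 PoszD opprD addrA !shift IH mulgA.
Qed.

Lemma int_hom_expg (H : groupType) (u : to_multiplicative int -> H) :
  {morph u : k l / k * l} -> forall k, u k = int_expg (u (1%R : int)) k.
Proof.
move=> uM; have uD (i j : int) : u (i + j)%R = u i * u j by exact: uM.
have uS (i : int) : u (i - 1)%R = u i / u (1%R : int).
  by rewrite -[in RHS](subrK 1%R i) [in RHS]uD mulgK.
have eS (i : int) h : int_expg h (i - 1)%R = int_expg h i / h :> H.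
  by rewrite -{2}(subrK 1%R i) int_expgS mulgK.
move=> k; elim/int_rec: (k : int) => [|n IH|n IH].
- by rewrite -[0%R in LHS](subrr 1%R) uS mulgV.
- by rewrite -addn1 PoszD uD int_expgS IH.
- by rewrite -addn1 PoszD opprD uS eS IH.
Qed.

(* A free product of copies of Z is free: [is_free] has models of every rank. *)
Lemma free_product_int_free (X : choiceType) :
  is_free (free_product (fun _ : X => to_multiplicative int)).
Proof.
pose gen : to_multiplicative int := 1%R : int.
exists X, (fun x => fp_in (G_ := fun _ : X => to_multiplicative int) (i := x) gen).
move=> H f.
pose g x := Multiplicative.Pack (Multiplicative.Class
  (isMultiplicative.Build _ _ _ (@int_expgM H (f x)))).
have [phi phiE phiU] := free_productP
  (G_ := fun _ : X => to_multiplicative int) g.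
exists phi => [x|psi psiE]; first by rewrite phiE.
apply: phiU => x k; rewrite -[RHS]/(int_expg (f x) k) -psiE.
apply: (int_hom_expg (u := fun j => psi (fp_in j))) => i j.
by rewrite fp_inM gmulfM.
Qed.

Lemma free_presentation_exists (G : groupType) :
  exists (F : groupType) (R : normal_subgroup F),
    is_free F /\ isomorphic G (quotient_group R).
Proof.
have [F0 F0free [phi [i phiE]]] : exists2 F : groupType, is_free F &
    exists (phi : {multiplicative F -> G}) (i : G -> F), forall x, phi (i x) = x.
  exists (free_product (fun _ : G => to_multiplicative int)).
    exact: free_product_int_free.
  pose g (x : G) := Multiplicative.Pack (Multiplicative.Class
    (isMultiplicative.Build _ _ _ (@int_expgM G x))).
  have [phi phiE _] := free_productP
    (G_ := fun _ : G => to_multiplicative int) g.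
  exists phi, (fun x => fp_in (G_ := fun _ : G => to_multiplicative int)
                          (i := x) (1%R : int)).
  by move=> x; rewrite phiE.
have phi1 : phi 1 = 1.
  have := congr1 (fun z => (phi 1)^-1 * z) (gmulfM (s := phi) 1 1).
  by rewrite mulg1 mulgA mulVg mul1g.
have phiV x : phi x^-1 = (phi x)^-1.
  by rewrite -[LHS]mulg1 -(mulgV (phi x)) mulgA -gmulfM mulVg phi1 mul1g.
have ker_normal : is_normal [set x | phi x = 1].
  split; first split=> [|x y /= x1 y1] //=; last first.
    by move=> x y /= x1; rewrite /conjg !gmulfM x1 mul1g phiV mulVg.
  by rewrite gmulfM phiV x1 y1 invg1 mulg1.
pose R := NormalSubgroup ker_normal; exists F0, R; split=> //.
have piP x y : \pi_(quotient_group R) x = \pi y <-> phi x = phi y.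
  split=> [/pi_cosetP/asboolP /= | exy].
    by rewrite gmulfM phiV => e; rewrite -[RHS](mulVKg (phi x)) e mulg1.
  by apply/pi_cosetP/asboolP; rewrite /= gmulfM phiV exy mulVg.
pose f x := \pi_(quotient_group R) (i x).
have fM : {morph f : x y / x * y}.
  move=> x y; transitivity (\pi_(quotient_group R) (i x * i y)).
    by apply/piP; rewrite gmulfM !phiE.
  exact: pi_quotientM.
exists (Multiplicative.Pack (Multiplicative.Class
  (isMultiplicative.Build _ _ f fM))).
exists (fun a => phi (repr a)) => [x|a] /=.
  by rewrite -[RHS]phiE; apply/piP; rewrite reprK.
by rewrite -[RHS]reprK; apply/piP; rewrite phiE.
Qed.

End FreeGroup.

Definition nilpotent_product (n : nat) (I : choiceType) (G_ : I -> groupType) :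
    groupType :=
  quotient_group (NormalSubgroup (lower_central_normal (free_product G_) n.+1)).

Section DirectSum.
Variables (I : finType) (G_ : I -> groupType).

Definition direct_sum := {dffun forall i, G_ i}.

HB.instance Definition _ := Choice.on direct_sum.

Definition dsum_one : direct_sum := [ffun i => 1].
Definition dsum_mul (f g : direct_sum) : direct_sum := [ffun i => f i * g i].
Definition dsum_inv (f : direct_sum) : direct_sum := [ffun i => (f i)^-1].

Lemma dsum_mulA : associative dsum_mul.
Proof. by move=> f g h; apply/ffunP => i; rewrite !ffunE mulgA. Qed.

Lemma dsum_mul1 : left_id dsum_one dsum_mul.
Proof. by move=> f; apply/ffunP => i; rewrite !ffunE mul1g. Qed.

Lemma dsum_mulr1 : right_id dsum_one dsum_mul.
Proof. by move=> f; apply/ffunP => i; rewrite !ffunE mulg1. Qed.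

Lemma dsum_mulV : left_inverse dsum_one dsum_inv dsum_mul.
Proof. by move=> f; apply/ffunP => i; rewrite !ffunE mulVg. Qed.

Lemma dsum_mulrV : right_inverse dsum_one dsum_inv dsum_mul.
Proof. by move=> f; apply/ffunP => i; rewrite !ffunE mulgV. Qed.

HB.instance Definition _ := isGroup.Build direct_sum
  dsum_mulA dsum_mul1 dsum_mulr1 dsum_mulV dsum_mulrV.

End DirectSum.

Definition infinite_cyclic : groupType := to_multiplicative int.

(* The cyclic group of order [r] only when [1 < r]: ['Z_0] and ['Z_1] have two
   elements. *)
Definition finite_cyclic (r : nat) : groupType := to_multiplicative 'Z_r.

Definition direct_power (A : groupType) (d : nat) : groupType :=
  {ffun 'I_d -> A}.

(* [m] copies of Z, then cyclic groups of orders [r 1], ..., [r t]; the value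
   [r 0] is unused. *)
Definition cyclic_factors (m t : nat) (r : nat -> nat) (i : 'I_m + 'I_t) :
    groupType :=
  match i with
  | inl _ => infinite_cyclic
  | inr j => finite_cyclic (r j.+1)
  end.

Local Open Scope ring_scope.

Definition moebius (e : nat) : int :=
  if all (fun p => logn p e == 1%N) (primes e) then (-1) ^+ size (primes e)
  else 0.

Definition chi (k d : nat) : rat :=
  k%:R^-1 * \sum_(e <- divisors k) (moebius e)%:~R * (d ^ (k %/ e))%N%:R.

(* d_k = chi_(c+1)(k) + ... + chi_(c+n)(k). This rational number is a natural
   number (it counts basic commutators), so [truncn] merely casts it to [nat];
   it is nondecreasing in [k], so no difference d_k+1 - d_k is truncated. *)
Definition basic_comm_count (n c k : nat) : nat :=
  Num.truncn (\sum_(1 <= i < n.+1) chi (c + i)%N k).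

(* Main.v *)
Require Import Defs.
From HB Require Import structures.
From mathcomp Require Import zify.
From mathcomp Require Import all_boot all_order all_algebra.
From mathcomp Require Import generic_quotient.
From mathcomp Require Import boolp classical_sets.

(** Since [c >= n], the multiplier of [G = F / R] is
    [gamma_(c+1)(F) / [R, _c F]]; it does not depend on the presentation, so [F]
    may be taken free on the [m + t] obvious letters.  Expand [F] by Magnus,
    sending the letter [a] to [1 + a] in the ring of noncommutative power series.

    Let [gcd w] be the gcd of the orders of the letters of a word [w], an
    infinite order counting as 0.  Elements of [R] have their coefficients on
    the words [w] of length at most [n] divisible by [gcd w], because [r] divides
    [binomial r k] when [1 <= k <= n] and [r] is prime to every prime at most [n].
    Commutation with an element of [F] raises the length bound by one, so on
    [[R, _c F]] the divisibility holds up to length [c + n].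

    Conversely, [gamma_k(F)] is generated modulo [gamma_(k+1)(F)] by the basic
    commutators attached to the Lyndon words of length [k], the Magnus expansion
    of such a commutator being [1 + w + larger words + longer words].  Moreover
    the [gcd w]-th power of the commutator of [w] lies in [[R, _(k-1) F]] modulo
    [gamma_(k+1)(F)].  Hence an element of [gamma_(c+1)(F)] lies in [[R, _c F]] as
    soon as its coefficients on the Lyndon words [w] of lengths [c+1, ..., c+n]
    are divisible by [gcd w], and these coefficients identify the multiplier with
    the direct sum of the [Z / gcd w].  Since the orders form a divisibility
    chain, [gcd w] only depends on the largest letter of [w]; the number of Lyndon
    words follows from the count of primitive necklaces by Moebius inversion. *)

Set Implicit Arguments.
Unset Strict Implicit.
Unset Printing Implicit Defensive.

Import Algebra GRing.Theory Num.Theory.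

(** * Commutator calculus modulo the lower central series *)

Section Groups.
Local Open Scope classical_set_scope.
Local Open Scope quotient_scope.
Local Open Scope group_scope.

(** * Homomorphisms, quotient projections and transport of subgroups *)

Section Morphisms.
Variables (G H : groupType) (f : {multiplicative G -> H}).

Lemma hom1 : f 1 = 1.
Proof. by apply: (mulgI (f 1)); rewrite -gmulfM !mulg1. Qed.

Lemma homV x : f x^-1 = (f x)^-1.
Proof. by apply: (mulgI (f x)); rewrite -gmulfM !mulgV hom1. Qed.

Lemma homX x k : f (x ^+ k) = f x ^+ k.
Proof. by elim: k => [|k IH]; rewrite ?hom1 // !expgS gmulfM IH. Qed.

Lemma homJ x y : f (x ^ y) = f x ^ f y.
Proof. by rewrite /conjg !gmulfM homV. Qed.

Lemma homR x y : f [~ x, y] = [~ f x, f y].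
Proof. by rewrite /commg gmulfM homJ homV. Qed.

Definition hom_of (g : G -> H) (gM : {morph g : x y / x * y}) :
    {multiplicative G -> H} :=
  Multiplicative.Pack (Multiplicative.Class (isMultiplicative.Build _ _ g gM)).

End Morphisms.

Section QuotientProjection.
Variables (G : groupType) (N : normal_subgroup G).

Definition qproj : {multiplicative G -> quotient_group N} :=
  hom_of (@pi_quotientM G N).

Lemma qproj_eq x y : qproj x = qproj y <-> normal_set N (x^-1 * y).
Proof.
by split=> [/pi_cosetP/asboolP|h] //; apply/pi_cosetP/asboolP.
Qed.

Lemma qproj1P x : qproj x = 1 <-> normal_set N x.
Proof.
rewrite -(hom1 qproj); split=> [/esym/qproj_eq|h]; first by rewrite invg1 mul1g.
by apply/esym/qproj_eq; rewrite invg1 mul1g.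
Qed.

Lemma qproj_surj a : exists x, qproj x = a.
Proof. by exists (repr a); apply: reprK. Qed.

Lemma qproj_commute x y :
  normal_set N [~ x, y] -> commute (qproj x) (qproj y).
Proof. by move/qproj1P; rewrite homR => /eqP/commgP. Qed.

End QuotientProjection.

Lemma is_subgroup_preim (G H : groupType) (f : {multiplicative G -> H}) A :
  is_subgroup A -> is_subgroup [set x | A (f x)].
Proof.
move=> sA; split=> [|x y Ax Ay] /=; first by rewrite hom1; exact: is_subgroup1.
by rewrite gmulfM homV; exact: sA.2.
Qed.

Lemma is_normal_ker (G H : groupType) (f : {multiplicative G -> H}) :
  is_normal [set x | f x = 1].
Proof.
split; first split=> [|x y /= fx fy] /=; first exact: hom1.
  by rewrite gmulfM homV fx fy mulgV.
by move=> x y /= fx; rewrite homJ fx conj1g.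
Qed.

Lemma is_subgroup_equalizer (G H : groupType) (f g : {multiplicative G -> H}) :
  is_subgroup [set x | f x = g x].
Proof.
split=> [|x y /= fx fy] /=; first by rewrite !hom1.
by rewrite !gmulfM !homV fx fy.
Qed.

Lemma is_subgroup_image (G H : groupType) (f : {multiplicative G -> H}) A :
  is_subgroup A -> is_subgroup (f @` A).
Proof.
move=> sA; split; first by exists 1; rewrite ?hom1 //; exact: is_subgroup1.
move=> _ _ [x Ax <-] [y Ay <-]; exists (x / y); first exact: sA.2.
by rewrite gmulfM homV.
Qed.

Lemma is_subgroupX (G : groupType) (A : set G) x k :
  is_subgroup A -> A x -> A (x ^+ k).
Proof.
move=> sA Ax; elim: k => [|k IH]; first exact: is_subgroup1.
by rewrite expgS; exact: is_subgroupM.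
Qed.

Lemma is_subgroup_intX (G : groupType) (A : set G) x k :
  is_subgroup A -> A x -> A (int_expg x k).
Proof.
move=> sA Ax; case: k => k /=; first exact: is_subgroupX.
by apply: is_subgroupV => //; exact: is_subgroupX.
Qed.

Lemma hom_int_expg (G H : groupType) (f : {multiplicative G -> H}) x k :
  f (int_expg x k) = int_expg (f x) k.
Proof. by case: k => k /=; rewrite ?homV homX. Qed.

(** * Commutator identities and weights of brackets *)

Section Commutators.
Variable G : groupType.
Implicit Types (A B N : set G) (x y z : G).

Lemma commute_commg x y : commute x y -> [~ x, y] = 1.
Proof. by move/commgP/eqP. Qed.

Lemma commute_conjg x y : commute x y -> x ^ y = x.
Proof. by move=> xy; rewrite conjgE xy mulKg. Qed.

Lemma commMgJ x y z : [~ x * y, z] = [~ x, z] ^ y * [~ y, z].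
Proof. by rewrite /commg /conjg !gnorm. Qed.

Lemma commgMJ x y z : [~ x, y * z] = [~ x, z] * [~ x, y] ^ z.
Proof. by rewrite /commg /conjg !gnorm. Qed.

Lemma commXg x y r : commute x [~ x, y] -> [~ x ^+ r, y] = [~ x, y] ^+ r.
Proof.
move=> cx; elim: r => [|r IH]; first exact: comm1g.
by rewrite expgSr commMgJ IH expgSr commute_conjg //; exact/commute_sym/commuteX.
Qed.

Lemma Hall_Witt x y z :
  [~ x, y^-1, z] ^ y * [~ y, z^-1, x] ^ z * [~ z, x^-1, y] ^ x = 1.
Proof.
(* Each factor is [(a x y z)^-1 * a y z x] up to a cyclic shift of the variables, so the product
   telescopes. *)
pose a x y z : G := x * z * y ^ x.
suff hw x' y' z' : [~ x', y'^-1, z'] ^ y' = (a x' y' z')^-1 * (a y' z' x').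
  by rewrite !hw; move: a {hw} => a; rewrite 2!mulgA !mulgK mulVg.
by rewrite /a /commg /conjg !gnorm.
Qed.

(** Elementwise three subgroups lemma: the Hall-Witt identity expresses a conjugate of the last
    bracket through conjugates of the other two. *)
Lemma three_commutators N x y z : is_normal N ->
  N [~ x, y^-1, z] -> N [~ y, z^-1, x] -> N [~ z, x^-1, y].
Proof.
move=> nN N1 N2; have [sN NJ] := nN.
have := Hall_Witt x y z => /(canRL (mulKg _)); rewrite mulg1 => e.
rewrite -(conjgK x [~ z, x^-1, y]) e; apply: (NJ).
by apply: is_subgroupV => //; apply: is_subgroupM => //; apply: (NJ).
Qed.

Lemma commutator_subgroupP A B x y :
  A x -> B y -> commutator_subgroup A B [~ x, y].
Proof. by move=> Ax By; apply: sub_gen_smallest; exists x => //; exists y. Qed.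

Lemma commutator_subgroup_sub A B N : is_subgroup N ->
  (forall x y, A x -> B y -> N [~ x, y]) -> commutator_subgroup A B `<=` N.
Proof.
by move=> sN h; apply: smallest_sub => // _ [x Ax [y By <-]]; exact: h.
Qed.

(** Modulo [N] this set is the centralizer of [A]; hence a condition on brackets can be checked on
    generators of the second argument. *)
Lemma is_subgroup_centralizes N A : is_normal N ->
  is_subgroup [set y | forall x, A x -> N [~ x, y]].
Proof.
move=> nN; pose q := qproj (NormalSubgroup nN).
have E x y : N [~ x, y] <-> commute (q x) (q y).
  split=> [/(qproj_commute (N := NormalSubgroup nN))|] //.
  by move/commgP/eqP; rewrite -homR => /qproj1P.
split=> [x Ax|y z Ny Nz x Ax] /=; first by rewrite commg1; exact: is_subgroup1 nN.1.
apply/E; rewrite gmulfM homV; apply: commuteM; first exact/E/Ny.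
exact/commuteV/E/Nz.
Qed.

Lemma lower_centralS k :
  lower_central k.+2 = commutator_subgroup (lower_central k.+1) setT :> set G.
Proof. by []. Qed.

Lemma lower_central_sub k l :
  k <= l -> (lower_central l : set G) `<=` lower_central k.
Proof.
move=> kl; have kl' : k.-1 <= l.-1 by lia.
rewrite /lower_central -(subnK kl') /iter_commutator iterD.
exact: iter_commutator_sub (iter_commutator_normal _ (@is_normalT G)).
Qed.

Lemma iter_commutator_antitone A k l : is_normal A -> k <= l ->
  iter_commutator l A `<=` iter_commutator k A.
Proof.
move=> nA kl; rewrite -(subnK kl) /iter_commutator iterD.
exact: iter_commutator_sub (iter_commutator_normal _ nA).
Qed.

(** Bracketing with an element of weight [j + 1] is worth [j + 1] brackets with arbitrary elements.
    By induction on [j], [three_commutators] trades [[x, [y, z]]] for [[[x, z], y]] and [[[x, y],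
    z]], where [y] has the smaller weight. *)
Lemma iter_commutator_lower_central A i j x y : is_normal A ->
  iter_commutator i A x -> lower_central j.+1 y ->
  iter_commutator (i + j.+1) A [~ x, y].
Proof.
move=> nA; elim: j i x y => [|j IH] i x y Ax.
  by rewrite addn1 => _; exact: commutator_subgroupP.
have nN := iter_commutator_normal (i + j.+2) nA.
rewrite lower_centralS => Gy.
have sub := commutator_subgroup_sub
  (is_subgroup_centralizes (iter_commutator i A) nN).
apply: sub Gy _ Ax => {x} {}y z Gy _ x Ax.
rewrite -(invgR [~ y, z]); apply: is_subgroupV; first exact: nN.1.
have AV := is_subgroupV (iter_commutator_normal i nA).1.
rewrite -[z]invgK; apply: (three_commutators (y := x) nN).
  rewrite -addSnnS; apply: (IH i.+1) => //.
  rewrite -invgR; apply: (is_subgroupV (iter_commutator_normal i.+1 nA).1).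
  by apply: commutator_subgroupP => //; exact: AV.
rewrite addnS; apply: commutator_subgroupP => //; apply: (IH i) => //.
by apply: is_subgroupV => //; exact: (lower_central_normal _ _).1.
Qed.

Lemma lower_central_comm i j x y : lower_central i.+1 x ->
  lower_central j.+1 y -> lower_central (i.+1 + j.+1) [~ x, y].
Proof. exact: iter_commutator_lower_central. Qed.

End Commutators.

Lemma hom_iter_commutator (G H : groupType) (f : {multiplicative G -> H})
    (A : set G) (B : set H) k :
  (forall x, A x -> B (f x)) ->
  forall x, iter_commutator k A x -> iter_commutator k B (f x).
Proof.
move=> AB; elim: k => //= k IH x.
have sub := commutator_subgroup_sub
  (is_subgroup_preim f (smallest_is_subgroup
    [set [~ x, y] | x in iter_commutator k B & y in setT])).
apply: sub => {}x y Ax _ /=; rewrite homR; apply: commutator_subgroupP => //.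
exact: IH.
Qed.

Lemma hom_lower_central (G H : groupType) (f : {multiplicative G -> H}) k x :
  lower_central k x -> lower_central k (f x).
Proof. by apply: hom_iter_commutator. Qed.

Lemma hom_lower_central_surj (G H : groupType) (f : {multiplicative G -> H}) k :
  (forall y, exists x, f x = y) ->
  forall y, lower_central k y -> exists2 x, lower_central k x & f x = y.
Proof.
move=> fs; rewrite /lower_central; elim: k.-1 => {k} [|k IH] y.
  by have [x <-] := fs y; exists x.
have sub := commutator_subgroup_sub
  (is_subgroup_image f (smallest_is_subgroup
    [set [~ x, y] | x in @iter_commutator G k setT & y in setT])).
apply: sub => {}y z /IH [x Gx <-] _; have [x' <-] := fs z.
by exists [~ x, x']; rewrite ?homR //; exact: commutator_subgroupP.
Qed.

(* Independence of the multiplier from the presentation rests on this. *)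
Lemma hom_id_mod_iter_commutator (G : groupType) (f : {multiplicative G -> G})
    (R : set G) : is_normal R -> (forall x, R (x^-1 * f x)) ->
  forall k x, lower_central k.+1 x -> iter_commutator k R (x^-1 * f x).
Proof.
move=> nR fR; elim=> [|k IH] x; first by move=> _; exact: fR.
have nN := iter_commutator_normal k.+1 nR.
pose q := qproj (NormalSubgroup nN).
move=> Gx; apply/(qproj_eq (NormalSubgroup nN)).
have sub := commutator_subgroup_sub (is_subgroup_equalizer q
  (hom_of (g := fun x => q (f x))
     (fun x y => etrans (congr1 q (gmulfM (s := f) x y)) (gmulfM (s := q) _ _)))).
apply: sub Gx => {}x y Gx _; rewrite /= (homR f).
(* Modulo [[R, G, ..., G]] with [k + 1] copies of [G], the error [s] is central and the error [t]
   centralizes [gamma_(k+1)], so [[x s, y t]] reduces to [[x, y]]. *)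
have [s Rs ->] : exists2 s, iter_commutator k R s & f x = x * s.
  by exists (x^-1 * f x); rewrite ?mulVKg //; exact: IH.
have [t Rt ->] : exists2 t, R t & f y = y * t.
  by exists (y^-1 * f y); rewrite ?mulVKg.
have Cs g : commute (q s) (q g).
  by apply: qproj_commute; exact: commutator_subgroupP.
have Ct g : lower_central k.+1 g -> commute (q t) (q g).
  move=> Gg; apply: qproj_commute.
  exact: (@iter_commutator_lower_central _ R 0 k).
have E : [~ q x * q s, q y * q t] = [~ q x, q y] ^ q t.
  rewrite commMgJ [[~ q s, _]]commute_commg; last by apply: commuteM; exact: Cs.
  rewrite mulg1 commgMJ [[~ _, q t]]commute_commg ?mul1g; last exact/commute_sym/Ct.
  by rewrite commute_conjg // -(homR q) -(homJ q); apply/commute_sym/Cs.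
rewrite [LHS](homR q) [RHS](homR q) !gmulfM E.
rewrite -(homR q) /conjg -(Ct [~ x, y]) ?mulKg //.
exact: (@lower_central_sub G k.+1 k.+2) (commutator_subgroupP _ _).
Qed.

(** * Bilinearity of commutation modulo the lower central series *)

Section LowerCentralQuotients.
Variable G : groupType.
Implicit Types (x y z : G) (k : nat).

Definition lc_normal k := NormalSubgroup (lower_central_normal G k).

Definition lcq k : {multiplicative G -> quotient_group (lc_normal k)} :=
  qproj (lc_normal k).

Lemma lcq_eq k x y : lcq k x = lcq k y <-> lower_central k (x^-1 * y).
Proof. exact: qproj_eq. Qed.

Lemma lcq1P k x : lcq k x = 1 <-> lower_central k x.
Proof. exact: qproj1P. Qed.

Lemma lcq_commute k i j x y : 0 < i -> 0 < j -> k <= i + j ->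
  lower_central i x -> lower_central j y -> commute (lcq k x) (lcq k y).
Proof.
case: i j => [|i] [|j] // _ _ kij Gx Gy; apply: qproj_commute.
exact: lower_central_sub kij _ (lower_central_comm Gx Gy).
Qed.

(** Conjugating [[x, y]] by [x'] changes it by an element of weight [2 i + j], which is trivial
    modulo [gamma_k]. *)
Lemma lcq_commMg k i j x x' y : 0 < i -> 0 < j -> k <= (i + j).+1 ->
  lower_central i x -> lower_central i x' -> lower_central j y ->
  lcq k [~ x * x', y] = lcq k [~ x, y] * lcq k [~ x', y].
Proof.
case: i j => [|i] [|j] // _ _ kij Gx Gx' Gy.
rewrite commMgJ gmulfM homJ commute_conjg //.
by apply: (lcq_commute (j := i.+1) _ _ _ (lower_central_comm Gx Gy)) => //; lia.
Qed.

Lemma lcq_commVg k i j x y : 0 < i -> 0 < j -> k <= (i + j).+1 ->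
  lower_central i x -> lower_central j y ->
  lcq k [~ x^-1, y] = (lcq k [~ x, y])^-1.
Proof.
move=> i0 j0 kij Gx Gy; apply: (mulgI (lcq k [~ x, y])); rewrite mulgV.
rewrite -(lcq_commMg i0 j0) // ?mulgV ?comm1g ?hom1 //.
by apply: is_subgroupV => //; exact: (lower_central_normal _ _).1.
Qed.

(** Brackets are multilinear on the associated graded group, so an [r]-th power moves from the first
    entry to the whole bracket. This will place suitable powers of basic commutators in the iterated
    commutators of [R]. *)
Lemma iter_commutator_power (V R : set G) r : is_normal V -> is_normal R ->
  (forall v, V v -> exists2 s, R s & lcq 2 s = lcq 2 (v ^+ r)) ->
  forall k v, iter_commutator k V v ->
    exists2 s, iter_commutator k R s & lcq k.+2 s = lcq k.+2 (v ^+ r).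
Proof.
move=> nV nR VR; elim=> [//|k IH] v Vv.
have VG l u : iter_commutator l V u -> lower_central l.+1 u.
  exact: iter_commutatorS.
(* Membership in [gamma_(k+2)] is carried along because it makes the [r]-th power multiplicative
   modulo [gamma_(k+3)], as closure under quotients requires. *)
suff [//] : (lower_central k.+2 v /\ (lcq k.+3 @` iter_commutator k.+1 R)
    (lcq k.+3 (v ^+ r))).
have sub := @commutator_subgroup_sub G (iter_commutator k V) setT
   [set v | lower_central k.+2 v /\ (lcq k.+3 @` iter_commutator k.+1 R)
    (lcq k.+3 (v ^+ r))].
apply: (sub _ _ v Vv) => {v Vv sub}; last first.
  move=> v y Vv _; split; first exact: commutator_subgroupP (VG _ _ Vv) _.
  have [s Rs sE] := IH v Vv; exists [~ s, y]; first exact: commutator_subgroupP.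
  have Gg : lower_central k.+2 (s^-1 * v ^+ r) by apply/lcq_eq.
  have cv : commute (lcq k.+3 v) [~ lcq k.+3 v, lcq k.+3 y].
    rewrite -homR; apply: (lcq_commute (i := k.+1) (j := k.+2)) => //; last 1 first.
    - exact: commutator_subgroupP (VG _ _ Vv) _.
    - by lia.
    - exact: VG.
  rewrite homX !homR -(commXg _ cv) -homX -!homR -[v ^+ r](mulVKg s).
  rewrite commMgJ [RHS](gmulfM (s := lcq _)) homJ commute_conjg; last first.
    apply: (lcq_commute (i := k.+2) (j := k.+2) _ _ _ _ Gg) => //; first by lia.
    apply: commutator_subgroupP => //.
    exact: iter_commutatorS (@subsetT _ R) _ Rs.
  rewrite (_ : lcq k.+3 [~ s^-1 * _, _] = 1) ?mulg1 //.
  by apply/lcq1P; exact: commutator_subgroupP.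
have sG := (lower_central_normal G k.+2).1.
have sR := is_subgroup_image (lcq k.+3) (iter_commutator_normal k.+1 nR).1.
split; first by split; rewrite ?expg1n; [exact: is_subgroup1|rewrite hom1; exact: is_subgroup1].
move=> x y [Gx Rx] [Gy Ry]; split; first exact: sG.2.
rewrite homX gmulfM homV expgnFl; last first.
  by apply: (lcq_commute (i := k.+2) (j := k.+2)) => //; lia.
by rewrite -!homX; exact: sR.2.
Qed.

End LowerCentralQuotients.

#[global] Arguments lcq {G} k.
#[global] Arguments lc_normal {G} k.

Lemma int_expgD (G : groupType) (x : G) k l :
  int_expg x (k + l)%R = int_expg x k * int_expg x l.
Proof. exact: int_expgM. Qed.

Lemma int_expgN (G : groupType) (x : G) k : int_expg x (- k)%R = (int_expg x k)^-1.
Proof. by apply: (mulgI (int_expg x k)); rewrite -int_expgD subrr mulgV. Qed.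

Lemma int_expg_mul (G : groupType) (x : G) (r : nat) (k : int) :
  int_expg x (r%:Z * k)%R = int_expg (x ^+ r) k.
Proof.
case: k => k; first by rewrite -PoszM /= expgnA.
by rewrite NegzE mulrN !int_expgN -PoszM /= expgnA.
Qed.

(** * Subgroups generated by chosen elements and a term of the lower central series *)

Section Span.
Variables (G : groupType) (T : eqType) (c : T -> G).

Definition gspan (k : nat) (P : set T) : set G :=
  smallest (@is_subgroup G) (c @` P `|` lower_central k).

Lemma gspan_subgroup k P : is_subgroup (gspan k P).
Proof. exact: smallest_is_subgroup. Qed.

Lemma gspan_gen k (P : set T) w : P w -> gspan k P (c w).
Proof. by move=> Pw; apply: sub_gen_smallest; left; exists w. Qed.

Lemma gspan_lower_central k P x : lower_central k x -> gspan k P x.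
Proof. by move=> Gx; apply: sub_gen_smallest; right. Qed.

Lemma gspan_sub k P A : is_subgroup A -> (forall w, P w -> A (c w)) ->
  lower_central k `<=` A -> gspan k P `<=` A.
Proof.
by move=> sA cA GA; apply: smallest_sub => // x [[w Pw <-]|/GA//]; exact: cA.
Qed.

Lemma gspan_mono k P Q : P `<=` Q -> gspan k P `<=` gspan k Q.
Proof.
move=> PQ; apply: gspan_sub; first exact: gspan_subgroup.
  by move=> w /PQ; exact: gspan_gen.
exact: gspan_lower_central.
Qed.

Lemma gspan_lcq k P x y : lcq k x = lcq k y -> gspan k P x -> gspan k P y.
Proof.
move/lcq_eq => xy Px; rewrite -(mulVKg x y); apply: is_subgroupM Px _.
  exact: gspan_subgroup.
exact: gspan_lower_central.
Qed.

(** Modulo [gamma_(k+1)] the generators commute with one another, so all occurrences of [c w] can be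
    collected on the right and cancelled by one power. *)
Lemma gspan_cons k w (s : seq T) x : 0 < k ->
  (forall u, u \in w :: s -> lower_central k (c u)) ->
  gspan k.+1 [set` w :: s] x ->
  exists e, gspan k.+1 [set` s] (x * int_expg (c w) e).
Proof.
move=> k0 cG; have sS := gspan_subgroup k.+1 [set` s].
have Gw : lower_central k (c w) by apply: cG; rewrite mem_head.
have Gk : is_subgroup (lower_central k : set G) := (lower_central_normal G k).1.
have SG : gspan k.+1 [set` s] `<=` lower_central k.
  apply: gspan_sub => // [u us|]; last exact: lower_central_sub.
  by apply: cG; rewrite inE orbC us.
have sJ y e : gspan k.+1 [set` s] y -> gspan k.+1 [set` s] (y ^ int_expg (c w) e).
  move=> Sy; rewrite conjgE; apply: gspan_lcq (Sy).
  rewrite -conjgE homJ commute_conjg //.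
  apply: (lcq_commute (i := k) (j := k)) => //; first by lia.
    exact: SG.
  exact: is_subgroup_intX.
have sub := @gspan_sub k.+1 [set` w :: s]
  [set x | exists e, gspan k.+1 [set` s] (x * int_expg (c w) e)].
apply: sub.
- split; first by exists 0; rewrite mul1g; exact: is_subgroup1.
  move=> y z [e Sy] [e' Sz].
  have [d de] : exists d, e = (e' + d)%R by exists (e - e')%R; rewrite addrC subrK.
  exists d; move: Sy; rewrite de int_expgD => Sy.
  have := is_subgroupV sS Sz => /(sJ _ d) /(is_subgroupM sS Sy).
  by rewrite /conjg !gnorm.
- move=> u; rewrite /= inE => /orP[/eqP ->|us].
    by exists (- 1)%R; rewrite int_expgN /= mulgV; exact: is_subgroup1.
  by exists 0; rewrite mulg1; exact: gspan_gen.
- by move=> y Gy; exists 0; rewrite mulg1; exact: gspan_lower_central.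
Qed.

End Span.

Lemma first_isomorphism (G H : groupType) (N : normal_subgroup G)
    (f : {multiplicative G -> H}) :
  (forall x, f x = 1 <-> normal_set N x) -> (forall y, exists x, f x = y) ->
  isomorphic (quotient_group N) H.
Proof.
move=> fker fsurj.
have fE x y : f x = f y <-> qproj N x = qproj N y.
  rewrite qproj_eq -fker gmulfM homV.
  by split=> [->|/(canRL (mulKg _))]; rewrite ?mulVg // mulg1 invgK.
pose g (a : quotient_group N) := f (repr a).
have gE x : g (qproj N x) = f x by apply/fE; exact: reprK.
have gM : {morph g : a b / a * b}.
  move=> a b; have [x <-] := qproj_surj a; have [y <-] := qproj_surj b.
  by rewrite -gmulfM !gE gmulfM.
have h y : {x | f x = y} by exact/cid/fsurj.
exists (hom_of gM), (fun y => qproj N (sval (h y))) => [a|y] /=.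
  have [x <-] := qproj_surj a; rewrite gE; apply/fE.
  by case: (h (f x)).
by rewrite gE; case: (h y).
Qed.

End Groups.

(** * Lyndon words *)

Section Words.
Implicit Types (u v w p s t : seq nat) (d k : nat).

Fixpoint ltw u v : bool :=
  match u, v with
  | _, [::] => false
  | [::], _ :: _ => true
  | a :: u', b :: v' => (a < b) || (a == b) && ltw u' v'
  end.

Arguments ltw !u !v.

Lemma ltwnn u : ltw u u = false.
Proof. by elim: u => //= a u ->; rewrite ltnn eqxx. Qed.

Lemma ltw_trans v u w : ltw u v -> ltw v w -> ltw u w.
Proof.
elim: v u w => [|b v IH] [|a u] [|c w] //=.
move=> /orP[ab|/andP[/eqP-> uv]] /orP[bc|/andP[/eqP<- vw]].
- by rewrite (ltn_trans ab bc).
- by rewrite ab.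
- by rewrite bc.
- by rewrite eqxx (IH _ _ uv vw) orbT.
Qed.

Lemma ltw_total u v : [|| u == v, ltw u v | ltw v u].
Proof.
elim: u v => [|a u IH] [|b v] //=; rewrite eqseq_cons [b == a]eq_sym.
by case: ltngtP (IH v) => //= _.
Qed.

Lemma ltw_cat2l p u v : ltw (p ++ u) (p ++ v) = ltw u v.
Proof. by elim: p => //= a p ->; rewrite ltnn eqxx. Qed.

Lemma ltw_prefix u v : v != [::] -> ltw u (u ++ v).
Proof. by move=> v0; rewrite -{1}[u]cats0 ltw_cat2l; case: v v0. Qed.

Lemma ltw_catr u v w : ltw u v -> ltw u (v ++ w).
Proof.
elim: u v => [|a u IH] [|b v] //= /orP[->//|/andP[-> /IH ->]].
by rewrite orbT.
Qed.

Lemma ltw_cat u u' v v' : size u = size u' ->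
  ltw (u ++ v) (u' ++ v') = ltw u u' || (u == u') && ltw v v'.
Proof.
elim: u u' => [|a u IH] [|b u'] //= [/IH ->]; rewrite eqseq_cons.
by case: ltngtP.
Qed.

Lemma ltw_cat_nprefix u v p q :
  ltw u v -> ~~ prefix u v -> ltw (u ++ p) (v ++ q).
Proof.
elim: u v => [|a u IH] [|b v] //=; rewrite /= ?prefix0s //.
case: ltngtP => //= _ uv np.
by apply: IH => //; move: np; rewrite prefix_cons.
Qed.

Lemma size_word_gt0 w : (w != [::]) = (0 < size w).
Proof. by case: w. Qed.

(** Lyndon words through their suffixes rather than their rotations; the interval
    [iota 1 (size w).-1] lists the cuts that leave both parts nonempty. *)
Definition lyndon w : bool :=
  (w != [::]) && all (fun i => ltw w (drop i w)) (iota 1 (size w).-1).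

Lemma lyndonP w :
  reflect (w != [::] /\ forall p s, w = p ++ s -> p != [::] -> s != [::] -> ltw w s)
          (lyndon w).
Proof.
apply: (iffP andP) => -[w0 h]; split=> //.
  move=> p s wps p0 s0.
  have -> : s = drop (size p) w by rewrite wps drop_size_cat.
  apply: (allP h); rewrite mem_iota wps size_cat.
  by case: p s p0 s0 {wps h w0} => [|a p] [|b s] //=; lia.
apply/allP => i; rewrite mem_iota => /andP[i0 iw].
have iw' : i < size w by lia.
apply: (h (take i w)); rewrite ?cat_take_drop // -size_eq0 ?size_drop ?size_take;
  by rewrite ?iw' -lt0n ?subn_gt0.
Qed.

Lemma lyndon_neq0 w : lyndon w -> w != [::].
Proof. by case/andP. Qed.

Lemma lyndon_suffix p s : lyndon (p ++ s) -> p != [::] -> s != [::] ->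
  ltw (p ++ s) s.
Proof. by case/lyndonP => _ /(_ p s erefl). Qed.

Lemma cat_eq_cat u v p s : u ++ v = p ++ s ->
  (exists q, [/\ q != [::], u = p ++ q & s = q ++ v]) \/
  (exists q, p = u ++ q /\ v = q ++ s).
Proof.
elim: u p => [|a u IH] [|b p] /=; try by move=> ->; right; exists [::].
- by move=> ->; right; exists (b :: p).
- by move=> <-; left; exists (a :: u).
- move=> [-> /IH[[q [q0 -> ->]]|[q [-> ->]]]]; first by left; exists q.
  by right; exists q.
Qed.

(** The main point is [u v < v]: if [u] is a prefix of [v], cancel it and compare [v] with its own
    suffix; otherwise the first difference already lies inside [u]. Suffixes cutting [u] are handled
    by the Lyndon property of [u]. *)
Lemma lyndon_cat u v : lyndon u -> lyndon v -> ltw u v -> lyndon (u ++ v).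
Proof.
move=> Lu Lv uv; have v0 := lyndon_neq0 Lv; have u0 := lyndon_neq0 Lu.
have uvv : ltw (u ++ v) v.
  have [/prefixP[q vq]|npu] := boolP (prefix u v); last first.
    by rewrite -[X in ltw _ X]cats0; exact: ltw_cat_nprefix.
  have q0 : q != [::] by apply: contraTneq uv => q0; rewrite vq q0 cats0 ltwnn.
  rewrite {2}vq ltw_cat2l vq; apply: lyndon_suffix; by rewrite -?vq.
apply/lyndonP; split; first by case: (u) u0.
move=> p s e p0 s0.
have [[q [q0 uq sq]]|[q [pq vq]]] := cat_eq_cat e.
  rewrite sq; apply: ltw_cat_nprefix.
    by rewrite uq; apply: lyndon_suffix; rewrite // -uq.
  apply/negP => /prefixP[q' /(congr1 size)]; rewrite uq !size_cat.
  by case: (p) p0 => //= *; lia.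
have [q0|q0] := eqVneq q [::]; first by rewrite {2}vq q0 in uvv *.
by apply: ltw_trans uvv _; rewrite vq; apply: lyndon_suffix; rewrite -?vq.
Qed.

(** * Smallest suffixes and standard factorization *)

Fixpoint minsuffix w : seq nat :=
  match w with
  | [::] => [::]
  | a :: w' => let m := minsuffix w' in
      if (m == [::]) || ltw w m then w else m
  end.

Lemma minsuffix_eq0 w : (minsuffix w == [::]) = (w == [::]).
Proof. by by case: w => //= a w; case: ifP => //; case: (minsuffix w). Qed.

Lemma minsuffixP w : exists p, w = p ++ minsuffix w.
Proof.
elim: w => [|a w [p IH]]; first by exists [::].
by rewrite /=; case: ifP => _; [exists [::]|exists (a :: p); rewrite cat_cons -IH].
Qed.

Lemma minsuffix_le w p s : w = p ++ s -> s != [::] ->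
  s = minsuffix w \/ ltw (minsuffix w) s.
Proof.
elim: w p s => [|a w IH] [|b p] s //=; first by move=> <-.
  move=> <- _; case: ifP => [_|]; first by left.
  move=> /negbT; rewrite negb_or => /andP[m0 aw]; right.
  have := ltw_total (a :: w) (minsuffix w); rewrite (negbTE aw) /=.
  case/orP => // /eqP /(congr1 size).
  by have [q wq] := minsuffixP w; rewrite {1}wq /= size_cat; lia.
move=> [_ wps] s0; have m0 : minsuffix w != [::].
  by rewrite minsuffix_eq0 wps; case: (p) (s) s0 => [|? ?] [|? ?].
case: ifP => [|_]; last exact: IH wps s0.
rewrite (negbTE m0) /= => aw; right.
by have [->//|] := IH _ _ wps s0; exact: ltw_trans.
Qed.

(* On a Lyndon word, the smallest proper suffix is also the longest proper
   Lyndon suffix, so this is the usual standard factorization. *)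
Definition stdfact w u v : Prop :=
  [/\ w = u ++ v, u != [::], v != [::] &
    forall p s, w = p ++ s -> p != [::] -> s != [::] -> s = v \/ ltw v s].

Definition rfactor w := minsuffix (behead w).
Definition lfactor w := take (size w - size (rfactor w)) w.

Lemma stdfact_exists w : 1 < size w -> stdfact w (lfactor w) (rfactor w).
Proof.
case: w => [|a w] //=; rewrite ltnS => w1; rewrite /lfactor /rfactor /=.
have := minsuffix_eq0 w; have := @minsuffix_le w.
have [p] := minsuffixP w; move: (minsuffix w) => m e mle m0.
have -> : take ((size w).+1 - size m) (a :: w) = a :: p.
  have -> : (size w).+1 - size m = size (a :: p) by rewrite e size_cat /=; lia.
  by rewrite e -cat_cons take_size_cat.
split=> //; first by rewrite e.
  by rewrite m0; case: (w) w1.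
by move=> [|c q] s // [_ bw] _ s0; apply: (mle q).
Qed.

Lemma stdfact_uniq w u v : stdfact w u v -> u = lfactor w /\ v = rfactor w.
Proof.
move=> [e u0 v0 vle].
have w1 : 1 < size w.
  by rewrite e size_cat; case: (u) u0 (v) v0 => [|? ?] // _ [|? ?] //= _; lia.
have [e' u0' v0' vle'] := stdfact_exists w1.
have ev : v = rfactor w.
  have [//|h] := vle' _ _ e u0 v0; have [//|h'] := vle _ _ e' u0' v0'.
  by have := ltw_trans h h'; rewrite ltwnn.
split=> //; rewrite /lfactor -ev e size_cat addnK take_size_cat //.
Qed.

(** A proper suffix of [v] is a suffix of [w], hence above [v]. Let a proper suffix [s] of [u] be
    below [u]: if it is not a prefix of [u] then [s v < w], which is absurd; if [u = s q] then
    [w < s v] yields [q v < v], against the minimality of [v]. *)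
Lemma lyndon_stdfact w u v : lyndon w -> stdfact w u v ->
  [/\ lyndon u, lyndon v & ltw u v].
Proof.
move=> Lw [e u0 v0 vle].
have wv : ltw w v by rewrite e; apply: lyndon_suffix; rewrite -?e.
split; last by apply: ltw_trans wv; rewrite e; exact: ltw_prefix.
  apply/lyndonP; split=> // p s us p0 s0.
  have := ltw_total u s => /or3P[/eqP us'|//|su].
    have := congr1 size us; rewrite {1}us' size_cat.
    by case: (p) p0 => //= *; lia.
  have wsv : ltw w (s ++ v).
    rewrite e us -catA; apply: lyndon_suffix => //; last by case: (s) s0.
    by rewrite catA -us -e.
  have [/prefixP[q uq]|np] := boolP (prefix s u); last first.
    by have := ltw_trans wsv; rewrite e => /(_ _ (ltw_cat_nprefix v v su np)); rewrite ltwnn.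
  move: wsv; rewrite e uq -catA ltw_cat2l => h.
  have [] := vle s (q ++ v); rewrite ?e ?uq ?catA //.
  - by case: (q) => //; case: (v) v0.
  - move/(congr1 size); have := congr1 size uq; rewrite {1}us !size_cat.
    by case: (p) p0 => //= *; lia.
  - by move/ltw_trans => /(_ _ h); rewrite ltwnn.
apply/lyndonP; split=> // p s vs p0 s0.
have [] := vle (u ++ p) s; rewrite ?e ?vs ?catA //.
- by case: (u) u0.
- by move/(congr1 size); rewrite size_cat; case: (p) p0 => //= *; lia.
Qed.

(** A suffix [q v] with [q] a proper suffix of [u] satisfies [v <= u2 <= q < q v], where [u2] is the
    right factor of [u]; so [v] remains the smallest suffix. *)
Lemma stdfact_cat u v : lyndon u -> lyndon v ->
  (forall u1 u2, stdfact u u1 u2 -> ~~ ltw u2 v) -> stdfact (u ++ v) u v.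
Proof.
move=> Lu Lv h; have u0 := lyndon_neq0 Lu; have v0 := lyndon_neq0 Lv.
split=> // p s e p0 s0.
have [[q [q0 uq sq]]|[q [pq vq]]] := cat_eq_cat e; last first.
  have [q0|q0] := eqVneq q [::]; first by left; rewrite vq q0.
  by right; rewrite vq; apply: lyndon_suffix; rewrite -?vq.
right; rewrite sq.
have u1 : 1 < size u by rewrite uq size_cat; case: (p) p0 (q) q0 => [|? ?] //= _ [|? ?] //= _; lia.
have su := stdfact_exists u1; have := h _ _ su; case: su => _ _ _ /(_ _ _ uq p0 q0).
move: (rfactor u) => u2 u2q vu2.
have vq : q = v \/ ltw v q.
  have : u2 = v \/ ltw v u2.
    by have := ltw_total u2 v; rewrite (negbTE vu2) /= => /orP[/eqP|]; [left|right].
  case: u2q => [->|u2q] // [<-|vu2']; right=> //; exact: ltw_trans u2q.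
by case: vq => [->|/ltw_catr]; [exact: ltw_prefix|apply].
Qed.

Definition lew u v := (u == v) || ltw u v.

Lemma lew_total : total lew.
Proof.
by move=> u v; have := ltw_total u v; rewrite /lew eq_sym; case: eqP => //= _ ->.
Qed.

Lemma lew_trans : transitive lew.
Proof.
move=> v u w /orP[/eqP->//|uv] /orP[/eqP<-|vw]; first by rewrite /lew uv orbT.
by rewrite /lew (ltw_trans uv vw) orbT.
Qed.

Lemma lew_sorted_cons w (s : seq (seq nat)) : uniq (w :: s) -> sorted lew (w :: s) ->
  [/\ uniq s, sorted lew s & forall u, u \in s -> ltw w u].
Proof.
move=> /= /andP[ws us] ps; split=> //; first exact: path_sorted ps.
move=> u us'; have /allP/(_ _ us') := order_path_min lew_trans ps.
by case/orP => // /eqP wu; rewrite wu us' in ws.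
Qed.

(** * Finite lists of words *)

Fixpoint words d k : seq (seq nat) :=
  if k is k'.+1 then [seq a :: w | a <- iota 0 d, w <- words d k'] else [:: [::]].

Lemma mem_words d k w :
  (w \in words d k) = (size w == k) && all (fun a => a < d) w.
Proof.
elim: k w => [|k IH] w; first by rewrite inE; case: w.
apply/allpairsP/idP => [[[a v] /= [ai vw ->]]|].
  move: ai vw; rewrite mem_iota IH /= => ->.
  by move=> /andP[/eqP -> ->]; rewrite eqxx.
case: w => [|a w] //= /andP[sw /andP[ad wd]]; exists (a, w).
by rewrite mem_iota IH wd andbT.
Qed.

Lemma uniq_words d k : uniq (words d k).
Proof.
elim: k => //= k IH; apply: allpairs_uniq; rewrite ?iota_uniq //.
by move=> [a u] [b v] _ _ /= [-> ->].
Qed.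

Lemma size_words d k : size (words d k) = d ^ k.
Proof. by elim: k => //= k IH; rewrite size_allpairs size_iota IH expnS. Qed.

Definition lyndon_words d k : seq (seq nat) :=
  [seq w <- words d k | lyndon w].

Definition words_upto d k := flatten [seq words d i | i <- iota 0 k.+1].

Lemma mem_words_upto d k w :
  (w \in words_upto d k) = (size w <= k) && all (fun a => a < d) w.
Proof.
apply/flattenP/idP => [[_ /mapP[i ik ->]]|/andP[wk wd]].
  by rewrite mem_words => /andP[/eqP -> ->]; rewrite mem_iota in ik; rewrite andbT; lia.
exists (words d (size w)); last by rewrite mem_words eqxx.
by apply: map_f; rewrite mem_iota; lia.
Qed.

(** The lexicographic order is not well founded on words of unbounded length; this position among
    the short words supports induction along it. *)
Definition rank d k v := count (fun w => ltw w v) (words_upto d k).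

Lemma rank_lt d k u v : size u <= k -> all (fun a => a < d) u -> ltw u v ->
  rank d k u < rank d k v.
Proof.
move=> uk ud uv; rewrite /rank -!size_filter.
set s := words_upto d k.
have us : u \in filter (fun w => ltw w v) s.
  by rewrite mem_filter uv mem_words_upto uk ud.
apply: leq_ltn_trans (_ : size (rem u (filter (fun w => ltw w v) s)) < _).
  have <- : filter (fun w => ltw w u) (filter (fun w => ltw w v) s) =
            filter (fun w => ltw w u) s.
    rewrite -filter_predI; apply: eq_filter => w /=.
    by case wu: (ltw w u); rewrite // (ltw_trans wu uv).
  move: us; move: (filter (fun w => ltw w v) s) => {}s.
  elim: s => //= w s IH; rewrite inE eq_sym; case: eqVneq => [->|wu] /=.
    by rewrite ltwnn size_filter => _; exact: count_size.
  by move=> /IH; case: ifP => //= _; lia.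
by rewrite size_rem // prednK //; case: (filter _ s) us.
Qed.

End Words.

(** * Lyndon commutators *)

Section LyndonCommutators.
Local Open Scope classical_set_scope.
Local Open Scope group_scope.
Variables (G : groupType) (x : nat -> G) (d : nat).
Implicit Types (u v w : seq nat).

(* [bc w] is the basic commutator obtained by bracketing the letters of [w]
   along iterated standard factorizations; the first argument of [bc_rec] is
   fuel. *)
Fixpoint bc_rec (k : nat) w : G :=
  match k, w with
  | _, [:: a] => x a
  | k'.+1, _ => [~ bc_rec k' (lfactor w), bc_rec k' (rfactor w)]
  | 0, _ => 1
  end.

Definition bc w := bc_rec (size w) w.

Lemma bc1 a : bc [:: a] = x a.
Proof. by []. Qed.

Lemma bc_recS k w : 1 < size w ->
  bc_rec k.+1 w = [~ bc_rec k (lfactor w), bc_rec k (rfactor w)].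
Proof. by case: w => [|a [|b w]]. Qed.

Lemma bc_recE k w : w != [::] -> size w <= k -> bc_rec k w = bc w.
Proof.
rewrite /bc; move sw: (size w) => l.
elim/ltn_ind: l k w sw => l IH k w sw w0 wk.
case: w sw w0 wk => [|a [|b w]] // sw _ lk; first by case: (k) (l) => [|?] [|?].
have [] := stdfact_exists (isT : 1 < size [:: a, b & w]).
set u := lfactor _; set v := rfactor _ => e u0 v0 _.
have : size u + size v = l by rewrite -sw e size_cat.
have : 0 < size u by rewrite -size_word_gt0.
have : 0 < size v by rewrite -size_word_gt0.
case: k l lk sw IH {e} => [|k] [|l] //= lk sw IH su sv uv.
rewrite -/u -/v (IH (size u) _ k u) // ?(IH (size v) _ k v) //; try lia.
by rewrite (IH (size u) _ l u) ?(IH (size v) _ l v) //; lia.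
Qed.

Lemma bc_stdfact w u v : stdfact w u v -> bc w = [~ bc u, bc v].
Proof.
move=> h; have [-> ->] := stdfact_uniq h; case: h => e u0 v0 _.
have w1 : 1 < size w.
  by rewrite e size_cat; case: (u) u0 (v) v0 => [|? ?] // _ [|? ?] //= _; lia.
have [] := stdfact_exists w1; move: (lfactor w) (bc_recS (size w).-1 w1) => l.
move: (rfactor w) => r E e' l0 r0 _.
have : size w = size l + size r by rewrite e' size_cat.
have : 0 < size l by rewrite -size_word_gt0.
have : 0 < size r by rewrite -size_word_gt0.
by move=> sl sr slr; rewrite /bc -{1}(prednK (ltnW w1)) E !bc_recE //; lia.
Qed.

Definition Lyn w : bool := lyndon w && all (fun a => a < d) w.

Lemma Lyn_neq0 w : Lyn w -> w != [::].
Proof. by case/andP => /lyndon_neq0. Qed.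

Lemma Lyn_stdfact w u v : Lyn w -> stdfact w u v -> [/\ Lyn u, Lyn v & ltw u v].
Proof.
move=> /andP[Lw wd] h; have [Lu Lv uv] := lyndon_stdfact Lw h.
by case: h wd => -> _ _ _; rewrite all_cat => /andP[ud vd]; rewrite /Lyn Lu Lv ud vd.
Qed.

Lemma Lyn_ind (P : seq nat -> Prop) :
  (forall a, a < d -> P [:: a]) ->
  (forall w u v, stdfact w u v -> Lyn w -> Lyn u -> Lyn v -> ltw u v ->
     P u -> P v -> P w) ->
  forall w, Lyn w -> P w.
Proof.
move=> P1 P2 w; move sw: (size w) => l; elim/ltn_ind: l w sw => l IH w sw Lw.
have [w1|w1] := leqP (size w) 1.
  have := Lyn_neq0 Lw; case: w w1 Lw {sw} => [|a [|b w]] // _ /andP[_].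
  by rewrite /= andbT => /P1.
have st := stdfact_exists w1; have [Lu Lv uv] := Lyn_stdfact Lw st.
have [e u0 v0 _] := st; rewrite size_word_gt0 in u0; rewrite size_word_gt0 in v0.
have := congr1 size e; rewrite size_cat => se.
by apply: P2 st Lw Lu Lv uv (IH _ _ _ erefl Lu) (IH _ _ _ erefl Lv); lia.
Qed.

Lemma bc_lower_central w : Lyn w -> lower_central (size w) (bc w).
Proof.
elim/Lyn_ind => [a ad|{}w u v st _ Lu Lv _]; first by [].
rewrite (bc_stdfact st); case: st => -> u0 v0 _; rewrite size_cat.
by case: u v u0 v0 {Lu Lv} => [|a u] [|b v] //= _ _; exact: lower_central_comm.
Qed.

Lemma lcq_commgV k i j (y z : G) : 0 < i -> 0 < j -> k <= (i + j).+1 ->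
  lower_central i y -> lower_central j z ->
  lcq k [~ y, z^-1] = (lcq k [~ y, z])^-1.
Proof.
move=> i0 j0 kij Gy Gz; rewrite -invgR homV; congr (_^-1).
by rewrite (lcq_commVg j0 i0) // ?[in j + i]addnC // -homV invgR.
Qed.

(** Since [z |-> [z, y]] is multiplicative modulo [gamma_(k+i+1)], only the generators [bc w] have
    to be examined. *)
Lemma gspan_comm (P S : set _) k i y z : 0 < k -> 0 < i ->
  is_subgroup S -> lower_central (k + i).+1 `<=` S ->
  (forall w, P w -> lower_central k (bc w)) -> lower_central i y ->
  (forall w, P w -> S [~ bc w, y]) ->
  gspan bc k.+1 P z -> S [~ z, y].
Proof.
move=> k0 i0 sS GS PG Gy PS Pz.
have sk : is_subgroup (lower_central k : set G) := (lower_central_normal G k).1.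
have Slcq g h : lcq (k + i).+1 g = lcq (k + i).+1 h -> S g -> S h.
  by move/lcq_eq/GS => gh Sg; rewrite -(mulVKg g h); exact: is_subgroupM.
suff [] : (lower_central k `&` [set z | S [~ z, y]]) z by [].
move: z Pz; apply: gspan_sub.
- split; first by split; [exact: is_subgroup1|rewrite /= comm1g; exact: is_subgroup1].
  move=> z z' [Gz Sz] [Gz' Sz']; split; first exact: sk.2.
  apply: (Slcq ([~ z, y] / [~ z', y])); last exact: sS.2.
  rewrite (@lcq_commMg _ _ k i) //; last exact: is_subgroupV.
  by rewrite gmulfM homV (@lcq_commVg _ _ k i).
- by move=> w Pw; split; [exact: PG|exact: PS].
move=> z Gz; split; first exact: lower_central_sub Gz.
apply: GS; case: i i0 Gy {PS Slcq} => [|i] // _ Gy.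
by have := lower_central_comm Gz Gy; rewrite addSn.
Qed.

(* When [u = u' u''] with [u'' < v], the factorization of [u v] is not standard
   and the Jacobi identity replaces [[u', u''], v] by brackets whose two words
   are both smaller than [v]; hence the induction on the rank of [v]. *)
Lemma bc_comm u v : Lyn u -> Lyn v -> ltw u v ->
  gspan bc (size u + size v).+1
    [set w | [/\ Lyn w, size w = size u + size v & ltw w v]] [~ bc u, bc v].
Proof.
have [r] := ubnP (rank d (size u + size v) v).
move sN: (size u + size v) => N; elim/ltn_ind: N r u v sN => N IHN.
elim=> [|r IHr] u v sN // rv Lu Lv uv.
have [/andP[lu ud] /andP[lv vd]] := (Lu, Lv).
(* When [(u, v)] is the standard factorization of [u v], the bracket is itself the basic commutator
   of the Lyndon word [u v], which is below its suffix [v]. *)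
have std0 : (forall u1 u2, stdfact u u1 u2 -> ~~ ltw u2 v) ->
    gspan bc N.+1 [set w | [/\ Lyn w, size w = N & ltw w v]] [~ bc u, bc v].
  move=> h; rewrite -(bc_stdfact (stdfact_cat lu lv h)); apply: gspan_gen.
  have luv := lyndon_cat lu lv uv; split; first by rewrite /Lyn luv all_cat ud vd.
    by rewrite size_cat.
  by apply: (lyndon_suffix luv); exact: lyndon_neq0.
have [u1|u1] := leqP (size u) 1.
  apply: std0 => u1' u2' [e]; rewrite !size_word_gt0 => h1 h2 _.
  by move: u1; rewrite e size_cat; lia.
have st := stdfact_exists u1; move: st.
set u' := lfactor u; set u'' := rfactor u => st.
have [u2v|u2v] := boolP (ltw u'' v); last first.
  by apply: std0 => w1 w2 /stdfact_uniq[_ ->].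
rewrite (bc_stdfact st); have [Lu' Lu'' u12] := Lyn_stdfact Lu st.
have u'v : ltw u' v by exact: ltw_trans u2v.
case: st => e u'0 u''0 _.
have su : size u = size u' + size u'' by rewrite e size_cat.
have su' : 0 < size u' by rewrite -size_word_gt0.
have su'' : 0 < size u'' by rewrite -size_word_gt0.
have sv : 0 < size v by rewrite -size_word_gt0 lyndon_neq0.
have e1 : size u'' + size v + size u' = N.
  by rewrite addnAC (addnC (size u'')) -su sN.
have e2 : size u' + size v + size u'' = N by rewrite addnAC -su sN.
have lt1 : size u'' + size v < N by rewrite -e1 -[X in X < _]addn0 ltn_add2l.
have lt2 : size u' + size v < N by rewrite -e2 -[X in X < _]addn0 ltn_add2l.
have p1 : 0 < size u'' + size v by rewrite addn_gt0 sv orbT.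
have p2 : 0 < size u' + size v by rewrite addn_gt0 sv orbT.
set S := gspan bc N.+1 _.
have sS : is_subgroup S by exact: gspan_subgroup.
have GS : lower_central N.+1 `<=` S by exact: gspan_lower_central.
have SG : S `<=` lower_central N.
  apply: gspan_sub; first exact: (lower_central_normal _ _).1.
    by move=> w /= [Lw <- _]; exact: bc_lower_central.
  exact: lower_central_sub.
(* Any subgroup between [gamma_(N+1)] and [gamma_N] is normal. *)
have nS : is_normal S.
  split=> // g h Sg; rewrite -(mulVKg g (g ^ h)); apply: (is_subgroupM sS Sg).
  apply: GS; have N0 : 0 < N by rewrite -sN addn_gt0 sv orbT.
  rewrite -(prednK N0); apply: (commutator_subgroupP (x := g) (y := h)) => //.
  exact: SG.
(* Once the bracket is ordered, its right word still has smaller rank than [v], so the inner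
   induction applies. *)
have below a b : Lyn a -> Lyn b -> size a + size b = N -> ltw a v -> ltw b v ->
    S [~ bc a, bc b].
  move=> La Lb sab av bv; have N0 a' : size a' <= N -> Lyn a' -> ltw a' v ->
      rank d N a' < r.
    move=> sa /andP[_ da] va; apply: leq_trans (_ : rank d N v <= r); last by [].
    exact: rank_lt.
  have [sa sb] : size a <= N /\ size b <= N by rewrite -sab leq_addr leq_addl.
  have [/eqP ->|ab|ba] := or3P (ltw_total a b).
  - by rewrite commgg; exact: is_subgroup1.
  - apply: gspan_mono (IHr a b sab (N0 b sb Lb bv) La Lb ab).
    by move=> w /= [Lw sw wb]; split=> //; exact: ltw_trans bv.
  - rewrite -invgR; apply: (is_subgroupV sS).
    rewrite addnC in sab; apply: gspan_mono (IHr b a sab (N0 a sa La av) Lb La ba).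
    by move=> w /= [Lw sw wb]; split=> //; exact: ltw_trans av.
have [Ga Gb Ge] : [/\ lower_central (size u') (bc u'),
    lower_central (size u'') (bc u'') & lower_central (size v) (bc v)].
  by split; exact: bc_lower_central.
have sub1 : gspan bc (size u'' + size v).+1
  [set w | [/\ Lyn w, size w = size u'' + size v & ltw w v]] [~ bc u'', bc v].
  exact: (IHN _ lt1 _ u'' v erefl (ltnSn _)).
have sub2 : gspan bc (size u' + size v).+1
  [set w | [/\ Lyn w, size w = size u' + size v & ltw w v]] [~ bc u', bc v].
  exact: (IHN _ lt2 _ u' v erefl (ltnSn _)).
have GV k (g : G) : lower_central k g -> lower_central k g^-1.
  by apply: is_subgroupV; exact: (lower_central_normal _ _).1.
(* The inner brackets [[u'', v]] and [[u', v]] have smaller weight and expand into words below [v];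
   bracketing these with the remaining word, also below [v], is covered by [below]. The inverses
   only change signs. *)
rewrite -[bc u'']invgK; apply: (three_commutators (y := bc v) nS).
  have := @gspan_comm [set w | [/\ Lyn w, size w = size u'' + size v & ltw w v]]
    S _ _ (bc u') [~ (bc u'')^-1, (bc v)^-1] p1 su' sS.
  rewrite e1; apply; [exact: GS| |exact: Ga| |].
  - by move=> w /= [Lw <- _]; exact: bc_lower_central.
  - by move=> w /= [Lw sw wv]; apply: below; rewrite ?sw ?e1.
  apply: gspan_lcq sub1; rewrite (@lcq_commVg _ _ (size u'') (size v)) //; last exact: GV.
  by rewrite (@lcq_commgV _ (size u'') (size v)) // invgK.
have := @gspan_comm [set w | [/\ Lyn w, size w = size u' + size v & ltw w v]]
  S _ _ (bc u'')^-1 [~ bc v, (bc u')^-1] p2 su'' sS.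
rewrite e2; apply; [exact: GS| |exact: GV| |].
- by move=> w /= [Lw <- _]; exact: bc_lower_central.
- move=> w /= [Lw sw wv].
  have Sw : S [~ bc w, bc u''] by apply: below; rewrite ?sw ?e2.
  have Gw := bc_lower_central Lw.
  have h : lcq N.+1 [~ bc w, bc u'']^-1 = lcq N.+1 [~ bc w, (bc u'')^-1].
    by rewrite homV (@lcq_commgV _ (size w) (size u'')) ?sw ?e2 // -sw.
  exact: gspan_lcq h (is_subgroupV sS Sw).
apply: gspan_lcq sub2; rewrite (@lcq_commgV _ (size v) (size u')) //; last first.
  by rewrite addnC.
by rewrite -homV invgR.
Qed.

Hypothesis x_gen : forall A : set G, is_subgroup A ->
  (forall a, a < d -> A (x a)) -> forall y, A y.

(** By bilinearity in both arguments, a bracket of weight [k + 2] reduces to brackets of a Lyndon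
    word with a letter, which [bc_comm] rewrites after putting the two words in increasing order. *)
Lemma lower_central_span k y : lower_central k.+1 y ->
  gspan bc k.+2 [set w | Lyn w /\ size w = k.+1] y.
Proof.
elim: k y => [|k IH] y.
  move=> _; apply: x_gen; first exact: gspan_subgroup.
  by move=> a ad; rewrite -bc1; apply: gspan_gen; rewrite /= /Lyn /= ad.
rewrite lower_centralS; set S := gspan bc _ _.
have sS : is_subgroup S by exact: gspan_subgroup.
have GS : lower_central k.+3 `<=` S by exact: gspan_lower_central.
apply: commutator_subgroup_sub => // {}y z Gy _.
apply: (@gspan_comm _ _ k.+1 1 _ y _ _ sS _ _ _ _ (IH y Gy)) => //.
- by rewrite addn1.
- by move=> w [Lw <-]; exact: bc_lower_central.
move=> w [Lw sw]; rewrite -invgR; apply: (is_subgroupV sS).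
have Gw : lower_central k.+1 (bc w) by rewrite -sw; exact: bc_lower_central.
have zs : gspan bc 2 [set w | Lyn w /\ size w = 1%N] z.
  apply: (x_gen (gspan_subgroup _ _ _)) => a ad.
  by rewrite -bc1; apply: gspan_gen; rewrite /= /Lyn /= ad.
apply: (@gspan_comm _ _ 1 k.+1 _ z _ _ sS _ _ _ _ zs) => //.
move=> a [La sa]; have [/eqP ->|aw|wa] := or3P (ltw_total a w).
- by rewrite commgg; exact: is_subgroup1.
- have := bc_comm La Lw aw; rewrite sa sw; apply: gspan_mono => w' /= [? ? ?].
  by split.
- rewrite -invgR; apply: (is_subgroupV sS).
  have := bc_comm Lw La wa; rewrite sa sw addn1; apply: gspan_mono => w' /= [? ? ?].
  by split.
Qed.

End LyndonCommutators.

(** * The Magnus expansion *)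

Section Series.
Local Open Scope ring_scope.

(* Power series with integer coefficients in the noncommuting letters
   [0, 1, 2, ...], given by their coefficients on words. *)
Definition series := seq nat -> int.

Implicit Types (f g h : series) (u v w : seq nat).

HB.instance Definition _ := gen_eqMixin series.
HB.instance Definition _ := gen_choiceMixin series.

Definition series_zero : series := fun=> 0.
Definition series_opp f : series := fun w => - f w.
Definition series_add f g : series := fun w => f w + g w.
Definition series_one : series := fun w => (w == [::])%:R.
Definition series_mul f g : series :=
  fun w => \sum_(i < (size w).+1) f (take i w) * g (drop i w).

Lemma series_addA : associative series_add.
Proof. by move=> f g h; apply/funext => w; apply: addrA. Qed.
Lemma series_addC : commutative series_add.
Proof. by move=> f g; apply/funext => w; apply: addrC. Qed.
Lemma series_add0 : left_id series_zero series_add.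
Proof. by move=> f; apply/funext => w; apply: add0r. Qed.
Lemma series_addN : left_inverse series_zero series_opp series_add.
Proof. by move=> f; apply/funext => w; apply: addNr. Qed.

HB.instance Definition _ := GRing.isZmodule.Build series
  series_addA series_addC series_add0 series_addN.

Definition shift (a : nat) f : series := fun w => f (a :: w).

Lemma series_mul_nil f g : series_mul f g [::] = f [::] * g [::].
Proof. by rewrite /series_mul big_ord_recl big_ord0 addr0. Qed.

(** Peeling off the first letter turns the convolution into a recursion, so that the ring laws
    follow by induction on the word. *)
Lemma series_mul_cons f g a w :
  series_mul f g (a :: w) = f [::] * g (a :: w) + series_mul (shift a f) g w.
Proof. by rewrite /series_mul big_ord_recl. Qed.

Lemma series_mulDl : left_distributive series_mul series_add.
Proof.
move=> f g h; apply/funext => w.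
by rewrite /series_mul /series_add -big_split; apply: eq_bigr => i _; rewrite mulrDl.
Qed.

Lemma series_mulDr : right_distributive series_mul series_add.
Proof.
move=> f g h; apply/funext => w.
by rewrite /series_mul /series_add -big_split; apply: eq_bigr => i _; rewrite mulrDr.
Qed.

Lemma series_mul_scale (k : int) f g w :
  series_mul (fun v => k * f v) g w = k * series_mul f g w.
Proof. by rewrite /series_mul big_distrr; apply: eq_bigr => i _; apply/esym/mulrA. Qed.

Lemma series_mulA : associative series_mul.
Proof.
move=> f g h; apply/funext => w; elim: w f => [|a w IH] f.
  by rewrite !series_mul_nil mulrA.
rewrite !series_mul_cons series_mul_nil IH.
have -> : shift a (series_mul f g) =
    series_add (fun v => f [::] * shift a g v) (series_mul (shift a f) g).
  by apply/funext => v; rewrite /shift series_mul_cons.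
by rewrite series_mulDl /series_add series_mul_scale mulrDr !addrA mulrA.
Qed.

Lemma series_mul1 : left_id series_one series_mul.
Proof.
move=> f; apply/funext => -[|a w]; first by rewrite series_mul_nil mul1r.
rewrite series_mul_cons mul1r [X in _ + X]big1 ?addr0 // => i _.
by rewrite /shift /series_one mul0r.
Qed.

Lemma series_mulr1 : right_id series_one series_mul.
Proof.
move=> f; apply/funext => w; elim: w f => [|a w IH] f.
  by rewrite series_mul_nil mulr1.
by rewrite series_mul_cons IH mulr0 add0r.
Qed.

Lemma series_one_neq0 : series_one != series_zero.
Proof. by apply/eqP => /(congr1 (fun f => f [::])). Qed.

HB.instance Definition _ := GRing.Zmodule_isNzRing.Build series
  series_mulA series_mul1 series_mulr1 series_mulDl series_mulDr series_one_neq0.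

Lemma seriesDE f g w : (f + g) w = f w + g w. Proof. by []. Qed.
Lemma seriesNE f w : (- f) w = - f w. Proof. by []. Qed.
Lemma series1E w : (1 : series) w = (w == [::])%:R. Proof. by []. Qed.
Lemma seriesME f g w :
  (f * g) w = \sum_(i < (size w).+1) f (take i w) * g (drop i w).
Proof. by []. Qed.
Definition order_ge (k : nat) f : Prop := forall w, (size w < k)%N -> f w = 0.

Lemma order_ge_leq k l f : (l <= k)%N -> order_ge k f -> order_ge l f.
Proof. by move=> lk kf w wl; apply: kf; exact: leq_trans lk. Qed.

Lemma order_geD k f g : order_ge k f -> order_ge k g -> order_ge k (f + g).
Proof. by move=> kf kg w wk; rewrite seriesDE kf // kg. Qed.

Lemma order_geN k f : order_ge k f -> order_ge k (- f).
Proof. by move=> kf w wk; rewrite seriesNE kf // oppr0. Qed.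

Lemma order_geM k l f g : order_ge k f -> order_ge l g -> order_ge (k + l) (f * g).
Proof.
move=> kf lg w wkl; rewrite seriesME big1 // => i _.
have [ik|ki] := ltnP i k.
  by rewrite kf ?mul0r // size_take; case: ifP => //; lia.
by rewrite lg ?mulr0 // size_drop; have := ltn_ord i; lia.
Qed.

Lemma order_geMl k f g : order_ge k f -> order_ge k (f * g).
Proof. by move=> kf; rewrite -[k]addn0; exact: order_geM. Qed.

Lemma order_geMr k f g : order_ge k g -> order_ge k (f * g).
Proof. by move=> kg; rewrite -[k]add0n; exact: order_geM. Qed.

(** Every cut other than the one at [k] leaves a piece too short for [f] or for [g]. *)
Lemma series_leadM k l f g w : order_ge k f -> order_ge l g ->
  size w = (k + l)%N -> (f * g) w = f (take k w) * g (drop k w).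
Proof.
move=> kf lg sw; rewrite seriesME.
have kw : (k < (size w).+1)%N by lia.
rewrite (bigD1 (Ordinal kw)) //= big1 ?addr0 // => i.
rewrite -val_eqE /= => ik; have [ik'|ki] := ltnP i k.
  by rewrite kf ?mul0r // size_take; case: ifP => //; lia.
by rewrite lg ?mulr0 // size_drop; have := ltn_ord i; lia.
Qed.

(** An invertible series is stored with its inverse, so inversion is a swap; [sunit_inj] shows that
    the first component alone decides equality. *)
Definition sunit : Type :=
  {p : (series * series)%type | (p.1 * p.2 == 1) && (p.2 * p.1 == 1)}.

HB.instance Definition _ := Choice.on sunit.

Definition sunit_val (p : sunit) : series := (val p).1.

Definition mk_sunit f g (fg : f * g = 1) (gf : g * f = 1) : sunit :=
  exist _ (f, g) (introT andP (conj (introT eqP fg) (introT eqP gf))).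

Lemma sunitP (p : sunit) : (val p).1 * (val p).2 = 1 /\ (val p).2 * (val p).1 = 1.
Proof. by case: p => p /= /andP[/eqP ? /eqP ?]. Qed.

Lemma sunit_mulP (p q : sunit) :
  ((val p).1 * (val q).1) * ((val q).2 * (val p).2) = 1.
Proof.
by rewrite mulrA -[X in X * _]mulrA (sunitP q).1 mulr1 (sunitP p).1.
Qed.

Lemma sunit_mulP' (p q : sunit) :
  ((val q).2 * (val p).2) * ((val p).1 * (val q).1) = 1.
Proof.
by rewrite mulrA -[X in X * _]mulrA (sunitP p).2 mulr1 (sunitP q).2.
Qed.

Definition sunit_one := mk_sunit (mulr1 (1 : series)) (mulr1 (1 : series)).
Definition sunit_mul p q := mk_sunit (sunit_mulP p q) (sunit_mulP' p q).
Definition sunit_inv p := mk_sunit (sunitP p).2 (sunitP p).1.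

Lemma sunit_inj (p q : sunit) : (val p).1 = (val q).1 -> p = q.
Proof.
move=> pq; apply: val_inj; move: pq (sunitP p) (sunitP q).
case: (val p) (val q) => [f f'] [g g'] /= -> [_ f'g] [gg' _]; congr (_, _).
by rewrite -[f']mulr1 -gg' mulrA f'g mul1r.
Qed.

Lemma sunit_mulA : associative sunit_mul.
Proof. by move=> p q r; apply: sunit_inj; apply: mulrA. Qed.
Lemma sunit_mul1 : left_id sunit_one sunit_mul.
Proof. by move=> p; apply: sunit_inj; apply: mul1r. Qed.
Lemma sunit_mulr1 : right_id sunit_one sunit_mul.
Proof. by move=> p; apply: sunit_inj; apply: mulr1. Qed.
Lemma sunit_mulV : left_inverse sunit_one sunit_inv sunit_mul.
Proof. by move=> p; apply: sunit_inj; exact: (sunitP p).2. Qed.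
Lemma sunit_mulrV : right_inverse sunit_one sunit_inv sunit_mul.
Proof. by move=> p; apply: sunit_inj; exact: (sunitP p).1. Qed.

HB.instance Definition _ := isGroup.Build sunit
  sunit_mulA sunit_mul1 sunit_mulr1 sunit_mulV sunit_mulrV.

Definition var (a : nat) : series := fun w => (w == [:: a])%:R.

(** The geometric series of [- a]: the coefficient is [(-1)^k] on the [k]-th power of the letter [a]
    and 0 on other words. *)
Fixpoint var_inv_rec (a : nat) w : int :=
  if w is b :: w' then if b == a then - var_inv_rec a w' else 0 else 1.
Definition var_inv a : series := var_inv_rec a.

Lemma shift_var_inv a b : shift b (var_inv a) = if b == a then - var_inv a else 0.
Proof. by apply/funext => w; rewrite /shift /=; case: eqP. Qed.

Lemma shift_1var a b : shift b (1 + var a) = if b == a then 1 else 0.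
Proof.
apply/funext => w; rewrite /shift seriesDE series1E add0r /var eqseq_cons.
by case: eqP => _ //=; rewrite series1E.
Qed.

Lemma series_mulE f g : series_mul f g = f * g. Proof. by []. Qed.

Lemma one_var_nil a : (1 + var a) [::] = 1.
Proof. by rewrite seriesDE series1E addr0. Qed.

Lemma var_mulV a : (1 + var a) * var_inv a = 1.
Proof.
apply/funext => -[|b w].
  by rewrite -series_mulE series_mul_nil one_var_nil.
rewrite -series_mulE series_mul_cons shift_1var series_mulE one_var_nil mul1r.
rewrite series1E [var_inv a _]/=; case: eqP => _.
  by rewrite mul1r addNr.
by rewrite mul0r addr0.
Qed.

Lemma var_mulVr a : var_inv a * (1 + var a) = 1.
Proof.
apply/funext => w; elim: w => [|b w IH].
  by rewrite -series_mulE series_mul_nil one_var_nil.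
rewrite -series_mulE series_mul_cons shift_var_inv series_mulE mul1r.
have -> : (1 + var a) (b :: w) = shift b (1 + var a) w by [].
rewrite shift_1var; case: eqP => _; last by rewrite mul0r.
by rewrite mulNr seriesNE IH subrr.
Qed.

Definition var_unit a : sunit := mk_sunit (var_mulV a) (var_mulVr a).

End Series.

Lemma mul_sub1 (A : nzRingType) (a b : A) :
  (a * b = a + b - 1 + (a - 1) * (b - 1))%R.
Proof.
have -> : ((a - 1) * (b - 1) = a * b - (a + b - 1))%R; last by rewrite addrC subrK.
rewrite mulrBr mulr1 mulrBl mul1r -[LHS]addrA -opprD; congr (_ - _)%R.
by rewrite addrA [(b + a)%R]addrC.
Qed.

Lemma commutator_sub1 (A : nzRingType) (a b : A) :
  ((a - 1) * (b - 1) - (b - 1) * (a - 1) = a * b - b * a)%R.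
Proof.
rewrite [(a * b)%R]mul_sub1 [(b * a)%R]mul_sub1 [(b + a)%R]addrC.
set c := (a + b - 1)%R; by rewrite [in RHS]opprD addrACA subrr add0r.
Qed.

(** * The filtration of a group by the order of its Magnus expansion *)

Section MagnusFiltration.
Local Open Scope ring_scope.
Local Open Scope classical_set_scope.
Variables (F : groupType) (phi : {multiplicative F -> sunit}).
Implicit Types (x y z : F) (w : seq nat).

Definition mag x : series := sunit_val (phi x).

Lemma magM x y : mag (x * y)%g = mag x * mag y.
Proof. by rewrite /mag gmulfM. Qed.

Lemma mag1 : mag 1%g = 1.
Proof. by rewrite /mag hom1. Qed.

Lemma magV x : mag x * mag x^-1%g = 1.
Proof. by rewrite -magM mulgV mag1. Qed.

Lemma magVr x : mag x^-1%g * mag x = 1.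
Proof. by rewrite -magM mulVg mag1. Qed.

Lemma magF_sub1 x y :
  mag (x / y)%g - 1 = ((mag x - 1) - (mag y - 1)) * mag y^-1%g.
Proof. by rewrite magM opprB addrA subrK mulrBl magV. Qed.

Lemma magJ_sub1 x y : mag (x ^ y)%g - 1 = mag y^-1%g * (mag x - 1) * mag y.
Proof. by rewrite /conjg !magM mulrBr mulr1 mulrBl magVr mulrA. Qed.

(** From [[x, y] - 1 = x^-1 y^-1 (x y - y x)]: up to an invertible factor, a group commutator is the
    ring commutator of the parts without constant term. *)
Lemma magR_sub1 x y : mag [~ x, y]%g - 1 =
  mag (x^-1 * y^-1)%g * ((mag x - 1) * (mag y - 1) - (mag y - 1) * (mag x - 1)).
Proof.
rewrite commutator_sub1 -!magM.
by rewrite mulrBr -!magM !mulgA mulgVK mulVg mag1 /commg /conjg !mulgA.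
Qed.

Definition mag_ge (k : nat) : set F := [set x | order_ge k (mag x - 1)].

Lemma mag_ge_normal k : is_normal (mag_ge k).
Proof.
split; first split=> [|x y kx ky] /=.
- by rewrite /mag_ge /= mag1 subrr.
- rewrite /mag_ge /= magF_sub1; apply: order_geMl.
  by apply: order_geD => //; exact: order_geN.
- by move=> x y kx; rewrite /mag_ge /= magJ_sub1; exact/order_geMl/order_geMr.
Qed.

Lemma mag_ge_comm k l x y : mag_ge k x -> mag_ge l y -> mag_ge (k + l) [~ x, y]%g.
Proof.
move=> kx ly; rewrite /mag_ge /= magR_sub1; apply/order_geMr/order_geD.
  exact: order_geM.
by apply: order_geN; rewrite addnC; exact: order_geM.
Qed.

Lemma lower_central_mag_ge k : mag_ge 1 = setT ->
  lower_central k.+1 `<=` mag_ge k.+1.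
Proof.
move=> U1; elim: k => [|k IH]; first by rewrite U1.
rewrite lower_centralS; apply: commutator_subgroup_sub.
  exact: (mag_ge_normal _).1.
move=> x y Gx _; rewrite -addn1; apply: mag_ge_comm; first exact: IH.
by rewrite U1.
Qed.

(** The correction [(mag x - 1) (mag y - 1)] has order at least [2 k]. *)
Lemma mag_coefM k x y w : mag_ge k x -> mag_ge k y -> w != [::] ->
  (size w < k + k)%N -> mag (x * y)%g w = mag x w + mag y w.
Proof.
move=> kx ky w0 wk; rewrite magM.
rewrite mul_sub1.
rewrite !seriesDE seriesNE series1E (negbTE w0) oppr0 addr0.
by rewrite (order_geM kx ky) // addr0.
Qed.

Lemma mag_coefX k x e w : mag_ge k x -> w != [::] -> (size w < k + k)%N ->
  mag (int_expg x e) w = e * mag x w.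
Proof.
move=> kx w0 wk; have sU := (mag_ge_normal k).1.
elim/int_rec: e => [|e IH|e IH].
- by rewrite mag1 series1E (negbTE w0) mul0r.
- rewrite -addn1 PoszD int_expgD (@mag_coefM k) ?IH //; last exact: (is_subgroup_intX _ sU kx).
  by rewrite mulrDl mul1r.
have := @mag_coefM k (int_expg x (- e.+1%:Z)) x w.
have -> : (int_expg x (- e.+1%:Z) * x = int_expg x (- e%:Z))%g.
  by rewrite -int_expgS -addn1 PoszD opprD addrK.
rewrite IH => /(_ _ kx w0 wk) => h.
have {}h := h (is_subgroup_intX _ sU kx).
by move/(canLR (addrK _)): h => <-; rewrite -addn1 PoszD opprD mulrDl mulN1r.
Qed.

(** * Divisibility of coefficients by the gcd of the letter orders *)

Section Divisibility.
Variable rho : nat -> nat.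

Definition word_gcd w : nat := \big[gcdn/0%N]_(a <- w) rho a.

Lemma word_gcd_cat u v : word_gcd (u ++ v) = gcdn (word_gcd u) (word_gcd v).
Proof. by rewrite /word_gcd big_cat. Qed.

Lemma word_gcd_take i w : (word_gcd w %| word_gcd (take i w))%N.
Proof. by rewrite -{1}(cat_take_drop i w) word_gcd_cat dvdn_gcdl. Qed.

Lemma word_gcd_drop i w : (word_gcd w %| word_gcd (drop i w))%N.
Proof. by rewrite -{1}(cat_take_drop i w) word_gcd_cat dvdn_gcdr. Qed.

(** The gcd of the empty word is 0, so the constant term has to vanish; hence the condition is
    imposed on [mag x - 1]. *)
Definition coef_dvd (b : nat) (f : series) : Prop :=
  forall w, (size w <= b)%N -> (word_gcd w %| f w)%Z.

Lemma coef_dvdD b f g : coef_dvd b f -> coef_dvd b g -> coef_dvd b (f + g).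
Proof. by move=> bf bg w wb; rewrite seriesDE rpredD ?bf ?bg. Qed.

Lemma coef_dvdN b f : coef_dvd b f -> coef_dvd b (- f).
Proof. by move=> bf w wb; rewrite seriesNE rpredN bf. Qed.

(** In each cut either the piece given to [f] has length at most [b], and the gcd of the word
    divides that of the piece, or the piece given to [g] is shorter than [k - 1]. The case [k = 1]
    is an ideal property; [k = 2] gains one length per commutator. *)
Lemma coef_dvdM b k f g : (0 < k)%N -> coef_dvd b f -> order_ge k.-1 g ->
  coef_dvd (b + k.-1) (f * g) /\ coef_dvd (b + k.-1) (g * f).
Proof.
move=> k0 bf kg; split=> w wb; rewrite seriesME; apply: rpred_sum => i _.
  have [ib|bi] := leqP (size (take i w)) b.
    apply: dvdz_mulr; apply: dvdz_trans (bf _ ib).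
    exact: word_gcd_take.
  rewrite kg ?mulr0 ?dvdz0 //; have := congr1 size (cat_take_drop i w).
  by rewrite size_cat; lia.
have [ib|bi] := leqP (size (drop i w)) b.
  apply: dvdz_mull; apply: dvdz_trans (bf _ ib).
  exact: word_gcd_drop.
rewrite kg ?mul0r ?dvdz0 //; have := congr1 size (cat_take_drop i w).
by rewrite size_cat; lia.
Qed.

Definition mag_dvd (b : nat) : set F := [set x | coef_dvd b (mag x - 1)].

Lemma mag_dvd_normal b : is_normal (mag_dvd b).
Proof.
have ideal f g : coef_dvd b f -> coef_dvd b (f * g) /\ coef_dvd b (g * f).
  by move=> bf; have := @coef_dvdM b 1 f g isT bf; rewrite addn0; apply.
split; first split=> [|x y bx by_] /=.
- by rewrite /mag_dvd /= mag1 subrr => w _; rewrite dvdz0.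
- rewrite /mag_dvd /= magF_sub1.
  by apply: (ideal _ _ _).1; apply: coef_dvdD => //; exact: coef_dvdN.
- move=> x y bx; rewrite /mag_dvd /= magJ_sub1.
  by apply: (ideal _ _ _).1; apply: (ideal _ _ _).2.
Qed.

Lemma mag_dvd_comm b x y : mag_dvd b x -> mag_ge 1 y -> mag_dvd b.+1 [~ x, y]%g.
Proof.
move=> bx y1; have [h1 h2] := @coef_dvdM b 2 _ _ isT bx y1.
rewrite addn1 in h1 h2; rewrite /mag_dvd /= magR_sub1.
have h := coef_dvdD h1 (coef_dvdN h2).
have ge0 : order_ge 0 (mag (x^-1 * y^-1)%g) by [].
by have [_] := @coef_dvdM b.+1 1 _ _ isT h ge0; rewrite addn0.
Qed.

Lemma iter_commutator_mag_dvd (R : set F) b k : mag_ge 1 = setT ->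
  R `<=` mag_dvd b -> iter_commutator k R `<=` mag_dvd (b + k).
Proof.
move=> U1 RJ; elim: k => [|k IH]; first by rewrite addn0.
apply: commutator_subgroup_sub; first exact: (mag_dvd_normal _).1.
by move=> x y /IH Rx _; rewrite addnS; apply: mag_dvd_comm; rewrite ?U1.
Qed.

End Divisibility.

End MagnusFiltration.

(** * Lyndon coefficients of the Magnus expansion *)

Lemma mem_lyndon_words d k w :
  (w \in lyndon_words d k) = Lyn d w && (size w == k).
Proof. by rewrite mem_filter mem_words /Lyn andbA andbAC. Qed.

Section MagnusLyndon.
Local Open Scope classical_set_scope.
Local Open Scope ring_scope.
Variables (F : groupType) (phi : {multiplicative F -> sunit}).
Variables (x : nat -> F) (d : nat).
Hypothesis x_gen : forall A : set F, is_subgroup A ->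
  (forall a, (a < d)%N -> A (x a)) -> forall y, A y.
Hypothesis mag_x : forall a, (a < d)%N -> mag phi (x a) = 1 + var a.

Local Notation M := (mag phi).
Local Notation Lyn := (Lyn d).
Local Notation bc := (bc x).

Lemma mag_ge1 : mag_ge phi 1 = setT.
Proof.
apply/seteqP; split=> // y _; apply: x_gen y; first exact: (mag_ge_normal _ _).1.
move=> a ad w; rewrite /= mag_x // addrAC subrr add0r.
by case: w.
Qed.

Lemma mag_nil y : M y [::] = 1.
Proof.
have : mag_ge phi 1 y by rewrite mag_ge1.
move=> /(_ [::] isT); rewrite seriesDE seriesNE series1E.
by move/eqP; rewrite subr_eq0 => /eqP.
Qed.

Lemma lower_central_mag k : lower_central k.+1 `<=` mag_ge phi k.+1.
Proof. exact: lower_central_mag_ge mag_ge1. Qed.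

Lemma bc_mag_ge w : Lyn w -> mag_ge phi (size w) (bc w).
Proof.
move=> Lw; have := Lyn_neq0 Lw; rewrite size_word_gt0 => w0.
rewrite -(prednK w0); apply: lower_central_mag; rewrite prednK //.
exact: (bc_lower_central x Lw).
Qed.

Lemma mag_sub1E y w : w != [::] -> (M y - 1) w = M y w.
Proof. by move=> w0; rewrite seriesDE seriesNE series1E (negbTE w0) subr0. Qed.

Lemma mag_ge0 k y w : mag_ge phi k y -> w != [::] -> (size w < k)%N -> M y w = 0.
Proof. by move=> ky w0 wk; rewrite -mag_sub1E // ky. Qed.

(** Triangularity. The lowest part of [bc w] is the ring commutator of the lowest parts of [bc u]
    and [bc v]; one product starts at [u v = w], the other at [v u], which is larger because
    [w < v]. *)
Lemma bc_lead w : Lyn w ->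
  M (bc w) w = 1 /\ forall z, size z = size w -> ltw z w -> M (bc w) z = 0.
Proof.
elim/Lyn_ind => [a ad|{}w u v st Lw Lu Lv uv [Mu uz] [Mv vz]].
  rewrite bc1 mag_x // seriesDE series1E /var eqxx; split=> // -[|b [|c z]] // _.
  rewrite /= andbF orbF => ba; rewrite seriesDE series1E /var add0r.
  by rewrite eqseq_cons andbT ltn_eqF.
have [wE u0 v0 _] := st.
have lw : lyndon w by case/andP: Lw.
have wvu : ltw w (v ++ u).
  by apply: ltw_catr; rewrite wE; apply: lyndon_suffix; rewrite // -wE.
have ue := bc_mag_ge Lu; have ve := bc_mag_ge Lv.
have sw : size w = (size u + size v)%N by rewrite wE size_cat.
have MzE z : size z = size w -> M (bc w) z =
    (M (bc u) - 1) (take (size u) z) * (M (bc v) - 1) (drop (size u) z)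
    - (M (bc v) - 1) (take (size v) z) * (M (bc u) - 1) (drop (size v) z).
  move=> zw; have z0 : z != [::].
    by rewrite size_word_gt0 zw -size_word_gt0; exact: lyndon_neq0.
  rewrite -mag_sub1E // (bc_stdfact x st) magR_sub1.
  have h : order_ge (size u + size v) ((M (bc u) - 1) * (M (bc v) - 1) -
      (M (bc v) - 1) * (M (bc u) - 1)).
    apply: order_geD; first exact: order_geM.
    by apply: order_geN; rewrite addnC; exact: order_geM.
  rewrite (@series_leadM 0%N _ _ _ _ _ h) ?zw ?sw // take0 drop0 mag_nil mul1r.
  rewrite [LHS]seriesDE [in LHS]seriesNE (series_leadM ue ve) ?zw //.
  by rewrite (series_leadM ve ue) // zw sw addnC.
have su : (0 < size u)%N by rewrite -size_word_gt0.
have sv : (0 < size v)%N by rewrite -size_word_gt0.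
(* A word below [p q], cut after [size p] letters, has its first piece below [p] or its second piece
   below [q], so one factor vanishes. *)
have low p q z : Lyn p -> Lyn q -> p != [::] -> size z = (size p + size q)%N ->
    ltw z (p ++ q) -> M (bc p) p = 1 ->
    (forall z, size z = size p -> ltw z p -> M (bc p) z = 0) ->
    (forall z, size z = size q -> ltw z q -> M (bc q) z = 0) ->
    (M (bc p) - 1) (take (size p) z) * (M (bc q) - 1) (drop (size p) z) = 0.
  move=> Lp Lq p0 zs zpq Mp pz qz.
  have sp : size (take (size p) z) = size p by rewrite size_takel // zs leq_addr.
  have sq : size (drop (size p) z) = size q by rewrite size_drop zs addKn.
  move: zpq; rewrite -{1}(cat_take_drop (size p) z) ltw_cat //.
  case/orP => [zp|/andP[_ zq]].
    by rewrite mag_sub1E ?pz ?mul0r // size_word_gt0 sp -size_word_gt0.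
  rewrite [X in _ * X]mag_sub1E ?qz ?mulr0 // size_word_gt0 sq -size_word_gt0.
  exact: (Lyn_neq0 Lq).
split=> [|z zw zlt]; rewrite MzE //; last first.
  rewrite low // ?zw ?sw ?wE // 1?addnC //; last by rewrite -wE.
  rewrite low ?subr0 // ?zw ?sw 1?addnC //.
  exact: ltw_trans zlt wvu.
rewrite [X in _ - X]low ?subr0 //; last by rewrite sw addnC.
by rewrite wE take_size_cat // drop_size_cat // !mag_sub1E // Mu Mv.
Qed.

(** The factor containing [a] lies in an iterated commutator of [V], and bracketing with the other
    factor adds the weight of the latter. If [a] sits on the right, the bracket is inverted
    first. *)
Lemma bc_iter_commutator (V : set F) w a : is_normal V -> Lyn w -> a \in w ->
  V (x a) -> iter_commutator (size w).-1 V (bc w).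
Proof.
move=> nV Lw aw Va; elim/Lyn_ind: Lw aw => [b bd|{}w u v st _ Lu Lv _ Hu Hv].
  by rewrite inE => /eqP <-.
rewrite (bc_stdfact x st); have [-> u0 v0 _] := st; rewrite mem_cat size_cat.
have := bc_lower_central x Lu; have := bc_lower_central x Lv.
rewrite !size_word_gt0 in u0 v0.
move: Hu Hv; rewrite -{2 3}(prednK u0) -{2 3}(prednK v0) /=.
move: (size u).-1 (size v).-1 => i j Hu Hv Gv Gu.
case/orP => [/Hu|/Hv] h.
  exact: iter_commutator_lower_central.
rewrite addnS addnC -addnS -invgR.
apply: (is_subgroupV (iter_commutator_normal _ nV).1).
exact: iter_commutator_lower_central.
Qed.

(** Commutators of words above [w] have coefficient 0 at [w] by [bc_lead], and this coefficient is
    additive in the present range. *)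
Lemma gspan_coef0 k (s : seq (seq nat)) w h :
  (forall u, u \in s -> [/\ Lyn u, size u = k.+1 & ltw w u]) -> size w = k.+1 ->
  gspan bc k.+2 [set` s] h -> mag_ge phi k.+1 h /\ M h w = 0.
Proof.
move=> sP sw; have w0 : w != [::] by case: (w) sw.
have wk : (size w < k.+1 + k.+1)%N by rewrite sw; lia.
have sU := (mag_ge_normal phi k.+1).1.
move: h; apply: gspan_sub.
- split; first by split; [exact: is_subgroup1|rewrite mag1 series1E (negbTE w0)].
  move=> y z [Uy My] [Uz Mz]; split; first exact: sU.2.
  have Uz' := is_subgroupV sU Uz.
  rewrite (mag_coefM Uy Uz') // My add0r.
  have := mag_coefM Uz Uz' w0 wk; rewrite mulgV mag1 series1E (negbTE w0) Mz add0r.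
  by [].
- move=> u /sP[Lu su wu]; split; first by have := bc_mag_ge Lu; rewrite su.
  by apply: (bc_lead Lu).2; rewrite ?su.
move=> y Gy; have Uy : mag_ge phi k.+2 y by exact: lower_central_mag.
split; first by apply: order_ge_leq Uy.
by apply: (mag_ge0 Uy w0); rewrite sw.
Qed.

(** * Recognizing the denominator of the multiplier by Lyndon coefficients *)

Section Kernel.
Variables (n c : nat) (rho : nat -> nat) (R : set F).
Hypothesis c_ge_n : (n <= c)%N.
Hypothesis nR : is_normal R.
Hypothesis R_dvd : R `<=` mag_dvd phi rho n.
Hypothesis R_lower_central : lower_central n.+1 `<=` R.
Hypothesis R_x : forall a, (a < d)%N -> R (x a ^+ rho a)%g.
Hypothesis rho_chain : forall a b, (a <= b < d)%N -> (rho b %| rho a)%N.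

(** In a divisibility chain the gcd of two orders is the order of the larger letter, so a single
    letter attains the gcd of the word. *)
Lemma word_gcd_letter w : w != [::] -> all (fun a => (a < d)%N) w ->
  exists2 a, a \in w & word_gcd rho w = rho a.
Proof.
elim: w => // a w IH _ /= /andP[ad wd].
rewrite /word_gcd big_cons -/(word_gcd rho w).
have [w0|w0] := eqVneq w [::].
  by exists a; rewrite ?mem_head // w0 /word_gcd big_nil gcdn0.
have [b bw ->] := IH w0 wd; have /(allP wd) bd := bw.
have [ab|ba] := leqP a b.
  exists b; first by rewrite inE bw orbT.
  by apply/gcdn_idPr/rho_chain; rewrite ab.
exists a; first exact: mem_head.
by apply/gcdn_idPl/rho_chain; rewrite (ltnW ba).
Qed.

Local Notation D := (iter_commutator c R).

Definition lyndon_dvd (g : F) : Prop :=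
  forall w, Lyn w -> (size w <= c + n)%N -> (word_gcd rho w %| M g w)%Z.

Lemma D_dvd : D `<=` mag_dvd phi rho (c + n).
Proof. by rewrite addnC; exact: iter_commutator_mag_dvd mag_ge1 R_dvd. Qed.

Lemma D_lyndon_dvd g : D g -> lyndon_dvd g.
Proof.
move=> /D_dvd Dg w Lw wn; rewrite -mag_sub1E; first exact: Dg.
exact: Lyn_neq0 Lw.
Qed.

Lemma iter_commutator_lower_central_sub g : lower_central (c + n).+1 g -> D g.
Proof.
rewrite /lower_central /= /iter_commutator iterD; apply: iter_commutatorS.
exact: R_lower_central.
Qed.

(** Let [a] be a letter attaining the gcd. The elements whose [rho a]-th power falls into [R] modulo
    [gamma_2] form a normal subgroup [V] containing [x a]; [iter_commutator_power] transfers this to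
    [bc w]. *)
Lemma bc_power_mod w : Lyn w -> exists2 s, iter_commutator (size w).-1 R s &
  lcq (size w).+1 s = lcq (size w).+1 (bc w ^+ word_gcd rho w)%g.
Proof.
move=> Lw; have w0 := Lyn_neq0 Lw; have [_ wd] := andP Lw.
have [a aw ->] := word_gcd_letter w0 wd; have ad := allP wd a aw.
pose V := [set v | exists2 s, R s & lcq 2 s = lcq 2 (v ^+ rho a)%g].
have cQ (g h : F) : commute (lcq 2 g) (lcq 2 h).
  by apply: (lcq_commute (i := 1) (j := 1)).
have sR := nR.1.
have nV : is_normal V.
  split; first split.
  - by exists 1%g; [exact: is_subgroup1|rewrite expg1n].
  - move=> g h [s Rs sg] [t Rt th]; exists (s / t)%g; first exact: sR.2.
    by rewrite gmulfM homV sg th !homX gmulfM homV expgnFl.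
  - move=> g h [s Rs sg]; exists (s ^ h)%g; first exact: nR.2.
    by rewrite homJ sg -homJ conjXg.
have Va : V (x a) by exists (x a ^+ rho a)%g => //; exact: R_x.
have := bc_iter_commutator nV Lw aw Va.
move/(iter_commutator_power nV nR (fun v h => h)).
by rewrite prednK // -size_word_gt0.
Qed.

(** Weight by weight, expand in basic commutators along increasing words. The coefficient at the
    smallest word gives its exponent, which is divisible by the gcd, so that factor is removed by an
    element of [D]. *)
Lemma lyndon_dvd_D g : lower_central c.+1 g -> lyndon_dvd g -> D g.
Proof.
(* Here [j] counts the weights still to be cleared; at [j = 0] the element lies in [gamma_(c+n+1)],
   which is contained in [D]. *)
suff H j k h : (c + n = k + j)%N -> (c <= k)%N -> lower_central k.+1 h ->
    lyndon_dvd h -> D h by exact: H.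
elim: j k h => [|j IH] k h cnk ck Gh hdvd.
  by apply: iter_commutator_lower_central_sub; rewrite cnk addn0.
have kn : (k < c + n)%N by rewrite cnk addnS ltnS leq_addr.
(* On [gamma_(c+1)] the coefficients at nonempty words are additive below length [2 (c + 1)], a
   range reaching [c + n] because [n <= c]. *)
have knk : (c + n < c.+1 + c.+1)%N by rewrite addSn ltnS addnS ltnW // ltnS leq_add2l.
pose s := sort lew (lyndon_words d k.+1).
have sP u : u \in s -> Lyn u /\ size u = k.+1.
  by rewrite mem_sort mem_lyndon_words => /andP[Lu /eqP].
have us : uniq s by rewrite sort_uniq filter_uniq // uniq_words.
have ss : sorted lew s by exact: sort_sorted lew_total _.
have : gspan bc k.+2 [set` s] h.
  apply: gspan_mono (lower_central_span x_gen Gh) => w /= [Lw sw].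
  by rewrite mem_sort mem_lyndon_words Lw sw eqxx.
have nD := iter_commutator_normal c nR.
have : lower_central c.+1 h by exact: lower_central_sub Gh.
clearbody s; clear Gh; elim: s us ss sP h hdvd => [|w s IHs] us ss sP h hdvd Gh Sh.
  apply: (IH k.+1) => //; first by rewrite cnk addSnnS.
    exact: leqW.
  apply: gspan_sub Sh; [exact: (lower_central_normal _ _).1|by []|by []].
have [us' ss' ws] := lew_sorted_cons us ss.
have [Lw sw] := sP w (mem_head _ _).
have w0 := Lyn_neq0 Lw.
have bG u : u \in w :: s -> lower_central k.+1 (bc u).
  by move=> /sP[Lu <-]; exact: (bc_lower_central x Lu).
have [e She] := gspan_cons (ltn0Sn k) bG Sh.
have sP' u : u \in s -> Lyn u /\ size u = k.+1.
  by move=> us''; apply: sP; rewrite inE us'' orbT.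
have Uh : mag_ge phi k.+1 h.
  have SG : gspan bc k.+2 [set` w :: s] `<=` lower_central k.+1.
    apply: gspan_sub; first exact: (lower_central_normal _ _).1.
      by move=> u us''; exact: bG.
    exact: lower_central_sub.
  exact: lower_central_mag (SG _ Sh).
have Uw : mag_ge phi k.+1 (bc w) by rewrite -sw; exact: bc_mag_ge.
have wk : (size w < k.+1 + k.+1)%N by rewrite sw addSn ltnS addnS ltnS leq_addr.
have eE : M h w + e = 0.
  have [_] := @gspan_coef0 k s w (h * int_expg (bc w) e)%g
    (fun u us'' => And3 (sP' u us'').1 (sP' u us'').2 (ws u us'')) sw She.
  rewrite (@mag_coefM _ _ k.+1) ?(@mag_coefX _ _ k.+1) //.
    by rewrite (bc_lead Lw).1 mulr1.
  exact: (is_subgroup_intX _ (mag_ge_normal _ _).1 Uw).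
have [e' e'E] : exists e', e = (word_gcd rho w)%:Z * e'.
  have : (word_gcd rho w %| e)%Z.
    rewrite -(addKr (M h w) e) eE addr0 rpredN.
    by apply: hdvd => //; rewrite sw.
  by case/dvdzP => q ->; exists q; rewrite mulrC.
(* Modulo [gamma_(k+2)] the power of [bc w] equals a power of [t], which lies in [D]; multiplying by
   the latter preserves both the divisibility and membership in [D]. *)
have [t Rt tE] := bc_power_mod Lw; rewrite sw /= in Rt tE.
have Dt : D (int_expg t e').
  apply: (is_subgroup_intX _ nD.1).
  exact: iter_commutator_antitone Rt.
have Gt : lower_central c.+1 (int_expg t e').
  exact: (iter_commutatorS (@subsetT _ R) Dt).
suff Dht : D (h * int_expg t e')%g.
  by rewrite -(mulgK (int_expg t e') h); exact: nD.1.2.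
apply: IHs => //.
- move=> u Lu un; rewrite (@mag_coefM _ _ c.+1 h) //.
  + by rewrite rpredD ?hdvd // D_lyndon_dvd.
  + exact: lower_central_mag.
  + exact: lower_central_mag.
  + exact: Lyn_neq0 Lu.
  + exact: leq_ltn_trans un knk.
- by apply: is_subgroupM; first exact: (lower_central_normal _ _).1.
apply: gspan_lcq She; rewrite !gmulfM !hom_int_expg; congr (_ * _)%g.
by rewrite e'E int_expg_mul -homX; congr (int_expg _ _); exact/esym.
Qed.

(** A triangular system, solved by increasing length and then along increasing words: a power of
    [bc w] adjusts the coefficient at [w] and leaves alone shorter words and smaller words of the
    same length. *)
Lemma lyndon_coef_surj (y : seq nat -> int) :
  exists2 g, lower_central c.+1 g &
    forall w, Lyn w -> (c < size w <= c + n)%N -> M g w = y w.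
Proof.
have sG : is_subgroup (lower_central c.+1 : set F) := (lower_central_normal F _).1.
suff H j : (j <= n)%N -> exists2 g, lower_central c.+1 g &
    forall w, Lyn w -> (c < size w <= c + j)%N -> M g w = y w by exact: H.
elim: j => [_|j IH jn].
  exists 1%g; first exact: is_subgroup1.
  by move=> w _ /andP[h1 h2]; have := leq_trans h1 h2; rewrite addn0 ltnn.
have [g0 Gg0 g0E] := IH (ltnW jn).
pose k := (c + j)%N.
pose s := sort lew (lyndon_words d k.+1).
have sP u : u \in s -> Lyn u /\ size u = k.+1.
  by rewrite mem_sort mem_lyndon_words => /andP[Lu /eqP].
have us : uniq s by rewrite sort_uniq filter_uniq // uniq_words.
have ss : sorted lew s by exact: sort_sorted lew_total _.
have ck : (c < k.+1)%N by rewrite ltnS leq_addr.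
have kn : (k.+1 < c.+1 + c.+1)%N.
  by rewrite addSn !ltnS addnS ltnS leq_add2l (leq_trans _ c_ge_n) // ltnW.
(* The last clause, on words below all those of [s], protects the coefficients already adjusted
   during the induction on [s]. *)
have [g [Gg gs glow _]] : exists g, [/\ lower_central c.+1 g,
    forall w, w \in s -> M g w = y w,
    forall u, Lyn u -> (size u <= k)%N -> M g u = M g0 u &
    forall u, size u = k.+1 -> (forall w, w \in s -> ltw u w) -> M g u = M g0 u].
  clearbody s; clear g0E; elim: s us ss sP g0 Gg0 => [|w s IHs] us ss sP g0 Gg0.
    by exists g0.
  have [us' ss' ws] := lew_sorted_cons us ss.
  have [Lw sw] := sP w (mem_head _ _).
  have w0 := Lyn_neq0 Lw.
  pose e := y w - M g0 w.
  have Uw : mag_ge phi k.+1 (bc w) by rewrite -sw; exact: bc_mag_ge.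
  have Uw' : mag_ge phi c.+1 (bc w) by exact: order_ge_leq Uw.
  have Ge : lower_central c.+1 (int_expg (bc w) e).
    apply: (is_subgroup_intX _ sG).
    by apply: lower_central_sub (bc_lower_central x Lw); rewrite sw.
  have E u : u != [::] -> (size u <= k.+1)%N ->
      M (g0 * int_expg (bc w) e)%g u = M g0 u + e * M (bc w) u.
    move=> u0 uk; have uk' := leq_ltn_trans uk kn.
    rewrite (@mag_coefM _ _ c.+1) ?(@mag_coefX _ _ c.+1) //; exact: lower_central_mag.
  have sP' u : u \in s -> Lyn u /\ size u = k.+1.
    by move=> us''; apply: sP; rewrite inE us'' orbT.
  have [g [Gg gs glow gmin]] := IHs us' ss' sP' (g0 * int_expg (bc w) e)%g
    (is_subgroupM sG Gg0 Ge).
  exists g; split=> // [u|u Lu uk|u uk ult].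
  - rewrite inE => /orP[/eqP ->|]; last exact: gs.
    rewrite gmin // E ?sw // (bc_lead Lw).1 mulr1 /e addrC subrK.
    by [].
  - rewrite glow // E //; last exact: leqW.
      by rewrite (mag_ge0 Uw) ?mulr0 ?addr0 //; exact: Lyn_neq0 Lu.
    exact: Lyn_neq0 Lu.
  - have u0 : u != [::] by rewrite size_word_gt0 uk.
    rewrite gmin // => [|v vs]; last by apply: ult; rewrite inE vs orbT.
    rewrite E ?uk // (bc_lead Lw).2 ?mulr0 ?addr0 ?sw //.
    by apply: ult; exact: mem_head.
exists g => // w Lw /andP[cw]; rewrite addnS leq_eqVlt => /orP[/eqP wk|wk].
  by apply: gs; rewrite mem_sort mem_lyndon_words Lw wk eqxx.
by rewrite glow // g0E // cw.
Qed.

End Kernel.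

End MagnusLyndon.

(** * Counting Lyndon words *)

Section WordPowers.
Implicit Types (u v w p s : seq nat) (d k e i j : nat).

Definition wpow j w := flatten (nseq j w).

Lemma wpowS j w : wpow j.+1 w = w ++ wpow j w. Proof. by []. Qed.

Lemma size_wpow j w : size (wpow j w) = j * size w.
Proof. by elim: j => // j IH; rewrite wpowS size_cat IH mulSn. Qed.

Lemma take_wpow j w : 0 < j -> take (size w) (wpow j w) = w.
Proof. by case: j => // j _; rewrite wpowS take_size_cat. Qed.

Lemma wpow_conj j p s : p ++ wpow j (s ++ p) = wpow j (p ++ s) ++ p.
Proof.
elim: j => [|j IH]; first by rewrite cats0.
by rewrite !wpowS -!catA IH.
Qed.

Lemma rot_wpow_cat j p s : rot (size p) (wpow j (p ++ s)) = wpow j (s ++ p).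
Proof.
case: j => [|j]; first by rewrite /wpow /= rot_oversize.
by rewrite wpowS -catA rot_size_cat -catA wpowS -catA wpow_conj.
Qed.

Lemma ltw_wpow j w w' : size w = size w' -> 0 < j -> ltw (wpow j w) (wpow j w') = ltw w w'.
Proof.
case: j => // j sw _; rewrite !wpowS ltw_cat //; case: eqP => [->|_]; last by rewrite orbF.
by rewrite !ltwnn.
Qed.

Lemma lyndon_ltw_rot p s : lyndon (p ++ s) -> p != [::] -> s != [::] ->
  ltw (p ++ s) (s ++ p).
Proof. by move=> L p0 s0; apply: ltw_catr; exact: lyndon_suffix. Qed.

(** Suppose a suffix [s] of [w = p s] is below [w]. Minimality of [w] forces [w = s q]; then
    [w < s p] gives [q < p], while [w < q s] gives [p <= q]. *)
Lemma lyndon_of_min_rot w : w != [::] ->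
  (forall p s, w = p ++ s -> p != [::] -> s != [::] -> ltw w (s ++ p)) -> lyndon w.
Proof.
move=> w0 h; apply/lyndonP; split=> // p s wps p0 s0.
have := ltw_total w s => /or3P[/eqP ws|//|sw].
  move: p0; have := congr1 size wps; rewrite {1}ws size_cat size_word_gt0.
  by case: (size p) => //; lia.
have wsp := h p s wps p0 s0.
have [/prefixP[q wq]|np] := boolP (prefix s w); last first.
  by have := ltw_cat_nprefix p [::] sw np; rewrite cats0 => /(ltw_trans wsp); rewrite ltwnn.
have qp : ltw q p by rewrite wq ltw_cat2l in wsp.
have sqp : size q = size p by have := congr1 size wps; rewrite wq !size_cat addnC => /addIn.
have q0 : q != [::] by rewrite size_word_gt0 sqp -size_word_gt0.
have := h s q wq s0 q0; rewrite wps ltw_cat //.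
move=> /orP[/(ltw_trans qp)|/andP[/eqP pq _]]; first by rewrite ltwnn.
by rewrite pq ltwnn in qp.
Qed.

(** Writing [v = p q] with [size p = e], invariance means [p q = q p]; so [q] is empty or starts
    with [p], and it is again invariant. *)
Lemma rot_fix_wpow e v j : size v = j * e -> rot e v = v -> v = wpow j (take e v).
Proof.
elim: j v => [|j IH] v sv ev; first by apply: size0nil; rewrite sv.
have le : e <= size v by rewrite sv mulSn leq_addr.
have sp : size (take e v) = e by rewrite size_takel.
have e1 : drop e v ++ take e v = take e v ++ drop e v by rewrite cat_take_drop.
have sq : size (drop e v) = j * e by rewrite size_drop sv mulSn addKn.
rewrite wpowS -{1}(cat_take_drop e v); congr (_ ++ _).
move: (take e v) (drop e v) sp e1 sq => p q sp e1 sq.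
clear v sv ev le.
case: j IH sq => [|j] IH sq; first by apply: size0nil; rewrite sq.
have [q' qE] : exists q', q = p ++ q'.
  exists (drop e q); rewrite -{1}(cat_take_drop e q); congr (_ ++ _).
  have := congr1 (take e) e1; rewrite takel_cat; last by rewrite sq mulSn leq_addr.
  by rewrite -{2}sp take_size_cat // => ->.
have e2 : q' ++ p = q.
  move: e1; rewrite {1}qE -catA => /eqP.
  by rewrite eqseq_cat // eqxx => /eqP.
have tq : take e q = p by rewrite qE -sp take_size_cat.
rewrite -{1}tq; apply: IH => //.
by rewrite {1}qE -{1}sp rot_size_cat.
Qed.

Lemma rot_fix_mul e v q : rot e v = v -> q * e <= size v -> rot (q * e) v = v.
Proof.
move=> ev; elim: q => [|q IH] h; first by rewrite mul0n rot0.
by rewrite mulSn rotD // IH // (leq_trans _ h) // mulSn leq_addl.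
Qed.

Lemma rot_fix_mod e v i : rot e v = v -> i <= size v -> rot i v = rot (i %% e) v.
Proof.
move=> ev iv; rewrite {1}(divn_eq i e) addnC rotD; last by rewrite addnC -divn_eq.
by rewrite rot_fix_mul // (leq_trans _ iv) // leq_trunc_div.
Qed.

Lemma exists_lew_min (t : seq (seq nat)) : t != [::] ->
  exists2 m, m \in t & forall u, u \in t -> lew m u.
Proof.
elim: t => // a t IH _; have [->|t0] := eqVneq t [::].
  by exists a; rewrite ?mem_head // => u; rewrite inE => /eqP ->; rewrite /lew eqxx.
have [m mt mle] := IH t0.
have /orP[am|ma] := lew_total a m.
  exists a; first exact: mem_head.
  move=> u; rewrite inE => /orP[/eqP ->|/mle]; first by rewrite /lew eqxx.
  exact: lew_trans.
exists m; first by rewrite inE mt orbT.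
by move=> u; rewrite inE => /orP[/eqP ->|/mle].
Qed.

(** The smallest rotation [v] of [u] is a power of its prefix of length [e], the least positive
    rotation fixing [v]. Minimality of [v] and of [e] puts this prefix strictly below its proper
    rotations, so it is Lyndon. *)
Lemma lyndon_root u : u != [::] -> exists w i,
  [/\ lyndon w, size w %| size u, i < size w & u = rot i (wpow (size u %/ size w) w)].
Proof.
move=> u0; pose t := [seq rot i u | i <- iota 0 (size u).+1].
have [//|v /mapP[i]] := @exists_lew_min t.
rewrite mem_iota add0n ltnS => /andP[_ iu] vE vmin.
have sv : size v = size u by rewrite vE size_rot.
have vle j : j <= size v -> lew v (rot j v).
  rewrite sv => jv; apply: vmin; rewrite vE rot_add_mod //.
  apply: (map_f (fun i => rot i u)); rewrite mem_iota add0n ltnS.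
  by case: ifP => // _; rewrite leq_subLR leq_add.
have v0 : 0 < size v by rewrite sv -size_word_gt0.
pose P e := (0 < e) && (rot e v == v).
have exP : exists e, P e by exists (size v); rewrite /P v0 rot_size eqxx.
have [e /andP[e0 /eqP ev] emin] := ex_minnP exP.
have le : e <= size v by apply: emin; rewrite /P v0 rot_size eqxx.
have dv : e %| size v.
  rewrite /dvdn; have := ltn_pmod (size v) e0; case: posnP => // r0 re.
  have := emin (size v %% e); rewrite /P r0 -rot_fix_mod // rot_size eqxx => /(_ isT).
  by rewrite leqNgt re.
have vrep := rot_fix_wpow (esym (divnK dv)) ev.
have j0 : 0 < size v %/ e by rewrite divn_gt0.
set w := take e v in vrep; have sw : size w = e by rewrite size_takel.
have Lw : lyndon w.
  apply: lyndon_of_min_rot; first by rewrite size_word_gt0 sw.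
  move=> p s wps p0 s0; rewrite -(ltw_wpow _ j0); last by rewrite wps !size_cat addnC.
  have pe : 0 < size p < e.
    by rewrite -size_word_gt0 p0 -sw wps size_cat -ltn_psubLR ?subnn -?size_word_gt0.
  have rE : rot (size p) v = wpow (size v %/ e) (s ++ p).
    by rewrite {1}vrep wps rot_wpow_cat.
  rewrite -vrep -rE; have := vle (size p); rewrite /lew.
  rewrite (leq_trans _ le); last by case/andP: pe => _ /ltnW.
  move=> /(_ isT) /orP[/eqP rv|//].
  have := emin (size p); rewrite /P -rv eqxx andbT; case/andP: pe => -> pe /(_ isT).
  by rewrite leqNgt pe.
(* Rotating [v] by [size u - i] undoes the rotation by [i], and rotations of [v] depend only on
   their amount modulo [e]. *)
exists w, ((size u - i) %% e); split=> //.
- by rewrite sw -sv.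
- by rewrite sw ltn_mod.
rewrite sw -sv -vrep -rot_fix_mod // ?sv ?leq_subr //.
by rewrite vE -[RHS]/(_ _ _); have := rotK i u; rewrite /rotr size_rot => ->.
Qed.

Lemma lyndon_root_min w i j : lyndon w -> 0 < j -> 0 < i < size w ->
  ltw (wpow j w) (rot i (wpow j w)).
Proof.
move=> Lw j0 /andP[i0 iw].
have -> : rot i (wpow j w) = wpow j (drop i w ++ take i w).
  by rewrite -rot_wpow_cat cat_take_drop size_takel // ltnW.
rewrite ltw_wpow // ?size_cat ?size_drop ?size_take ?iw ?subnK //; last exact: ltnW.
rewrite -{1}(cat_take_drop i w); apply: lyndon_ltw_rot; rewrite ?cat_take_drop //.
  by rewrite size_word_gt0 size_take iw.
by rewrite size_word_gt0 size_drop subn_gt0.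
Qed.

Lemma all_rot (a : pred nat) i w : all a (rot i w) = all a w.
Proof. by rewrite -{2}(cat_take_drop i w) !all_cat andbC. Qed.

Lemma rot_eq_rot u v i i' : i' <= size v -> rot i u = rot i' v ->
  exists2 l, l <= size v & u = rot l v.
Proof.
move=> iv E; have suv : size u = size v by have := congr1 size E; rewrite !size_rot.
have := rotK i u; rewrite E /rotr size_rot rot_add_mod ?leq_subr // => <-.
eexists; last by reflexivity.
have h : size v - i <= size v by exact: leq_subr.
by case: ifP => // _; rewrite leq_subLR leq_add.
Qed.

(** Both powers are least in the same rotation class, hence equal. Different lengths of [w] and
    [w'], or different shifts, would give a rotation by less than one period fixing the power,
    against [lyndon_root_min]. *)
Lemma lyndon_root_inj w w' i i' j j' : lyndon w -> lyndon w' -> 0 < j -> 0 < j' ->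
  i < size w -> i' < size w' -> rot i (wpow j w) = rot i' (wpow j' w') ->
  w = w' /\ i = i'.
Proof.
move=> Lw Lw' j0 j0' iw iw' E.
pose v := wpow j w; pose v' := wpow j' w'.
have sv : size v = size v' by have := congr1 size E; rewrite !size_rot.
have fix_size z k : rot (size z) (wpow k z) = wpow k z.
  by rewrite -{2}[z]cats0 rot_wpow_cat.
have wv : size w <= size v by rewrite size_wpow leq_pmull.
have wv' : size w' <= size v' by rewrite size_wpow leq_pmull.
have w0 : 0 < size w by rewrite -size_word_gt0 lyndon_neq0.
have w0' : 0 < size w' by rewrite -size_word_gt0 lyndon_neq0.
have le z k l : lyndon z -> 0 < k -> 0 < size z -> l <= size (wpow k z) ->
    lew (wpow k z) (rot l (wpow k z)).
  move=> Lz k0 z0 lz; rewrite (rot_fix_mod (fix_size z k) lz).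
  have [->|r0] := posnP (l %% size z); first by rewrite rot0 /lew eqxx.
  by rewrite /lew lyndon_root_min ?orbT // r0 ltn_mod.
have vE := rot_eq_rot (leq_trans (ltnW iw') wv') E.
have vE' := rot_eq_rot (leq_trans (ltnW iw) wv) (esym E).
have vv' : v = v'.
  have [l lv vl] := vE; have [l' lv' vl'] := vE'.
  have := le w' j' l Lw' j0' w0' lv; rewrite -/v' -vl.
  have := le w j l' Lw j0 w0 lv'; rewrite -/v -vl'.
  rewrite /lew => /orP[/eqP->//|vv'] /orP[/eqP->//|v'v].
  by have := ltw_trans vv' v'v; rewrite ltwnn.
have not_fix z z' k k' : lyndon z -> 0 < k -> 0 < size z' -> wpow k z = wpow k' z' ->
    size z' < size z -> False.
  move=> Lz k0 z0' zz' h; have := @lyndon_root_min z (size z') k Lz k0.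
  by rewrite z0' h => /(_ isT); rewrite zz' fix_size ltwnn.
have sww' : size w = size w'.
  have [h|h|//] := ltngtP (size w) (size w').
    by case: (not_fix w' w j' j Lw' j0' w0 (esym vv') h).
  by case: (not_fix w w' j j' Lw j0 w0' vv' h).
have ww' : w = w' by rewrite -(take_wpow w j0) -/v vv' sww' take_wpow.
split=> //; move: E iw'; rewrite -/v -/v' -vv' -sww' => E iw'.
wlog lt : i i' iw iw' E / i < i' => [W|].
  by have [h|h|//] := ltngtP i i'; [|symmetry]; apply: W.
have := congr1 (rotr i) E; rewrite rotK => vr.
have i'v : i' <= size v by rewrite (leq_trans _ wv) // ltnW.
have := @lyndon_root_min w (i' - i) j Lw j0.
rewrite subn_gt0 lt (leq_ltn_trans (leq_subr _ _) iw') => /(_ isT).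
suff -> : rot (i' - i) (wpow j w) = wpow j w by rewrite ltwnn.
by rewrite [RHS]vr -{2}(subnKC (ltnW lt)) rotD ?subnKC // ?(ltnW lt) // rotK.
Qed.

Lemma uniq_flatten (T T' : eqType) (f : T -> seq T') (g : T' -> T) (s : seq T) :
  uniq s -> (forall x, uniq (f x)) -> (forall x y, y \in f x -> g y = x) ->
  uniq (flatten [seq f x | x <- s]).
Proof.
move=> us uf gf; elim: s us => //= e s IH /andP[es us]; rewrite cat_uniq uf IH // andbT.
apply/hasPn => w /flattenP[_ /mapP[e' e's ->] we'].
by apply: contra es => we; rewrite -(gf _ _ we) (gf _ _ we').
Qed.

Definition lyndon_count d k := size (lyndon_words d k).

(** Each word of length [k] is, in a unique way, a rotation by [i < size w] of a power of a Lyndon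
    word [w] whose length divides [k]. *)
Lemma sum_lyndon_count d k : 0 < k ->
  \sum_(e <- divisors k) e * lyndon_count d e = d ^ k.
Proof.
move=> k0; pose Ls := flatten [seq lyndon_words d e | e <- divisors k].
have LsP w : (w \in Ls) =
    [&& lyndon w, all (fun a => a < d) w & size w %| k].
  apply/flattenP/and3P => [[_ /mapP[e ek ->]]|[Lw wd wk]].
    rewrite mem_filter mem_words => /and3P[-> /eqP-> ->]; split=> //.
    by rewrite dvdn_divisors.
  exists (lyndon_words d (size w)); last by rewrite mem_filter Lw mem_words eqxx.
  by apply: map_f; rewrite -dvdn_divisors.
have uLs : uniq Ls.
  apply: (uniq_flatten (g := size)); first exact: divisors_uniq.
    by move=> e; rewrite filter_uniq // uniq_words.
  by move=> e w; rewrite mem_filter mem_words => /and3P[_ /eqP].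
pose T := [seq (w, i) | w <- Ls, i <- iota 0 (size w)].
have TP w i : ((w, i) \in T) = (w \in Ls) && (i < size w).
  apply/allpairsPdep/andP => [[w' [i' [h1 h2 [-> ->]]]]|[h1 h2]].
    by rewrite mem_iota in h2.
  by exists w, i; rewrite mem_iota.
pose f (x : seq nat * nat) := rot x.2 (wpow (k %/ size x.1) x.1).
have sT : size T = \sum_(e <- divisors k) e * lyndon_count d e.
  rewrite size_allpairs_dep sumnE big_map big_flatten big_map.
  apply: eq_bigr => e _; rewrite (eq_big_seq (fun=> e)).
    by rewrite big_const_seq count_predT iter_addn addn0.
  by move=> w; rewrite size_iota mem_filter mem_words => /and3P[_ /eqP].
have uT : uniq T.
  apply: allpairs_uniq_dep => //; first by move=> w _; exact: iota_uniq.
  by move=> [w i] [w' i'] _ _ /= [-> ->].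
rewrite -sT -(size_words d k) -(size_map f); apply/perm_size/uniq_perm.
- rewrite map_inj_in_uniq // => -[w i] [w' i'].
  rewrite !TP !LsP /f /= => /andP[/and3P[Lw _ wk] iw] /andP[/and3P[Lw' _ wk'] iw'] E.
  have j0 : 0 < k %/ size w by rewrite divn_gt0 ?(dvdn_leq k0) // (leq_ltn_trans _ iw).
  have j0' : 0 < k %/ size w' by rewrite divn_gt0 ?(dvdn_leq k0) // (leq_ltn_trans _ iw').
  by have [-> ->] := lyndon_root_inj Lw Lw' j0 j0' iw iw' E.
- exact: uniq_words.
move=> u; rewrite mem_words; apply/mapP/andP => [[[w i]]|[/eqP su ud]].
  rewrite TP LsP => /andP[/and3P[Lw wd wk] _] ->; rewrite /f /= size_rot size_wpow divnK //.
  split=> //; rewrite all_rot; elim: (_ %/ _) => // j IH.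
  by rewrite wpowS all_cat wd.
have u0 : u != [::] by rewrite size_word_gt0 su.
have [w [i [Lw wu iw uE]]] := lyndon_root u0.
exists (w, i); rewrite ?TP ?LsP /f /= -?su // Lw wu iw !andbT /=.
have : all (fun a => a < d) (rot i (wpow (size u %/ size w) w)) by rewrite -uE.
rewrite all_rot; case E: (size u %/ size w) => [|j]; last first.
  by rewrite wpowS all_cat => /andP[].
by move: (divnK wu); rewrite E mul0n su => h; rewrite -h in k0.
Qed.

End WordPowers.

(** * Moebius inversion and the number of Lyndon words *)

Section Moebius.
Local Open Scope ring_scope.
Implicit Types (n k e p : nat).

Lemma sum_divisors (V : nmodType) n (E : nat -> V) : (0 < n)%N ->
  \sum_(e <- divisors n) E e = \sum_(e < n.+1 | (e %| n)%N) E e.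
Proof.
move=> n0; rewrite -(big_mkord (fun e => e %| n)%N) -big_filter.
apply/perm_big/uniq_perm; rewrite ?divisors_uniq ?filter_uniq ?iota_uniq //.
move=> e; rewrite -dvdn_divisors // mem_filter mem_index_iota /= ltnS.
by case dn: (e %| n)%N => //=; rewrite (dvdn_leq n0 dn).
Qed.

Lemma moebius_mul_dvd p e : prime p -> (0 < e)%N -> (p %| e)%N -> moebius (p * e) = 0.
Proof.
move=> pp e0 pe; rewrite /moebius ifN //; apply/negP => /allP/(_ p).
have p0 := prime_gt0 pp.
rewrite mem_primes pp muln_gt0 p0 e0 dvdn_mulr // => /(_ isT).
rewrite lognM // logn_prime // eqxx add1n eqSS eqn0Ngt.
by rewrite logn_gt0 mem_primes pp e0 pe.
Qed.

Lemma moebius_mul_coprime p e : prime p -> (0 < e)%N -> ~~ (p %| e)%N ->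
  moebius (p * e) = - moebius e.
Proof.
move=> pp e0 pe; have p0 := prime_gt0 pp.
have pr : perm_eq (primes (p * e)) (p :: primes e).
  apply: uniq_perm; rewrite ?primes_uniq //=.
    by rewrite primes_uniq mem_primes pp e0 (negbTE pe).
  by move=> q; rewrite primesM // primes_prime // !inE.
have le : logn p e = 0%N by apply/eqP; rewrite eqn0Ngt logn_gt0 mem_primes pp e0.
rewrite /moebius (perm_all _ pr) (perm_size pr) /= lognM // le addn0.
rewrite logn_prime // eqxx /= exprS mulN1r.
have -> : all (fun q => logn q (p * e) == 1%N) (primes e) =
          all (fun q => logn q e == 1%N) (primes e).
  apply: eq_in_all => q; rewrite mem_primes => /and3P[pq _ qe].
  by rewrite lognM // logn_prime // (_ : q == p = false) //; apply: contraNF pe => /eqP <-.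
by case: ifP => _; rewrite ?oppr0.
Qed.

(** For [n = p m] with [p] prime, the divisors [p e] contribute minus the Moebius value of [e] when
    [p] does not divide [e], and 0 otherwise; this cancels the divisors prime to [p]. *)
Lemma sum_moebius n : (0 < n)%N ->
  \sum_(e < n.+1 | (e %| n)%N) moebius e = (n == 1%N)%:R.
Proof.
move=> n0; have [->|n1] := eqVneq n 1%N.
  by rewrite big_mkcond !big_ord_recl big_ord0 /moebius /= add0r addr0.
have pp : prime (pdiv n) by rewrite pdiv_prime // ltn_neqAle eq_sym n1.
have := pdiv_dvd n; set p := pdiv n in pp * => pn.
have p0 := prime_gt0 pp.
have [m nE] : exists m, n = (p * m)%N by exists (n %/ p)%N; rewrite mulnC divnK.
have m0 : (0 < m)%N by rewrite nE muln_gt0 p0 in n0.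
rewrite (bigID (fun e : 'I_n.+1 => (p %| e)%N)) /=.
have mn : (m < n.+1)%N by rewrite ltnS nE leq_pmull.
have -> : \sum_(e < n.+1 | (e %| n)%N && (p %| e)%N) moebius e =
    \sum_(e < m.+1 | (e %| m)%N) moebius (p * e).
  rewrite -(big_mkord (fun e => (e %| n) && (p %| e))%N (fun e => moebius e)).
  rewrite -(big_mkord (fun e => e %| m)%N (fun e => moebius (p * e))).
  rewrite -big_filter -[in RHS]big_filter -[RHS](big_map (muln p) xpredT moebius).
  apply/perm_big/uniq_perm; rewrite ?filter_uniq ?iota_uniq //.
    rewrite map_inj_uniq ?filter_uniq ?iota_uniq // => a b /eqP.
    by rewrite eqn_pmul2l // => /eqP.
  move=> e; rewrite mem_filter mem_index_iota leq0n andTb.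
  apply/andP/mapP => [[/andP[en /dvdnP[q qE]] _]|[q]].
    move: en; rewrite qE mulnC nE dvdn_pmul2l // => qm; exists q => //.
    by rewrite mem_filter qm mem_index_iota /= ltnS dvdn_leq.
  rewrite mem_filter mem_index_iota /= => /andP[qm _] ->.
  by rewrite nE dvdn_pmul2l // qm dvdn_mulr // ltnS leq_pmul2l // dvdn_leq.
have -> : \sum_(e < n.+1 | (e %| n)%N && ~~ (p %| e)%N) moebius e =
    \sum_(e < m.+1 | (e %| m)%N && ~~ (p %| e)%N) moebius e.
  rewrite -(big_mkord (fun e => (e %| n) && ~~ (p %| e))%N (fun e => moebius e)).
  rewrite -(big_mkord (fun e => (e %| m) && ~~ (p %| e))%N (fun e => moebius e)).
  rewrite -big_filter -[in RHS]big_filter.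
  apply/perm_big/uniq_perm; rewrite ?filter_uniq ?iota_uniq //.
  move=> e; rewrite !mem_filter !mem_index_iota !leq0n !andTb !ltnS.
  case pe: (p %| e)%N; rewrite ?andbF //= !andbT.
  have -> : (e %| n)%N = (e %| m)%N.
    by rewrite nE Gauss_dvdr // coprime_sym prime_coprime // pe.
  case em: (e %| m)%N => //=; have le := dvdn_leq m0 em.
  by rewrite le (leq_trans le) // nE leq_pmull.
rewrite (bigID (fun e : 'I_m.+1 => (p %| e)%N)) /= big1 ?add0r; last first.
  move=> e /andP[em pe]; apply: moebius_mul_dvd => //.
  by case: (val e) em => //; rewrite dvd0n => /eqP m0'; rewrite m0' in m0.
rewrite -big_split /= big1 // => e /andP[em pe].
rewrite moebius_mul_coprime ?addNr //.
by case: (val e) em => //; rewrite dvd0n => /eqP m0'; rewrite m0' in m0.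
Qed.

Lemma div_dvdn e n : (e %| n)%N -> (n %/ e %| n)%N.
Proof. by move=> en; rewrite -{2}(divnK en) dvdn_mulr. Qed.

(** After exchanging sums, [f a] is multiplied by the sum of the Moebius function over the divisors
    of [n / a], nonzero only for [a = n]. *)
Lemma moebius_inversion (f g : nat -> int) :
  (forall n, (0 < n)%N -> \sum_(e <- divisors n) f e = g n) ->
  forall n, (0 < n)%N -> \sum_(e <- divisors n) moebius e * g (n %/ e)%N = f n.
Proof.
move=> fg n n0; rewrite sum_divisors //.
have div0 e : (e %| n)%N -> (0 < n %/ e)%N.
  by move=> en; rewrite divn_gt0 ?(dvdn_gt0 n0) //; exact: dvdn_leq.
have E (e : 'I_n.+1) : (e %| n)%N -> moebius e * g (n %/ e)%N =
    \sum_(a < n.+1 | (a %| n %/ e)%N) moebius e * f a.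
  move=> en; rewrite -fg ?div0 // sum_divisors ?div0 // big_distrr /=.
  rewrite (big_ord_widen_cond n.+1 (fun a => a %| n %/ e)%N (fun a => moebius e * f a)).
    apply: eq_bigl => a; case ae: (a %| _)%N => //=.
    by rewrite ltnS; apply: dvdn_leq ae; exact: div0.
  by rewrite ltnS leq_div.
rewrite (eq_bigr _ E) (exchange_big_dep (fun a : 'I_n.+1 => (a %| n)%N)) /=; last first.
  by move=> e a en ae; apply: dvdn_trans ae (div_dvdn en).
rewrite (eq_bigr (fun a : 'I_n.+1 => (a == ord_max)%:R * f a)).
  rewrite (bigD1 ord_max) ?dvdnn //= eqxx mul1r big1 ?addr0 // => a /andP[_ /negbTE ->].
  by rewrite mul0r.
move=> a an; rewrite -big_distrl /=; congr (_ * _).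
have a0 : (0 < a)%N := dvdn_gt0 n0 an.
have -> : (a == ord_max) = (n %/ a == 1)%N.
  by rewrite -val_eqE /= [RHS]eq_sym eqn_div // mul1n.
rewrite -sum_moebius ?div0 //.
rewrite [RHS](big_ord_widen_cond n.+1 (fun e => e %| n %/ a)%N moebius); last first.
  by rewrite ltnS leq_div.
apply: eq_bigl => e; apply/andP/andP => [[en ae]|[ea _]].
  have ea : (e %| n %/ a)%N by rewrite dvdn_divRL // mulnC -dvdn_divRL.
  by split=> //; rewrite ltnS; apply: dvdn_leq ea; exact: div0.
have en : (e %| n)%N by apply: dvdn_trans ea (div_dvdn an).
by split=> //; rewrite dvdn_divRL // mulnC -dvdn_divRL.
Qed.

Lemma chi_lyndon_count k d : (0 < k)%N -> chi k d = (lyndon_count d k)%:R.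
Proof.
move=> k0; rewrite /chi.
have fg n : (0 < n)%N ->
    \sum_(e <- divisors n) (e * lyndon_count d e)%N%:Z = (d ^ n)%N%:Z.
  by move=> n0; rewrite -sum_lyndon_count // (big_morph Posz PoszD (erefl _)).
have -> : \sum_(e <- divisors k) (moebius e)%:~R * (d ^ (k %/ e))%:R =
    (k * lyndon_count d k)%:R :> rat.
  rewrite -[RHS]/((Posz (k * lyndon_count d k))%:~R) -(moebius_inversion fg k0) rmorph_sum /=.
  by apply: eq_bigr => e _; rewrite intrM.
by rewrite natrM mulKf // pnatr_eq0 -lt0n.
Qed.

(** Each [chi] counts Lyndon words, so the rational sum is a natural number and the truncation is
    exact. *)
Lemma basic_comm_countE n c d :
  basic_comm_count n c d = (\sum_(1 <= i < n.+1) lyndon_count d (c + i))%N.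
Proof.
rewrite /basic_comm_count (eq_big_nat _ _ (F2 := fun i => (lyndon_count d (c + i))%:R)).
  by rewrite -natr_sum natrK.
by move=> i /andP[i1 _]; rewrite chi_lyndon_count // addn_gt0 i1 orbT.
Qed.

End Moebius.

(** * A free presentation of the nilpotent product *)

Section Lifting.
Local Open Scope classical_set_scope.
Local Open Scope group_scope.

Definition hom_comp (A B C : groupType) (g : {multiplicative B -> C})
    (f : {multiplicative A -> B}) : {multiplicative A -> C} :=
  hom_of (g := fun x => g (f x))
    (fun x y => etrans (congr1 g (gmulfM (s := f) x y)) (gmulfM (s := g) _ _)).

(** Lift the images of the basis; uniqueness in the universal property identifies the composite with
    [h]. *)
Lemma free_lift (F A B : groupType) (p : {multiplicative A -> B})
    (h : {multiplicative F -> B}) : is_free F -> (forall b, exists a, p a = b) ->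
  exists f : {multiplicative F -> A}, forall x, p (f x) = h x.
Proof.
move=> [X [i iP]] ps.
have l (x : X) : {a | p a = h (i x)} by exact/cid/ps.
have [f fE _] := iP A (fun x => sval (l x)).
have [u uE uU] := iP B (fun x => h (i x)).
exists f => x; rewrite (uU h) //; apply: (uU (hom_comp p f)) => z /=.
by rewrite fE; case: (l z).
Qed.

Definition zexp (G : groupType) (g : G) : {multiplicative to_multiplicative int -> G} :=
  hom_of (@int_expgM G g).

Lemma fp_in_expg (I : choiceType) (G_ : I -> groupType) i (g : G_ i) k :
  fp_in (g ^+ k) = fp_in g ^+ k.
Proof. exact: (homX (hom_of (@fp_inM I G_ i))). Qed.

Lemma fp_in_int_expg (I : choiceType) (G_ : I -> groupType) i (g : G_ i) k :
  fp_in (int_expg g k) = int_expg (fp_in g) k.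
Proof. exact: (hom_int_expg (hom_of (@fp_inM I G_ i))). Qed.

Lemma free_product_gen (I : choiceType) (G_ : I -> groupType)
    (A : set (free_product G_)) : is_subgroup A ->
  (forall i (g : G_ i), A (fp_in g)) -> forall y, A y.
Proof.
move=> sA Ag y; rewrite -[y]reprK; elim: (repr y) => [|[i g] w IH].
  by rewrite pi_fp1; exact: (is_subgroup1 sA).
by rewrite -cat1s pi_fp_cat; apply: (is_subgroupM sA _ IH); exact: Ag.
Qed.

Lemma int_mul_expg (k : int) : int_expg (1%R : to_multiplicative int) k = k.
Proof.
exact/esym/(@int_hom_expg (to_multiplicative int) id (fun _ _ => erefl) k).
Qed.

End Lifting.

(** * Binomial coefficients and powers of [1 + a] *)

Section Binomials.
Local Open Scope ring_scope.

(** From [k C(r, k) = r C(r - 1, k - 1)], cancelling [k]. *)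
Lemma dvdn_bin_coprime r k : (0 < k)%N -> coprime k r -> (r %| 'C(r, k))%N.
Proof.
case: k => // k _ kr; case: r kr => [|r] kr.
  by rewrite bin0n.
by rewrite -(Gauss_dvdr _ (_ : coprime r.+1 k.+1)) 1?coprime_sym // -mul_bin_diag dvdn_mulr.
Qed.

Lemma one_var_exp a s w :
  ((1 + var a) ^+ s) w = ((w == nseq (size w) a) * 'C(s, size w))%N%:Z.
Proof.
elim: s w => [|s IH] [|b w]; rewrite ?expr0 ?exprS.
- by [].
- by rewrite series1E /= bin0n muln0.
- by rewrite -series_mulE series_mul_nil one_var_nil mul1r IH /= !bin0.
rewrite -series_mulE series_mul_cons series_mulE shift_1var one_var_nil mul1r IH.
rewrite [nseq _ _]/= eqseq_cons; case: eqP => _ /=; last by rewrite mul0r addr0.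
by rewrite mul1r IH -PoszD -mulnDr -binS.
Qed.

End Binomials.

(** * Generators, their orders and the kernel of the presentation *)

Section Presentation.
Local Open Scope classical_set_scope.
Local Open Scope group_scope.
Variables (n m t : nat) (r : nat -> nat).
Hypothesis r_gt1 : forall i, 1 <= i <= t -> 1 < r i.
Hypothesis r_dvd : forall i, 1 <= i <= t.-1 -> r i.+1 %| r i.
Hypothesis r_coprime : forall p, prime p -> p <= n -> gcdn p (r 1%N) = 1%N.

Definition factor_index : choiceType := ('I_m + 'I_t)%type.
Definition free_cover : groupType := free_product (fun _ : factor_index => to_multiplicative int).

(** The infinite factors come first, so that the orders [0, ..., 0, r 1, ..., r t] form a
    divisibility chain along the letters. *)
Definition letter_of (i : factor_index) : nat :=
  match i with inl i => i | inr j => m + j end.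

Lemma letter_of_lt i : letter_of i < m + t.
Proof.
by case: i => [i|j] /=; [exact: leq_trans (ltn_ord i) (leq_addr _ _)|rewrite ltn_add2l].
Qed.

Lemma letter_of_inj : injective letter_of.
Proof.
move=> [i|j] [i'|j'] /=.
- by move/val_inj ->.
- by move=> e; have := ltn_ord i; rewrite e ltnNge leq_addr.
- by move=> e; have := ltn_ord i'; rewrite -e ltnNge leq_addr.
- by move/addnI/val_inj ->.
Qed.

Lemma letter_of_surj a : a < m + t -> exists i, letter_of i = a.
Proof.
move=> at_; have [am|ma] := ltnP a m; first by exists (inl (Ordinal am)).
have jt : a - m < t by rewrite ltn_subLR.
by exists (inr (Ordinal jt)); rewrite /= subnKC.
Qed.

Definition gen0 (i : factor_index) : free_cover :=
  fp_in (G_ := fun _ : factor_index => to_multiplicative int) (i := i) (1%R : int).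

Definition gen_letter (a : nat) : free_cover :=
  if [pick i : 'I_m + 'I_t | letter_of i == a] is Some i then gen0 i else 1.

Lemma gen_letterE i : gen_letter (letter_of i) = gen0 i.
Proof.
rewrite /gen_letter; case: pickP => [j /eqP /letter_of_inj -> //|/(_ i)].
by rewrite eqxx.
Qed.

Lemma gen_letter_gen (A : set free_cover) : is_subgroup A ->
  (forall a, a < m + t -> A (gen_letter a)) -> forall y, A y.
Proof.
move=> sA Ax; apply: free_product_gen => // i k.
rewrite -(int_mul_expg k) fp_in_int_expg; apply: (is_subgroup_intX _ sA).
by rewrite -/(gen0 i) -gen_letterE; apply: Ax; exact: letter_of_lt.
Qed.

Lemma free_cover_free : is_free free_cover.
Proof. exact: free_product_int_free. Qed.

Lemma magnus_exists : exists phi : {multiplicative free_cover -> sunit},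
  forall a, a < m + t -> mag phi (gen_letter a) = (1 + var a)%R.
Proof.
have [phi phiE _] := free_productP (G_ := fun _ : factor_index => to_multiplicative int)
  (fun i => zexp (var_unit (letter_of i))).
exists phi => a /letter_of_surj [i <-]; rewrite gen_letterE /mag phiE.
by [].
Qed.

(* The generators of infinite order get order 0, so that divisibility by the
   order of a letter means vanishing. *)
Definition letter_order (a : nat) : nat := if a < m then 0 else r (a - m).+1.

Lemma letter_order_chain a b : a <= b < m + t -> letter_order b %| letter_order a.
Proof.
move=> /andP[ab bt]; rewrite /letter_order; have [//|ma] := ltnP a m.
have mb := leq_trans ma ab; rewrite ltnNge mb /=.
have : a - m <= b - m by exact: leq_sub2r.
have : b - m < t by rewrite ltn_subLR.
move: (a - m) (b - m) => i j jt ij; elim: j ij jt => [|j IH].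
  by rewrite leqn0 => /eqP ->.
rewrite leq_eqVlt => /orP[/eqP -> //|ij jt].
apply: dvdn_trans (IH ij (ltnW jt)); apply: r_dvd.
by rewrite /= -ltnS (ltn_predK jt).
Qed.

(** A prime dividing both [k] and [r 1] would be at most [n], which [r_coprime] excludes; so [k] is
    prime to every finite order. For order 0 the binomial vanishes. *)
Lemma letter_order_bin a k : a < m + t -> 0 < k <= n -> letter_order a %| 'C(letter_order a, k).
Proof.
move=> at_ /andP[k0 kn]; rewrite /letter_order; have [am|ma] := ltnP a m.
  by rewrite bin0n; case: k k0 {kn}.
apply: dvdn_bin_coprime => //.
have r1 : r (a - m).+1 %| r 1.
  have := @letter_order_chain m a; rewrite ma at_ /letter_order ltnn subnn ltnNge ma /=; exact.
apply: coprime_dvdr r1 _.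
rewrite /coprime -dvdn1; apply/negPn/negP => h.
have g1 : 1 < gcdn k (r 1).
  by rewrite ltn_neqAle eq_sym -dvdn1 h gcdn_gt0 k0.
have pp := pdiv_prime g1; have := pdiv_dvd (gcdn k (r 1)); rewrite dvdn_gcd => /andP[pk pr].
have := r_coprime pp (leq_trans (dvdn_leq k0 pk) kn).
by move/gcdn_idPl: pr => -> p1; rewrite p1 in pp.
Qed.

Section Factors.
Variable phi : {multiplicative free_cover -> sunit}.
Hypothesis phiE : forall a, a < m + t -> mag phi (gen_letter a) = (1 + var a)%R.

Lemma mag_dvd_power a : a < m + t -> mag_dvd phi letter_order n (gen_letter a ^+ letter_order a).
Proof.
move=> at_ w wn.
have -> : mag phi (gen_letter a ^+ letter_order a) = ((1 + var a) ^+ letter_order a)%R.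
  rewrite -(phiE at_); elim: (letter_order a) => [|s IH]; first by rewrite mag1.
  by rewrite expgS magM IH GRing.exprS.
case: w wn => [|b w] wn; rewrite seriesDE seriesNE series1E one_var_exp.
  by rewrite bin0 subrr dvdz0.
rewrite subr0; case: eqP => [->|_]; last by rewrite mul0n dvdz0.
rewrite mul1n size_nseq; have -> : word_gcd letter_order (nseq (size (b :: w)) a) = letter_order a.
  rewrite /word_gcd /=; elim: (size w) => [|s IH].
    by rewrite big_seq1.
  by rewrite big_cons IH gcdnn.
exact: letter_order_bin.
Qed.

Local Notation cyc := (@cyclic_factors m t r).

Definition cyc_gen (i : factor_index) : cyc i :=
  match i with inl _ => (1%R : int) | inr j => (1%R : 'Z_(r j.+1)) end.

Lemma Zr_expg q k : (1%R : finite_cyclic q) ^+ k = (k%:R : 'Z_q)%R.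
Proof. by elim: k => // k IH; rewrite expgS IH -[k.+1]add1n GRing.natrD. Qed.

Lemma cyc_genP i (g : cyc i) : exists k : int, g = int_expg (cyc_gen i) k.
Proof.
case: i g => [i|j] g; first by exists g; rewrite int_mul_expg.
exists (Posz (g : 'Z_(r j.+1))); rewrite /= Zr_expg; exact/esym/natr_Zp.
Qed.

Lemma cyc_gen_order (j : 'I_t) : cyc_gen (inr j) ^+ r j.+1 = 1.
Proof. by rewrite /= Zr_expg; apply: pchar_Zp; rewrite r_gt1 // ltn_ord. Qed.

Lemma cyc_hom_exists (H : groupType) (i : factor_index) (h : H) :
  h ^+ letter_order (letter_of i) = 1 -> exists u : {multiplicative cyc i -> H}, u (cyc_gen i) = h.
Proof.
case: i => [i|j] hr; first by exists (zexp h).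
move: hr; rewrite /letter_order /= ltnNge leq_addr /= addKn => hr.
have r1 : 1 < r j.+1 by apply: r_gt1; rewrite ltn_ord.
pose u (z : finite_cyclic (r j.+1)) := h ^+ (z : 'Z_(r j.+1)).
(* Arithmetic in ['Z_q] is modulo [(Zp_trunc q).+2], which is [q] only when [1 < q]. *)
have e : (Zp_trunc (r j.+1)).+2 = r j.+1 by exact: Zp_cast.
have mod_r k : h ^+ (k %% (Zp_trunc (r j.+1)).+2) = h ^+ k.
  by rewrite e [in RHS](divn_eq k (r j.+1)) expgnDr mulnC expgnA hr expg1n mul1g.
have uM : {morph u : x y / x * y}.
  by move=> x y; rewrite /u -expgnDr -[RHS]mod_r.
exists (hom_of uM); rewrite /= /u /=.
by rewrite modn_small ?expg1.
Qed.

Local Notation P := (free_product cyc).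
Local Notation G := (nilpotent_product n cyc).

Lemma proj_exists : exists p : {multiplicative free_cover -> P},
  forall i, p (gen0 i) = fp_in (cyc_gen i).
Proof.
have [p pE _] := free_productP (G_ := fun _ : factor_index => to_multiplicative int)
  (fun i => zexp (fp_in (G_ := cyc) (cyc_gen i))).
by exists p => i; rewrite pE.
Qed.

(** For the last clause, the quotient of the free group by [mag_dvd] receives a map from the free
    product of the cyclic groups, since the powers of the generators die in it. *)
Lemma presentation_exists : exists eta : {multiplicative free_cover -> G},
  [/\ forall y, exists x, eta x = y,
      forall x, lower_central n.+1 x -> eta x = 1,
      forall a, a < m + t -> eta (gen_letter a ^+ letter_order a) = 1 &
      forall x, eta x = 1 -> mag_dvd phi letter_order n x].
Proof.
have [p pE] := proj_exists.
pose q : {multiplicative P -> G} := lcq n.+1.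
have ps y : exists x, p x = y.
  suff [x _ <-] : (p @` setT) y by exists x.
  apply: free_product_gen y; first exact: is_subgroup_image.
  move=> i g; have [k ->] := cyc_genP g.
  by exists (int_expg (gen0 i) k) => //; rewrite hom_int_expg pE fp_in_int_expg.
exists (hom_comp q p); split.
- move=> y; have [z <-] := qproj_surj y; have [x <-] := ps z.
  by exists x.
- by move=> x Gx /=; apply/lcq1P; exact: hom_lower_central.
- move=> a at_; rewrite homX -[hom_comp q p _]/(q (p (gen_letter a))).
  have [i <-] := letter_of_surj at_; rewrite gen_letterE pE -homX -fp_in_expg.
  have -> : cyc_gen i ^+ letter_order (letter_of i) = 1.
    case: i => [i|j] /=; rewrite /letter_order; first by rewrite ltn_ord.
    by rewrite ltnNge leq_addr addKn; exact: cyc_gen_order.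
  have -> : fp_in (1 : cyc i) = 1 := hom1 (hom_of (@fp_inM _ cyc i)).
  exact: hom1.
move=> x /= /lcq1P px.
have nN := mag_dvd_normal phi letter_order n.
pose qN := qproj (NormalSubgroup nN).
have hexists i : {u : {multiplicative cyc i -> _} | u (cyc_gen i) = qN (gen0 i)}.
  apply: cid; apply: cyc_hom_exists; rewrite -homX; apply/qproj1P => /=.
  by rewrite -gen_letterE; apply: mag_dvd_power; exact: letter_of_lt.
have [th thE _] := free_productP (fun i => sval (hexists i)).
have thp y : th (p y) = qN y.
  apply: (gen_letter_gen (A := [set y | hom_comp th p y = qN y])) y.
    exact: is_subgroup_equalizer.
  move=> a /letter_of_surj [i <-]; rewrite /= gen_letterE pE thE.
  by case: (hexists i).
(* This [x'] in [gamma_(n+1)] of the free group has the same image as [x], hence agrees with it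
   modulo [mag_dvd]; its coefficients of positive length at most [n] vanish. *)
have [x' Gx' pxx'] := hom_lower_central_surj ps px.
apply/(qproj1P (NormalSubgroup nN)); rewrite -/qN -thp -pxx' thp.
apply/qproj1P => /= w wn.
have := lower_central_mag gen_letter_gen phiE Gx'; rewrite /mag_ge /= => -> //.
Qed.

End Factors.

End Presentation.

(** * The multiplier *)

Section LyndonIndices.
Variables (n c : nat).
Implicit Types (w : seq nat) (a d : nat).

Definition basis_words d : seq (seq nat) :=
  flatten [seq lyndon_words d k | k <- iota c.+1 n].

Lemma mem_basis_words d w : (w \in basis_words d) = Lyn d w && (c < size w <= c + n).
Proof.
apply/flattenP/andP => [[_ /mapP[k kn ->]]|[Lw wn]].
  rewrite mem_lyndon_words => /andP[-> /eqP ->]; split=> //.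
  by move: kn; rewrite mem_iota addSn ltnS.
exists (lyndon_words d (size w)); last by rewrite mem_lyndon_words Lw eqxx.
by apply: map_f; rewrite mem_iota addSn ltnS.
Qed.

Lemma uniq_basis_words d : uniq (basis_words d).
Proof.
apply: (uniq_flatten (g := size)); first exact: iota_uniq.
  by move=> k; rewrite filter_uniq // uniq_words.
by move=> k w; rewrite mem_lyndon_words => /andP[_ /eqP].
Qed.

Lemma size_basis_words d : size (basis_words d) = basic_comm_count n c d.
Proof.
rewrite basic_comm_countE size_flatten /shape -map_comp sumnE big_map.
have -> : iota c.+1 n = index_iota (1 + c) (n.+1 + c) by rewrite /index_iota addSn subSS addnK.
by rewrite big_addn addnK; apply: eq_bigr => i _; rewrite addnC.
Qed.

(** The words with largest letter [a], the letter whose order is the gcd of the word. *)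
Definition top_words a : seq (seq nat) := [seq w <- basis_words a.+1 | a \in w].

Lemma mem_top_words a w : (w \in top_words a) =
  [&& a \in w, Lyn a.+1 w & c < size w <= c + n].
Proof. by rewrite mem_filter mem_basis_words. Qed.

Lemma uniq_top_words a : uniq (top_words a).
Proof. by rewrite filter_uniq // uniq_basis_words. Qed.

Lemma size_top_words a :
  size (top_words a) = basic_comm_count n c a.+1 - basic_comm_count n c a.
Proof.
rewrite -!size_basis_words.
have -> : size (basis_words a) = size [seq w <- basis_words a.+1 | a \notin w].
  apply/perm_size/uniq_perm; rewrite ?filter_uniq ?uniq_basis_words // => w.
  rewrite mem_filter !mem_basis_words [RHS]andbA.
  have -> : (a \notin w) && Lyn a.+1 w = Lyn a w; last by [].
  rewrite /Lyn andbCA; congr (_ && _); elim: w => //= b w <-.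
  rewrite inE negb_or andbACA; congr (_ && _).
  by rewrite ltnS [b <= a]leq_eqVlt eq_sym; case: ltngtP.
by rewrite -(count_predC (fun w => a \in w) (basis_words a.+1)) -!size_filter addnK.
Qed.

Lemma exists_top_letter w : w != [::] ->
  exists2 a, a \in w & all (fun b => b < a.+1) w.
Proof.
elim: w => // b w IH _; have [->|w0] := eqVneq w [::].
  by exists b; rewrite ?mem_head //= ltnSn.
have [a aw wa] := IH w0; have [ba|ab] := leqP b a.
  by exists a; rewrite ?inE ?aw ?orbT //= ltnS ba.
exists b; rewrite ?mem_head //= ltnSn /=.
by apply/allP => e /(allP wa) ea; apply: leq_trans ea (ltnW _).
Qed.

Lemma basis_words_cases m t w : Lyn (m + t) w -> c < size w <= c + n ->
  w \in basis_words m \/ exists j : 'I_t, w \in top_words (m + j).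
Proof.
move=> Lw wn; have /andP[lw wd] := Lw.
have [a aw wa] := exists_top_letter (lyndon_neq0 lw).
have at_ := allP wd a aw; have [am|ma] := ltnP a m.
  left; rewrite mem_basis_words wn andbT /Lyn lw.
  by apply/allP => b /(allP wa) ba; exact: leq_trans ba am.
have jt : a - m < t by rewrite ltn_subLR.
by right; exists (Ordinal jt); rewrite /= subnKC // mem_top_words aw wn /Lyn lw wa.
Qed.

End LyndonIndices.

Lemma intr_Zp_eq0 q (k : int) : 1 < q -> (k%:~R = 0 :> 'Z_q)%R <-> (q %| k)%Z.
Proof.
move=> q1; have E (j : nat) : (j%:R = 0 :> 'Z_q)%R <-> q %| j.
  rewrite /dvdn; split=> [/(congr1 val)|/eqP h]; first by rewrite /= val_Zp_nat // => ->.
  by apply: val_inj; rewrite /= val_Zp_nat.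
case: k => j; first exact: E.
rewrite NegzE mulrNz dvdzE abszN; split=> [/eqP|/E h].
  by rewrite oppr_eq0 => /eqP /E.
by apply/eqP; rewrite oppr_eq0; apply/eqP.
Qed.

Lemma Lyn_leq d d' w : d <= d' -> Lyn d w -> Lyn d' w.
Proof.
move=> dd' /andP[lw /allP wd]; rewrite /Lyn lw.
by apply/allP => a /wd ad; exact: leq_trans dd'.
Qed.

Section WordGcd.
Variables (rho : nat -> nat) (d : nat).
Hypothesis rho_chain : forall a b, a <= b < d -> rho b %| rho a.

Lemma word_gcd_dvd_letter a w : a \in w -> word_gcd rho w %| rho a.
Proof.
elim: w => // b w IH; rewrite inE /word_gcd big_cons => /orP[/eqP ->|/IH].
  exact: dvdn_gcdl.
by move/(dvdn_trans (dvdn_gcdr _ _)).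
Qed.

Lemma word_gcd_top n c a w : a < d -> w \in top_words n c a -> word_gcd rho w = rho a.
Proof.
move=> ad; rewrite mem_top_words => /and3P[aw Lw _].
have wd : all (fun b => b < d) w.
  by case/andP: Lw => _ /allP wa; apply/allP => b /wa ba; exact: leq_trans ba ad.
have [b bw E] := word_gcd_letter rho_chain (Lyn_neq0 Lw) wd.
apply/eqP; rewrite eqn_dvd word_gcd_dvd_letter //= E; apply: rho_chain; rewrite ad.
by case/andP: Lw => _ /allP /(_ b bw); rewrite ltnS => ->.
Qed.

End WordGcd.

(** * The isomorphism read off from Lyndon coefficients *)

Section Assembly.
Local Open Scope group_scope.
Local Open Scope classical_set_scope.

Variables (n m t c : nat) (r : nat -> nat).
Hypothesis r_gt1 : forall i, 1 <= i <= t -> 1 < r i.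
Hypothesis r_dvd : forall i, 1 <= i <= t.-1 -> r i.+1 %| r i.
Hypothesis c_ge_n : n <= c.
Hypothesis r_coprime : forall p, prime p -> p <= n -> gcdn p (r 1%N) = 1%N.
Variables (F : groupType) (R : normal_subgroup F).
Hypothesis F_free : is_free F.

Local Notation G := (nilpotent_product n (@cyclic_factors m t r)).
Local Notation F0 := (free_cover m t).
Local Notation rho := (letter_order m r).
Local Notation dd := (basic_comm_count n c).

Variables (h : {multiplicative F -> G}).
Hypothesis h_ker : forall x, h x = 1 <-> normal_set R x.
Hypothesis h_surj : forall y, exists x, h x = y.

Local Notation target := (direct_power infinite_cyclic (dd m) *
  direct_sum (fun j : 'I_t =>
    direct_power (finite_cyclic (r j.+1)) (dd (m + j.+1) - dd (m + j))%N))%type.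

Lemma lower_central_nilpotent_product (y : G) : lower_central n.+1 y -> y = 1.
Proof.
move=> Gy; have [x Gx <-] := hom_lower_central_surj (@qproj_surj _ _) Gy.
exact/qproj1P.
Qed.

(** Lifts [alpha] and [beta] between the given presentation and the standard one are mutually
    inverse on [gamma_(c+1)] modulo the denominators. The isomorphism reads Lyndon coefficients
    after [alpha]; preimages are built in [F0] and brought back by [beta]. *)
Lemma multiplier_isomorphic : isomorphic (nilpotent_multiplier c R) target.
Proof.
have [phi phiE] := magnus_exists m t.
have [eta [eta_surj eta_lc eta_x eta_dvd]] := presentation_exists r_gt1 r_dvd r_coprime phiE.
pose R0 : set F0 := [set x | eta x = 1].
have nR0 : is_normal R0 := is_normal_ker eta.
have [alpha alphaE] := free_lift h F_free eta_surj.
have [beta betaE] := free_lift eta (free_cover_free m t) h_surj.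
have alphaR x : normal_set R x -> R0 (alpha x) by rewrite /R0 /= alphaE => /h_ker.
have betaR x : R0 x -> normal_set R (beta x) by move=> /= hx; apply/h_ker; rewrite betaE.
have x_gen := @gen_letter_gen m t.
have chain := letter_order_chain r_dvd (m := m).
have nR := normal_setP R.
(* The nilpotent product has class at most [n <= c], so the numerator is all of [gamma_(c+1)]. *)
have lcR (x : F) : lower_central c.+1 x -> normal_set R x.
  move=> Gx; apply/h_ker/lower_central_nilpotent_product/hom_lower_central.
  exact: lower_central_sub Gx.
have D_iff g : lower_central c.+1 g ->
    iter_commutator c R0 g <-> lyndon_dvd phi (m + t) n c rho g.
  move=> Gg; split.
    by apply: (D_lyndon_dvd x_gen phiE) => // x /eta_dvd.
  by apply: (lyndon_dvd_D x_gen phiE c_ge_n nR0) => // [x /eta_dvd|x /eta_lc|a /eta_x].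
have ba x : lower_central c.+1 x -> iter_commutator c R (x^-1 * beta (alpha x)).
  apply: (@hom_id_mod_iter_commutator _ (hom_comp beta alpha) R nR) => y /=.
  by apply/h_ker; rewrite gmulfM homV betaE alphaE mulVg.
have ab x : lower_central c.+1 x -> iter_commutator c R0 (x^-1 * alpha (beta x)).
  apply: (@hom_id_mod_iter_commutator _ (hom_comp alpha beta) R0 nR0) => y /=.
  by rewrite /R0 /= gmulfM homV alphaE betaE mulVg.
have MM (x y : F0) w : lower_central c.+1 x -> lower_central c.+1 y -> w != [::] ->
    size w <= c + n -> mag phi (x * y) w = (mag phi x w + mag phi y w)%R.
  move=> Gx Gy w0 wn; apply: (@mag_coefM _ _ c.+1) => //.
  - exact: (lower_central_mag x_gen phiE).
  - exact: (lower_central_mag x_gen phiE).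
  by rewrite (leq_ltn_trans wn) // addSn ltnS addnS ltnW // ltnS leq_add2l.
have basisP d w : w \in basis_words n c d -> w != [::] /\ size w <= c + n.
  by rewrite mem_basis_words => /andP[/Lyn_neq0 -> /andP[]].
have topP a w : w \in top_words n c a -> w != [::] /\ size w <= c + n.
  by rewrite mem_filter => /andP[_ /basisP].
have nthb (i : 'I_(dd m)) : nth [::] (basis_words n c m) i \in basis_words n c m.
  by rewrite mem_nth // size_basis_words.
have st (j : 'I_t) : size (top_words n c (m + j)) = dd (m + j.+1) - dd (m + j).
  by rewrite size_top_words addnS.
have ntht (j : 'I_t) (i : 'I_(dd (m + j.+1) - dd (m + j))) :
    nth [::] (top_words n c (m + j)) i \in top_words n c (m + j).
  by rewrite mem_nth // st.
pose N := multiplier_num c R.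
have NP (x : subgroup_type N) : lower_central c.+1 (alpha (val x)).
  by have /set_mem [_ Gx] := valP x; exact: hom_lower_central.
(* Words on the first [m] letters have gcd 0 and keep integer coefficients; words with top letter
   [m + j] are read modulo [r j.+1]. *)
pose f (x : subgroup_type N) : target :=
  ([ffun i : 'I_(dd m) =>
     mag phi (alpha (val x)) (nth [::] (basis_words n c m) i) : infinite_cyclic],
   [ffun j : 'I_t => [ffun i : 'I_(dd (m + j.+1) - dd (m + j)) =>
     ((mag phi (alpha (val x)) (nth [::] (top_words n c (m + j)) i))%:~R : 'Z_(r j.+1))%R
       : finite_cyclic (r j.+1)]]).
have fM : {morph f : x y / x * y}.
  move=> x y; rewrite /f valM gmulfM; congr (_, _).
    apply/ffunP => i; rewrite !ffunE; have [w0 wn] := basisP _ _ (nthb i).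
    exact: MM.
  apply/ffunP => j; rewrite !ffunE; apply/ffunP => i; rewrite !ffunE.
  have [w0 wn] := topP _ _ (ntht j i).
  by rewrite MM // intrD.
have Lb w : w \in basis_words n c m -> Lyn (m + t) w.
  by rewrite mem_basis_words => /andP[/(Lyn_leq (leq_addr t m))].
have Lt (j : 'I_t) w : w \in top_words n c (m + j) -> Lyn (m + t) w.
  rewrite mem_top_words => /and3P[_ Lw _]; apply: Lyn_leq Lw.
  by rewrite -addnS leq_add2l.
have gcd_basis w : w \in basis_words n c m -> word_gcd rho w = 0.
  move=> wb; have := wb; rewrite mem_basis_words => /andP[Lw _].
  have [_ wd] := andP (Lb _ wb); have [_ /allP wm] := andP Lw.
  have [b /wm bm ->] := word_gcd_letter chain (Lyn_neq0 Lw) wd.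
  by rewrite /letter_order bm.
have gcd_top (j : 'I_t) w : w \in top_words n c (m + j) -> word_gcd rho w = r j.+1.
  move=> wt; rewrite (word_gcd_top chain _ wt); last by rewrite ltn_add2l.
  by rewrite /letter_order ltnNge leq_addr addKn.
apply: (first_isomorphism (f := hom_of fM)) => [x|[y1 y2]].
  have Gax := NP x.
  have Gx : lower_central c.+1 (val x) by have /set_mem [] := valP x.
  (* The denominator is carried over by [alpha], and back by [beta] up to the correction [ba],
     itself in the denominator. *)
  have -> : normal_set (restrict N (multiplier_den c R)) x <->
      lyndon_dvd phi (m + t) n c rho (alpha (val x)).
    rewrite -D_iff //; split; first exact: hom_iter_commutator.
    move/(hom_iter_commutator (f := beta) betaR) => Rx.
    have sD := (iter_commutator_normal c nR).1.
    have := is_subgroupM sD Rx (is_subgroupV sD (ba _ Gx)).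
    by rewrite invgM invgK mulVKg.
  split=> [fx w Lw wn|dvd_x].
    have [wc|cw] := leqP (size w) c.
      rewrite (mag_ge0 (lower_central_mag x_gen phiE Gax)) ?dvdz0 //.
      exact: Lyn_neq0 Lw.
    have cwn : c < size w <= c + n by rewrite cw.
    have [wb|[j wt]] := basis_words_cases Lw cwn.
      have lt : index w (basis_words n c m) < dd m.
        by rewrite -size_basis_words index_mem.
      have := congr1 (fun p : target => p.1 (Ordinal lt)) fx.
      rewrite /= !ffunE /= nth_index // => e.
      by rewrite (e : mag phi (alpha (val x)) w = 0%R) dvdz0.
    have lt : index w (top_words n c (m + j)) < dd (m + j.+1) - dd (m + j).
      by rewrite -st index_mem.
    have := congr1 (fun p : target => p.2 j (Ordinal lt)) fx.
    rewrite /= !ffunE /= nth_index // (gcd_top j) // => e.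
    by apply/(intr_Zp_eq0 _ (r_gt1 (ltn_ord j : 1 <= j.+1 <= t))); exact: e.
  congr (_, _); first apply/ffunP => i; last (apply/ffunP => j; apply/ffunP => i).
    rewrite !ffunE; have wb := nthb i; have [_ wn] := basisP _ _ wb.
    by have := dvd_x _ (Lb _ wb) wn; rewrite gcd_basis // dvd0z => /eqP.
  rewrite !ffunE; have wt := ntht j i; have [_ wn] := topP _ _ wt.
  apply/intr_Zp_eq0; first by apply: r_gt1; rewrite ltn_ord.
  by have := dvd_x _ (Lt _ _ wt) wn; rewrite (gcd_top j).
(* For surjectivity, residues are lifted to integers; the lists of words are disjoint and free of
   repetitions, so each word receives one consistent value. *)
pose coef_ok w (v : int) :=
  (forall i : 'I_(dd m), nth [::] (basis_words n c m) i = w -> v = y1 i) /\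
  (forall (j : 'I_t) (i : 'I_(dd (m + j.+1) - dd (m + j))),
     nth [::] (top_words n c (m + j)) i = w -> (v%:~R = y2 j i :> 'Z_(r j.+1))%R).
have coef_ex w : exists v, coef_ok w v.
  have disj (j : 'I_t) : w \in basis_words n c m -> w \in top_words n c (m + j) -> False.
    rewrite mem_basis_words mem_top_words => /andP[/andP[_ /allP wm] _] /andP[/wm].
    by rewrite ltnNge leq_addr.
  have [wb|nwb] := boolP (w \in basis_words n c m).
    have lt : index w (basis_words n c m) < dd m by rewrite -size_basis_words index_mem.
    exists (y1 (Ordinal lt)); split=> [i iw|j i iw]; last first.
      by case: (disj j wb); rewrite -iw.
    congr (y1 _); apply: val_inj; rewrite /= -iw index_uniq ?uniq_basis_words //.
    by rewrite size_basis_words.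
  have [[j wt]|nwt] := pselect (exists j : 'I_t, w \in top_words n c (m + j)); last first.
    exists 0%R; split=> [i iw|j i iw]; first by rewrite -iw nthb in nwb.
    by case: nwt; exists j; rewrite -iw.
  have lt : index w (top_words n c (m + j)) < dd (m + j.+1) - dd (m + j).
    by rewrite -st index_mem.
  exists (Posz (y2 j (Ordinal lt) : 'Z_(r j.+1))); split=> [i iw|j' i iw].
    by case: (disj j _ wt); rewrite -iw.
  have wt' : w \in top_words n c (m + j') by rewrite -iw.
  have jj' : j = j'.
    move: wt wt'; rewrite !mem_top_words /Lyn.
    move=> /and3P[jw /andP[_ /allP wj] _] /and3P[jw' /andP[_ /allP wj'] _].
    have := wj' _ jw; have := wj _ jw'; rewrite !ltnS => h1 h2.
    by apply/val_inj/(@addnI m)/eqP; rewrite eqn_leq h1 h2.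
  subst j'; rewrite [LHS]natr_Zp; congr (y2 j _); apply: val_inj => /=.
  by rewrite -iw index_uniq ?uniq_top_words // st.
have [y yP] := choice coef_ex.
have [g Gg gE] := lyndon_coef_surj x_gen phiE c_ge_n y.
have Gbg : lower_central c.+1 (beta g) by exact: hom_lower_central.
have Nbg : beta g \in (normal_set N) by apply/mem_set; split=> //; exact: lcR.
exists (exist _ (beta g) Nbg).
(* Going through [beta] and [alpha] multiplies [g] by some [s] in the denominator, whose
   coefficients are divisible by the gcds and vanish in the target. *)
have Rg := ab g Gg; set s := g^-1 * alpha (beta g) in Rg.
have Gs : lower_central c.+1 s by exact: (iter_commutatorS (@subsetT _ R0) Rg).
have sE : alpha (beta g) = g * s by rewrite /s mulVKg.
have s_dvd : lyndon_dvd phi (m + t) n c rho s by exact/D_iff.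
congr (_, _); first apply/ffunP => i; last (apply/ffunP => j; apply/ffunP => i).
  rewrite !ffunE /= sE; have wb := nthb i; have [w0 wn] := basisP _ _ wb.
  have cw := wb; rewrite mem_basis_words in cw; have /andP[_ cwn] := cw.
  rewrite MM // (gE _ (Lb _ wb) cwn).
  have := s_dvd _ (Lb _ wb) wn; rewrite gcd_basis // dvd0z => /eqP.
  move=> ->; rewrite addr0; exact: (yP _).1.
rewrite !ffunE /= sE; have wt := ntht j i; have [w0 wn] := topP _ _ wt.
have cw := wt; rewrite mem_top_words in cw; have /and3P[_ _ cwn] := cw.
rewrite MM // (gE _ (Lt _ _ wt) cwn) intrD.
have := s_dvd _ (Lt _ _ wt) wn; rewrite (gcd_top j) // => /intr_Zp_eq0.
move=> ->; last by apply: r_gt1; rewrite ltn_ord.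
by rewrite addr0; exact: (yP _).2.
Qed.

End Assembly.

Theorem theorem3p3 (n m t c : nat) (r : nat -> nat)
    (n_ge1 : 1 <= n) (t_ge1 : 1 <= t)
    (r_gt1 : forall i, 1 <= i <= t -> 1 < r i)
    (r_dvd : forall i, 1 <= i <= t.-1 -> r i.+1 %| r i)
    (c_ge_n : n <= c)
    (r_coprime : forall p, prime p -> p <= n -> gcdn p (r 1) = 1)
    (F : groupType) (R : normal_subgroup F)
    (F_free : is_free F)
    (presentation : isomorphic (nilpotent_product n (@cyclic_factors m t r))
                               (quotient_group R)) :
  let d := basic_comm_count n c in
  isomorphic (nilpotent_multiplier c R)
    (direct_power infinite_cyclic (d m) *
     direct_sum (fun j : 'I_t =>
       direct_power (finite_cyclic (r j.+1)) (d (m + j.+1) - d (m + j))%N))%type.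
Proof.
(* The required surjection with kernel [R] is the projection onto the quotient followed by the
   inverse of the given isomorphism. *)
have [psi [g psiK gK]] := presentation.
pose g' := hom_of (can2_gmulfM psiK gK).
apply: (multiplier_isomorphic r_gt1 r_dvd c_ge_n r_coprime F_free (h := hom_comp g' (qproj R))).
  move=> x; rewrite -(qproj1P R) /=; split=> [gx|qx].
    by rewrite -[LHS]gK [X in psi X]gx hom1.
  by rewrite [X in g X]qx -(hom1 psi) psiK.
move=> y; have [x xE] := qproj_surj (psi y).
by exists x; rewrite /= [X in g X]xE psiK.
Qed.
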